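(* Let $m\in\{1,\dots,N\}$, $0<\gamma<N$ and $\alpha>0$ be such that $\alpha<\dfrac{2}{\gamma+m}$. Let $v_0\in\widetilde{\mathcal X_{m,\gamma}}$ with $v_0|_{\Omega_m}\ge0$, and let $v(t)=\mathcal S(t)v_0$ be the resulting solution of $v_t-\Delta v+|v|^\alpha v=0$. Suppose that there exist $R_0>0$ and $c_0>0$ such that $$v_0(x)\ge c_0\psi_0(x),\qquad x\in\Omega_m,\ |x|\ge R_0.$$ Then $$\lim_{t\to\infty}t^{1/\alpha}v(t,x\sqrt t)=g(x)$$ uniformly on compact subsets of $\mathbb R^N$, where $g\in C^{b,u}(\mathbb R^N)$ is the antisymmetric (bounded, uniformly continuous) profile of the self-similar solution $V(t,x)=t^{-1/\alpha}g(x/\sqrt t)$ given by $V=\lim_{\lambda\to\infty}\Gamma_\lambda^{2/\alpha}w$, $w$ being the solution of the same equation on $\mathbb R^N$ whose initial value is the antisymmetric function $h\in L^\infty(\mathbb R^N)$ with $h=1$ on $\Omega_m$.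
   Context: $N\ge1$ is an integer. $\Omega_m=\{x\in\mathbb R^N: x_1>0,\dots,x_m>0\}$. Let $\rho_m(x)=\dfrac{|x|^{\gamma+2m}}{x_1\cdots x_m}$ for $x\in\Omega_m$. $\mathcal X_{m,\gamma}$ is the Banach space of (a.e. classes of) measurable $\psi:\Omega_m\to\mathbb R$ with $\rho_m\psi\in L^\infty(\Omega_m)$, normed by $\|\psi\|_{\mathcal X_{m,\gamma}}=\|\rho_m\psi\|_{L^\infty(\Omega_m)}$. $\psi_0(x)=c_{m,\gamma}\,x_1\cdots x_m|x|^{-\gamma-2m}$ on $\Omega_m$, with $c_{m,\gamma}=\gamma(\gamma+2)\cdots(\gamma+2m-2)$. A function $f:\mathbb R^N\to\mathbb R$ is antisymmetric (with respect to $x_1,\dots,x_m$) if it changes sign under each reflection $x_i\mapsto-x_i$, $1\le i\le m$; $\mathcal A$ is the set of such functions. For $\psi:\Omega_m\to\mathbb R$, $\widetilde\psi$ is its pointwise antisymmetric extension to $\mathbb R^N$. $\widetilde{\mathcal X_{m,\gamma}}=\{\widetilde\psi:\psi\in\mathcal X_{m,\gamma}\}$ with norm $\|\varphi\|_{\widetilde{\mathcal X_{m,\gamma}}}=\|\varphi|_{\Omega_m}\|_{\mathcal X_{m,\gamma}}$. $C_0(\mathbb R^N)$ is the space of continuous functions vanishing at infinity with the sup norm; $C^{b,u}(\mathbb R^N)$ is the space of bounded uniformly continuous functions. For $v_0\in\widetilde{\mathcal X_{m,\gamma}}$, $\mathcal S(t)v_0=v(t)$, $t>0$, where $v\in C((0,\infty),C_0(\mathbb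 R^N)\cap\mathcal A)$ is the unique (classical on $(0,\infty)\times\mathbb R^N$) solution of $v_t-\Delta v+|v|^\alpha v=0$ such that $v(t)\to v_0$ in $L^1_{\rm loc}(\mathbb R^N\setminus\{0\})$ as $t\to0$ and $\|v(t)\|_{\widetilde{\mathcal X_{m,\gamma}}}\le C\|v_0\|_{\widetilde{\mathcal X_{m,\gamma}}}$ for all $t>0$ with $C$ independent of $v_0$ (existence and uniqueness of such $v$ being known). For $w_0\in L^\infty(\mathbb R^N)$, the solution with initial value $w_0$ is the unique $w\in C((0,\infty);C^{b,u}(\mathbb R^N))$ satisfying $w(t)=e^{t\Delta}w_0-\int_0^te^{(t-s)\Delta}(|w(s)|^\alpha w(s))\,ds$ for $t>0$, where $e^{t\Delta}$ is convolution with $(4\pi t)^{-N/2}e^{-|x|^2/4t}$; it is a classical solution for $t>0$ and $\|w(t)-e^{t\Delta}w_0\|_{L^\infty}\to0$ as $t\to0$. Dilations: $\Gamma_\lambda^{2/\alpha}w(t,x)=\lambda^{2/\alpha}w(\lambda^2t,\lambda x)$. With $w_0=h$, the limit $V=\lim_{\lambda\to\infty}\Gamma_\lambda^{2/\alpha}w$ exists uniformly on compact subsets of $(0,\infty)\times\mathbb R^N$ and is a self-similar solution ($\Gamma_\lambda^{2/\alpha}V=V$ for all $\lambda>0$), with $g=V(1,\cdot)\in C^{b,u}(\mathbb R^N)$ antisymmetric. *)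

(* Defs.v *)
From HB Require Import structures.
From mathcomp Require Import all_boot all_order all_algebra.
From mathcomp Require Import all_classical all_reals all_analysis.

Set Implicit Arguments.
Unset Strict Implicit.
Unset Printing Implicit Defensive.

Import Order.TTheory GRing.Theory Num.Theory.
Import numFieldNormedType.Exports.

Local Open Scope classical_set_scope.
Local Open Scope ring_scope.

(* R^n = 'rV[R]_n gets the sigma-algebra generated by the coordinates (i.e. the
   Borel one), and Lebesgue measure on it is the n-fold product of the
   one-dimensional Lebesgue measure. *)
Section measurable_rV.
Context {R : realType} (n : nat).

Let coor (i : 'I_n) (x : 'rV[R]_n) : measurableTypeR R := x ord0 i.

Let rV_set0 : g_sigma_preimage coor set0.
Proof. exact: sigma_algebra0. Qed.

Let rV_setC A : g_sigma_preimage coor A -> g_sigma_preimage coor (~` A).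
Proof. exact: sigma_algebraC. Qed.

Let rV_bigcup (F : (set 'rV[R]_n)^nat) : (forall i, g_sigma_preimage coor (F i)) ->
  g_sigma_preimage coor (\bigcup_i (F i)).
Proof. exact: sigma_algebra_bigcup. Qed.

HB.instance Definition _ :=
  @isMeasurable.Build default_measure_display
    'rV[R]_n (g_sigma_preimage coor) rV_set0 rV_setC rV_bigcup.

Lemma measurable_rV_coord (i : 'I_n) :
  measurable_fun [set: 'rV[R]_n] (fun x : 'rV[R]_n => x ord0 i).
Proof.
move=> _ Y mY; rewrite setTI; apply: sub_sigma_algebra => /=.
rewrite -bigcup_seq/=; exists i => /=; first by rewrite mem_index_enum.
by exists Y => //; rewrite setTI.
Qed.

Lemma measurable_fun_rV d (T : measurableType d) (f : T -> 'rV[R]_n) :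
  (forall i, measurable_fun [set: T] (fun t => f t ord0 i)) ->
  measurable_fun [set: T] f.
Proof.
move=> mf _ Y mY; rewrite setTI.
suff : [set A | measurable (f @^-1` A)] Y by [].
move: Y mY; apply: smallest_sub.
  split => /=.
  - by rewrite preimage_set0.
  - by move=> A mA; rewrite setTD preimage_setC; exact: measurableC.
  - by move=> F mF; rewrite preimage_bigcup; exact: bigcup_measurable.
rewrite -bigcup_seq/= => A [i _] [B mB <-] /=.
rewrite setTI -comp_preimage -[X in measurable X]setTI.
exact: mf.
Qed.

End measurable_rV.

Section lebesgue_rV.
Context {R : realType}.

Definition cons_rV n (p : R * 'rV[R]_n) : 'rV[R]_n.+1 := row_mx p.1%:M p.2.

Definition uncons_rV n (x : 'rV[R]_n.+1) : R * 'rV[R]_n :=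
  (x ord0 ord0, \row_j x ord0 (lift ord0 j)).

Lemma measurable_cons_rV n :
  measurable_fun [set: measurableTypeR R * 'rV[R]_n] (@cons_rV n).
Proof.
apply: measurable_fun_rV => i.
have [j ij|j ij] := split_ordP (i : 'I_(1 + n)).
  rewrite (_ : (fun t => _) = fst); first exact: measurable_fst.
  by apply/funext => t; rewrite /cons_rV /= ij [LHS](row_mxEl t.1%:M t.2 ord0 j) mxE !ord1 eqxx mulr1n.
rewrite (_ : (fun t => _) = (fun y : 'rV[R]_n => y ord0 j) \o snd).
  exact: (measurableT_comp (measurable_rV_coord j) measurable_snd).
by apply/funext => t; rewrite /cons_rV /= ij [LHS](row_mxEr t.1%:M t.2 ord0 j).
Qed.

Lemma measurable_uncons_rV n :
  measurable_fun [set: 'rV[R]_n.+1] (@uncons_rV n : _ -> measurableTypeR R * _).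
Proof.
apply: measurable_fun_pair; first exact: measurable_rV_coord.
apply: measurable_fun_rV => i.
under eq_fun do rewrite mxE.
exact: measurable_rV_coord.
Qed.

Lemma cons_rVK n : cancel (@cons_rV n) (@uncons_rV n).
Proof.
move=> [x y]; rewrite /cons_rV /uncons_rV /=; congr pair.
  have -> : ord0 = lshift n (ord0 : 'I_1) :> 'I_n.+1 by exact: val_inj.
  by rewrite [LHS](row_mxEl x%:M y ord0 ord0) mxE eqxx mulr1n.
apply/rowP => j; rewrite mxE.
have -> : lift ord0 j = rshift 1 j :> 'I_n.+1 by exact: val_inj.
exact: (row_mxEr x%:M y ord0 j).
Qed.

Section cons_measure.
Variables (n : nat) (mu : {sigma_finite_measure set 'rV[R]_n -> \bar R}).

Definition cons_measure : set 'rV[R]_n.+1 -> \bar R :=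
  pushforward (@lebesgue_measure R \x mu)%E (@cons_rV n).

Let cons_measure0 : cons_measure set0 = 0%E.
Proof. by rewrite /cons_measure /pushforward preimage_set0 measure0. Qed.

Let cons_measure_ge0 A : (0 <= cons_measure A)%E.
Proof. by rewrite /cons_measure /pushforward measure_ge0. Qed.

Let mpreimage_cons A : measurable A -> measurable (@cons_rV n @^-1` A).
Proof.
move=> mA; rewrite -[X in measurable X]setTI.
exact: measurable_cons_rV.
Qed.

Let cons_measure_sigma_additive : semi_sigma_additive cons_measure.
Proof.
move=> F mF tF mUF; rewrite /cons_measure /pushforward preimage_bigcup.
apply: measure_semi_sigma_additive.
- by move=> k; exact: mpreimage_cons.
- apply/trivIsetP => /= i j _ _ ij; rewrite -preimage_setI.
  by move/trivIsetP : tF => /(_ _ _ _ _ ij) ->//; rewrite preimage_set0.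
- by rewrite -preimage_bigcup; exact: mpreimage_cons.
Qed.

HB.instance Definition _ := isMeasure.Build _ _ _ cons_measure
  cons_measure0 cons_measure_ge0 cons_measure_sigma_additive.

Let cons_measure_sigma_finite : sigma_finite setT cons_measure.
Proof.
have /sigma_finiteP[F [TF ndF mF]] := sigma_finiteT (@lebesgue_measure R).
have /sigma_finiteP[G [TG ndG mG]] := sigma_finiteT mu.
exists (fun k => @uncons_rV n @^-1` (F k `*` G k)).
  rewrite -preimage_bigcup (_ : \bigcup_k _ = setT) ?preimage_setT//.
  rewrite -subTset => -[x y] _.
  have [i _ Fx] : (\bigcup_k F k) x by rewrite -TF.
  have [j _ Gy] : (\bigcup_k G k) y by rewrite -TG.
  exists (maxn i j) => //; split.
    by move: x Fx; exact/subsetPset/ndF/leq_maxl.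
  by move: y Gy; exact/subsetPset/ndG/leq_maxr.
move=> k; have [mFk Fkoo] := mF k; have [mGk Gkoo] := mG k; split.
  rewrite -[X in measurable X]setTI; apply: measurable_uncons_rV => //.
  exact: measurableX.
rewrite /cons_measure /pushforward -comp_preimage.
rewrite (_ : _ \o _ = id) ?preimage_id; last first.
  by apply/funext => p; exact: cons_rVK.
by rewrite product_measure1E// lte_mul_pinfty// ge0_fin_numE.
Qed.

HB.instance Definition _ := Measure_isSigmaFinite.Build _ _ _ cons_measure
  cons_measure_sigma_finite.

End cons_measure.

Fixpoint lebesgue_rV n : {sigma_finite_measure set 'rV[R]_n -> \bar R} :=
  if n is n'.+1 then cons_measure (lebesgue_rV n') else dirac (0 : 'rV[R]_0).

Lemma lebesgue_rV_box n (A : 'I_n -> set R) :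
  (forall i, measurable (A i : set (measurableTypeR R))) ->
  lebesgue_rV n [set x | forall i, A i (x ord0 i)] =
  (\prod_(i < n) lebesgue_measure (A i))%E.
Proof.
elim: n A => [|n IH] A mA /=.
  by rewrite big_ord0 diracE mem_set// => -[].
rewrite big_ord_recl -IH// /cons_measure /pushforward.
rewrite (_ : _ @^-1` _ =
    A ord0 `*` [set x : 'rV[R]_n | forall i, A (lift ord0 i) (x ord0 i)]).
  rewrite product_measure1E//.
  rewrite (_ : [set _ | _] = \bigcap_(i in [set: 'I_n])
      ((fun x : 'rV[R]_n => x ord0 i) @^-1` A (lift ord0 i))); last first.
    by apply/seteqP; split => [x Ax i _|x Ax i]; exact: Ax.
  apply: fin_bigcap_measurable => // i _.
  rewrite -[X in measurable X]setTI; apply: (measurable_rV_coord _ measurableT).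
  exact: mA.
have E x y j : @cons_rV n (x, y) ord0 (lift ord0 j) = y ord0 j.
  by move/(congr1 (fun p : R * 'rV[R]_n => p.2 ord0 j)): (cons_rVK (x, y)); rewrite /= mxE.
have E0 x y : @cons_rV n (x, y) ord0 ord0 = x.
  by move: (congr1 (fun p : R * 'rV[R]_n => p.1) (cons_rVK (x, y))) => /=.
apply/seteqP; split => -[x y] /=.
  by move=> H; split=> [|i]; [rewrite -(E0 x y)|rewrite -(E x y)]; exact: H.
move=> [H0 H] i; case: (unliftP ord0 i) => [j ->|->]; first by rewrite E; exact: H.
by rewrite E0.
Qed.

End lebesgue_rV.

Section sectorial_spaces.
Context {R : realType} {N : nat}.
Implicit Types (m : nat) (gamma : R) (x : 'rV[R]_N) (psi f : 'rV[R]_N -> R).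

(* The library norm `|x| on 'rV[R]_N is the sup norm; it induces the same
   topology and uniformity, but |x| below has to be the Euclidean norm. *)
Definition enorm x : R := Num.sqrt (\sum_(i < N) x ord0 i ^+ 2).

(* Coordinates are numbered from 0: x_1, ..., x_m are the x ord0 i, i < m. *)
Definition Omega m : set 'rV[R]_N :=
  [set x | forall i : 'I_N, (i < m)%N -> 0 < x ord0 i].

Definition rho m gamma x : R :=
  enorm x `^ (gamma + (2 * m)%:R) / \prod_(i < N | (i < m)%N) x ord0 i.

(* The L^oo(Omega_m) norm, taken on R^N after extension by 0. *)
Definition Xnorm m gamma psi : \bar R :=
  'N[lebesgue_rV N]_(+oo%E)[EFin \o ((rho m gamma \* psi) \_ (Omega m))].

(* A function on Omega_m is represented by a function on R^N whose values
   outside Omega_m are never used. *)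
Definition Xspace m gamma : set ('rV[R]_N -> R) :=
  [set psi | measurable_fun (Omega m) psi /\ (Xnorm m gamma psi < +oo)%E].

Definition psi0 m gamma x : R :=
  (\prod_(k < m) (gamma + (2 * k)%:R)) *
  (\prod_(i < N | (i < m)%N) x ord0 i) * enorm x `^ (- gamma - (2 * m)%:R).

Definition reflection (i : 'I_N) x : 'rV[R]_N :=
  \row_j (if j == i then - x ord0 j else x ord0 j).

Definition antisymmetric_fun m : set ('rV[R]_N -> R) :=
  [set f | forall (i : 'I_N) x, (i < m)%N -> f (reflection i x) = - f x].

(* As Num.sg 0 = 0, the extension vanishes on the hyperplanes x_i = 0. *)
Definition antisym_ext m psi : 'rV[R]_N -> R := fun x =>
  (\prod_(i < N | (i < m)%N) Num.sg (x ord0 i)) *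
  psi (\row_j (if (j < m)%N then `|x ord0 j| else x ord0 j)).

Definition antisym_Xspace m gamma : set ('rV[R]_N -> R) :=
  [set antisym_ext m psi | psi in Xspace m gamma].

Definition C0_fun : set ('rV[R]_N -> R) :=
  [set f | continuous f /\
    forall e, 0 < e -> exists r, forall x, r <= enorm x -> `|f x| <= e].

Definition Cbu_fun : set ('rV[R]_N -> R) :=
  [set f | (exists M, forall x, `|f x| <= M) /\ unif_continuous f].

End sectorial_spaces.

Section absorption_equation.
Context {R : realType} {N : nat}.
Implicit Types (alpha t : R) (x : 'rV[R]_N) (f : 'rV[R]_N -> R).
Implicit Types (u v w : R -> 'rV[R]_N -> R).

Definition partial (i : 'I_N) f : 'rV[R]_N -> R :=
  fun x => 'D_(delta_mx ord0 i) f x.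

Definition laplacian f : 'rV[R]_N -> R :=
  fun x => \sum_(i < N) partial i (partial i f) x.

Definition absorption alpha f : 'rV[R]_N -> R :=
  fun x => `|f x| `^ alpha * f x.

(* A function of (t, x) is only meaningful for 0 < t. *)
Definition C12 u := forall t x, 0 < t ->
  [/\ derivable (u ^~ x) t 1,
      (forall i, derivable (u t) x (delta_mx ord0 i)) &
      (forall i j, derivable (partial i (u t)) x (delta_mx ord0 j))] /\
  [/\ {for (t, x), continuous (fun p : R * 'rV[R]_N => u p.1 p.2)},
      {for (t, x), continuous (fun p : R * 'rV[R]_N => derive1 (u ^~ p.2) p.1)},
      (forall i, {for (t, x), continuous
        (fun p : R * 'rV[R]_N => partial i (u p.1) p.2)}) &
      (forall i j, {for (t, x), continuous
        (fun p : R * 'rV[R]_N => partial j (partial i (u p.1)) p.2)})].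

Definition classical_solution alpha u := C12 u /\
  forall t x, 0 < t ->
    derive1 (u ^~ x) t - laplacian (u t) x + absorption alpha (u t) x = 0.

(* v(t) = S(t) v0.  The uniform limits are limits in the sup norm; C is the
   constant of the a priori bound, fixed independently of v0. *)
Definition is_flow (m : nat) (gamma alpha C : R) (v0 : 'rV[R]_N -> R) v :=
  [/\ (forall t, 0 < t -> [/\ C0_fun (v t), antisymmetric_fun m (v t) &
         {uniform, v @ t --> v t}]),
      classical_solution alpha v,
      (forall K : set 'rV[R]_N, compact K -> ~ K 0 ->
         (\int[lebesgue_rV N]_(x in K) `|v t x - v0 x|%:E)%E
           @[t --> 0^'+] --> 0%E) &
      (forall t, 0 < t ->
         (Xnorm m gamma (v t) <= C%:E * Xnorm m gamma v0)%E)].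

Definition heat_kernel t x : R :=
  (4 * pi * t) `^ (- (N%:R / 2)) * expR (- (enorm x ^+ 2 / (4 * t))).

Definition heat t f : 'rV[R]_N -> R :=
  fun x => \int[lebesgue_rV N]_y (heat_kernel t (x - y) * f y).

(* The solution with a bounded initial value w0.  The last condition makes w
   bounded near t = 0, so that the time integral converges. *)
Definition is_bounded_solution alpha (w0 : 'rV[R]_N -> R) w :=
  [/\ (forall t, 0 < t -> Cbu_fun (w t) /\ {uniform, w @ t --> w t}),
      (forall t x, 0 < t -> w t x = heat t w0 x -
         \int[lebesgue_measure]_(s in `]0, t[)
           heat (t - s) (absorption alpha (w s)) x),
      classical_solution alpha w &
      {uniform, (fun t => w t \- heat t w0) @ 0^'+ --> (cst 0 : 'rV[R]_N -> R)}].

Definition dilation alpha (lambda : R) u : R -> 'rV[R]_N -> R :=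
  fun t x => lambda `^ (2 / alpha) * u (lambda ^+ 2 * t) (lambda *: x).

Definition dilation_limit alpha w (V : R -> 'rV[R]_N -> R) :=
  forall K : set (R * 'rV[R]_N), compact K -> K `<=` [set p | 0 < p.1] ->
    {uniform K, (fun lambda (p : R * 'rV[R]_N) => dilation alpha lambda w p.1 p.2)
       @ +oo --> (fun p : R * 'rV[R]_N => V p.1 p.2)}.

End absorption_equation.

(* Main.v *)
Require Import Defs.
From mathcomp Require Import all_boot all_order all_algebra.
From mathcomp Require Import all_classical all_reals all_analysis.
From mathcomp Require Import measurable_realfun ring lra.

Set Implicit Arguments.
Unset Strict Implicit.
Unset Printing Implicit Defensive.

Import Order.TTheory GRing.Theory Num.Theory.
Import numFieldNormedType.Exports.

Local Open Scope classical_set_scope.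
Local Open Scope ring_scope.

(* Work on the sector x_1, ..., x_m >= 0, where v, V and the dilations of w are
   nonnegative and vanish on the faces, and let l = sqrt t, so that the claim is
   l^{2/alpha} v(l^2, l x) -> V(1, x).

   Upper bound: for tau > 0 the bounded function v(tau) lies below a dilation of w with
   a large parameter near its initial time, so v(tau + s) <= V(s); let tau -> 0. Then
   rescale, V being invariant under dilations.

   Lower bound: dilate w by mu / l, with mu fixed and l -> oo; its initial value is the
   constant Q = (mu / l)^{2/alpha} on the sector. By the maximum principle the difference
   of this solution and v is at most the heat potential, for the odd reflection kernel
   of the sector, of the positive part of Q - v0. As alpha < 2 / (gamma + m), c0 psi0 is
   larger than Q at the points y with y_i > d l and |y - l x| <= L l, so that only the
   Gaussian mass of the other points counts, and it is small with d and 1 / L, uniformly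
   in l. Hence the limit is at least the dilation of w by mu at time 1, which tends to
   V(1, .) as mu -> oo.

   The profile V(1, .) is Lipschitz because each dilation of w stays below the spatially
   constant solution (alpha t)^{-1/alpha}, and is compared with its mirror images. *)

(** * Parabolic inequalities and the maximum principle *)

(** Nothing represents v near t = 0: the weighted bound lets v0 grow like |x|^(-gamma-m) at the
    origin, and v(t) tends to v0 only in L^1_loc away from 0. So v has no Duhamel formula and cannot
    be compared with anything at time 0. Every comparison starts at some tau > 0, and the gap
    |v(tau) - v0| is controlled by an integrable majorant independent of tau. This is where gamma <
    N enters: the odd kernel vanishes on the faces like y_1...y_m, and this factor reduces the
    singularity to |y|^(-gamma).

    The nonlinearity is never estimated. Being monotone, it makes the difference of two solutions a
    subsolution of the heat equation wherever that difference is positive, and antisymmetry makes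
    the difference vanish on the faces. One maximum principle on closed, possibly unbounded sets
    therefore serves for the sector, for a strip and for the whole space. *)

Section derive2.
Context {R : realType}.
Implicit Types (f g : R -> R) (x a b : R).

Lemma is_derive_quotient f x a e : is_derive x 1 f a -> 0 < e ->
  \forall h \near (0 : R)^', `|a - h^-1 * (f (h + x) - f x)| < e.
Proof.
move=> [df fa] e0.
have : h^-1 *: (f (h *: 1 + x) - f x) @[h --> (0:R)^'] --> a.
  by rewrite -fa; exact: df.
move=> /cvgrPdist_lt /(_ _ e0); apply: filterS => h.
by rewrite /GRing.scale/= mulr1.
Qed.

(** Only points to the left of x are tested, because in the maximum principle the maximum may be
    attained at the final time. *)
Lemma is_derive_ge0_left f x a : is_derive x 1 f a ->
  (\forall s \near x^'-, f s <= f x) -> 0 <= a.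
Proof.
move=> fa fx; rewrite leNgt; apply/negP => a0.
have /(is_derive_quotient fa) : 0 < - a by rewrite oppr_gt0.
move=> [d /= d0 hd].
case: fx => [d' /= d'0 hd'].
pose h := - (Num.min d d' / 2).
have hm : 0 < Num.min d d' by rewrite lt_min d0 d'0.
have h0 : h < 0 by rewrite /h oppr_lt0 divr_gt0.
have hmd : - h < Num.min d d' by rewrite /h opprK ltr_pdivrMr// ltr_pMr// ltr1n.
have [hd1 hd2] : - h < d /\ - h < d' by apply/andP; rewrite -lt_min.
have H1 : `|a - h^-1 * (f (h + x) - f x)| < - a.
  by apply: hd => /=; [rewrite sub0r normrN ltr0_norm|rewrite lt_eqF].
have H2 : f (h + x) <= f x.
  by apply: hd' => /=; [rewrite opprD addrCA subrr addr0 normrN ltr0_norm|rewrite gtrDr].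
have H3 : 0 <= h^-1 * (f (h + x) - f x).
  by apply: mulr_le0; rewrite ?invr_le0 ?(ltW h0)// subr_le0.
by move: H1; rewrite ltr_norml; lra.
Qed.

(** A relation with a witness f1 for the first derivative near x: sums, multiples and affine
    substitutions act on the witness directly. *)
Definition has_derive2 f x b := exists2 f1 : R -> R,
  (\forall y \near x, is_derive (y : R) 1 f (f1 y)) & is_derive x 1 f1 b.

(** Maximality on the left gives f1 x >= 0. If b > 0, then f1 is positive just to the right of x,
    and the mean value theorem contradicts maximality on the right. *)
Lemma has_derive2_max f x b : has_derive2 f x b ->
  (\forall s \near x, f s <= f x) -> b <= 0.
Proof.
move=> [f1 df ddf] fx; rewrite leNgt; apply/negP => b0.
have f1x : 0 <= f1 x.
  apply: (@is_derive_ge0_left f x); first exact: nbhs_singleton df.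
  by apply: cvg_within fx.
have [d0 /= d00 hd0] := is_derive_quotient ddf b0.
case: df => d1 /= d10 hd1; case: fx => d2 /= d20 hd2.
pose d := Num.min d0 (Num.min d1 d2).
have dm : 0 < d by rewrite !lt_min d00 d10 d20.
have dle : (d <= d0) /\ (d <= d1) /\ (d <= d2).
  by rewrite /d !ge_min !lexx ?orbT.
pose y := x + d / 2.
have xy : x < y by rewrite /y; lra.
have H c : c \in `]x, y[ -> is_derive c 1 f (f1 c).
  rewrite in_itv/= => /andP[xc cy]; apply: hd1 => /=.
  by rewrite distrC gtr0_norm ?subr_gt0//; rewrite /y in cy; lra.
have cf : {within `[x, y], continuous f}.
  apply: derivable_within_continuous => c; rewrite in_itv/= => /andP[xc cy].
  suff : is_derive c 1 f (f1 c) by case.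
  apply: hd1 => /=.
  by rewrite distrC ger0_norm ?subr_ge0//; rewrite /y in cy; lra.
have [c cxy fxy] := MVT xy H cf.
have fyx : f y <= f x.
  by apply: hd2 => /=; rewrite distrC /y addrC addKr gtr0_norm; lra.
move: (cxy); rewrite in_itv/= => /andP[xc cy].
have : `|b - (c - x)^-1 * (f1 (c - x + x) - f1 x)| < b.
  apply: hd0 => /=; last by rewrite subr_eq0 gt_eqF.
  by rewrite sub0r normrN gtr0_norm ?subr_gt0//; rewrite /y in cy; lra.
rewrite subrK ltr_norml => /andP[_ h].
have : 0 < (c - x)^-1 * (f1 c - f1 x) by lra.
rewrite pmulr_rgt0 ?invr_gt0 ?subr_gt0// => h'.
have : 0 < f1 c * (y - x) by apply: mulr_gt0; rewrite ?subr_gt0//; exact: le_lt_trans h'.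
by rewrite -fxy subr_gt0 ltNge fyx.
Qed.

Lemma has_derive2D f g x a b : has_derive2 f x a -> has_derive2 g x b ->
  has_derive2 (fun s => f s + g s) x (a + b).
Proof.
move=> [f1 df ddf] [g1 dg ddg]; exists (f1 \+ g1); last exact: is_deriveD.
by near=> y; apply: is_deriveD; near: y.
Unshelve. all: by end_near. Qed.

Lemma has_derive2Z k f x a : has_derive2 f x a ->
  has_derive2 (fun s => k * f s) x (k * a).
Proof.
move=> [f1 df ddf]; exists (k *: f1); last exact: is_deriveZ.
by near=> y; apply: (@is_deriveZ _ _ _ f); near: y.
Unshelve. all: by end_near. Qed.

Lemma has_derive2_cst k x : has_derive2 (fun=> k) x 0.
Proof.
exists (fun=> 0); last exact: is_derive_cst.
by near=> y; exact: is_derive_cst.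
Unshelve. all: by end_near. Qed.

Lemma has_derive2N f x a : has_derive2 f x a ->
  has_derive2 (fun s => - f s) x (- a).
Proof.
move=> /(has_derive2Z (-1)); rewrite mulN1r.
by under eq_fun do rewrite mulN1r.
Qed.

Lemma has_derive2B f g x a b : has_derive2 f x a -> has_derive2 g x b ->
  has_derive2 (fun s => f s - g s) x (a - b).
Proof. by move=> df /has_derive2N; exact: has_derive2D. Qed.

Lemma has_derive2_affine k d f x a : has_derive2 f (k * x + d) a ->
  has_derive2 (fun s => f (k * s + d)) x (k ^+ 2 * a).
Proof.
have daff (y : R) : is_derive y 1 (fun s => k * s + d) k.
  by apply: is_derive_eq; rewrite addr0 scaler1.
move=> [f1 df ddf]; exists (fun s => k * f1 (k * s + d)).
  have /derivable1_diffP /differentiable_continuous c :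
      derivable (fun s => k * s + d) x 1 by case: (daff x).
  have : \forall y \near x, is_derive (k * y + d) 1 f (f1 (k * y + d)).
    exact: (c _ df).
  apply: filterS => y hy.
  by rewrite [k * f1 _]mulrC; exact: (@is_derive1_comp _ f (fun s => k * s + d) y _ _ hy (daff y)).
have h : is_derive x 1 (f1 \o (fun s => k * s + d)) (k * a).
  by rewrite [k * a]mulrC; exact: (@is_derive1_comp _ f1 (fun s => k * s + d) x _ _ ddf (daff x)).
rewrite expr2 -mulrA.
exact: (@is_deriveZ _ _ _ (f1 \o (fun s => k * s + d))).
Qed.

Lemma has_derive2_sqr k x : has_derive2 (fun s => (k + s) ^+ 2) x 2.
Proof.
exists (fun s => 2 * (k + s)).
  by near=> y; apply: is_derive_eq; rewrite /GRing.scale/=; ring.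
by apply: is_derive_eq; rewrite /GRing.scale/=; ring.
Unshelve. all: by end_near. Qed.

End derive2.

Section parab.
Context {R : realType} {N : nat}.
Implicit Types (u : R -> 'rV[R]_N -> R) (t c k : R) (x : 'rV[R]_N).

Local Notation "''e_' i" := (delta_mx (ord0 : 'I_1) (i : 'I_N) : 'rV[R]_N)
  (at level 8, i at level 2, format "''e_' i").

(** The value c of the heat operator u_t - Delta u at one point, with second derivatives taken along
    coordinate lines. It applies equally to classical solutions, barriers and heat potentials,
    without [C12] regularity having to be shown for the latter. *)
Definition parab u t x c := exists a (b : 'I_N -> R),
  [/\ is_derive t 1 (u ^~ x) a,
      (forall i, has_derive2 (fun s => u t (x + s *: 'e_i)) 0 (b i)) &
      c = a - \sum_i b i].

Lemma parabD u v t x c d : parab u t x c -> parab v t x d ->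
  parab (fun t x => u t x + v t x) t x (c + d).
Proof.
move=> [a [b [da db ->]]] [a' [b' [da' db' ->]]].
exists (a + a'), (fun i => b i + b' i); split.
- exact: is_deriveD.
- by move=> i; exact: has_derive2D.
- by rewrite big_split/=; ring.
Qed.

Lemma parabZ k u t x c : parab u t x c ->
  parab (fun t x => k * u t x) t x (k * c).
Proof.
move=> [a [b [da db ->]]]; exists (k * a), (fun i => k * b i); split.
- exact: (@is_deriveZ _ _ _ (u ^~ x)).
- by move=> i; exact: has_derive2Z.
- by rewrite -mulr_sumr mulrBr.
Qed.

Lemma parabB u v t x c d : parab u t x c -> parab v t x d ->
  parab (fun t x => u t x - v t x) t x (c - d).
Proof.
move=> pu /(parabZ (-1)); rewrite mulN1r.
by under eq_fun do under eq_fun do rewrite mulN1r; exact: parabD.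
Qed.

Lemma parab_time (f : R -> R) t x a : is_derive t 1 f a ->
  parab (fun t _ => f t) t x a.
Proof.
move=> fa; exists a, (fun=> 0); split=> //.
- by move=> i; exact: has_derive2_cst.
- by rewrite big1// subr0.
Qed.

Lemma parab_cst k t x : parab (fun _ _ => k) t x 0.
Proof. by apply: parab_time; exact: is_derive_cst. Qed.

Lemma parab_mul_time (f : R -> R) f' u t x c : is_derive t 1 f f' ->
  parab u t x c -> parab (fun t x => f t * u t x) t x (f' * u t x + f t * c).
Proof.
move=> df [a [b [da db ->]]]; exists (f' * u t x + f t * a), (fun i => f t * b i).
split.
- have h := @is_deriveM _ _ f (u ^~ x) t 1 _ _ df da.
  by apply: (is_derive_eq h); rewrite /GRing.scale/=; ring.
- by move=> i; exact: has_derive2Z.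
- by rewrite -mulr_sumr; ring.
Qed.

(** The slopes [kk i] enter only through their squares, so this covers time shifts, parabolic
    dilations (slope l, k = l^2) and mirror reflections (slopes 1 and -1) at once. *)
Lemma parab_affine k d (kk : 'I_N -> R) (phi : 'rV[R]_N -> 'rV[R]_N) u t x c :
  (forall i, kk i ^+ 2 = k) ->
  (forall i y s, phi (y + s *: 'e_i) = phi y + (kk i * s) *: 'e_i) ->
  parab u (k * t + d) (phi x) c ->
  parab (fun t x => u (k * t + d) (phi x)) t x (k * c).
Proof.
move=> kkE phiE [a [b [da db ->]]]; exists (k * a), (fun i => k * b i); split.
- have h : is_derive t 1 (fun s => k * s + d) k.
    by apply: is_derive_eq; rewrite addr0 scaler1.
  rewrite mulrC.
  exact: (@is_derive1_comp _ (u ^~ (phi x)) (fun s => k * s + d) t _ _ da h).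
- move=> i; rewrite -[X in has_derive2 _ _ (X * _)](kkE i).
  rewrite (_ : (fun s => u _ (phi _)) =
    (fun s => (fun r => u (k * t + d) (phi x + r *: 'e_i)) (kk i * s + 0))).
    apply: (@has_derive2_affine _ (kk i) 0 (fun r => u (k * t + d) (phi x + r *: 'e_i)) 0).
    by rewrite mulr0 addr0.
  by apply/funext => s; rewrite phiE addr0.
- by rewrite -mulr_sumr mulrBr.
Qed.

Lemma derivable_line (f : 'rV[R]_N -> R) x (e : 'rV[R]_N) (s : R) :
  derivable f (x + s *: e) e ->
  is_derive s 1 (fun s => f (x + s *: e)) ('D_e f (x + s *: e)).
Proof.
have E : (fun h : R => h^-1 *: (f (x + (h *: 1 + s) *: e) - f (x + s *: e))) =
    (fun h => h^-1 *: (f (h *: e + (x + s *: e)) - f (x + s *: e))).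
  apply/funext => h; congr (_ *: (f _ - _)).
  by rewrite [h *: 1]mulr1 scalerDl addrCA.
move=> df; apply: DeriveDef; first by rewrite /derivable E.
by rewrite /derive E.
Qed.

Lemma parab_classical alpha u t x : classical_solution alpha u -> 0 < t ->
  parab u t x (- absorption alpha (u t) x).
Proof.
move=> [C12u eqn] t0; have [dt dx dxx] := (C12u _ x t0).1.
exists (derive1 (u ^~ x) t), (fun i => partial i (partial i (u t)) x); split.
- by apply: DeriveDef => //; rewrite derive1E.
- move=> i; exists (fun s => partial i (u t) (x + s *: 'e_i)).
    near=> s; apply: derivable_line.
    by have [_ h _] := (C12u _ (x + s *: 'e_i) t0).1; exact: h.
  rewrite [X in is_derive _ _ _ X](_ : _ =
    'D_('e_i) (partial i (u t)) (x + 0 *: 'e_i)); last by rewrite scale0r addr0.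
  by apply: derivable_line; rewrite scale0r addr0; exact: dxx.
- by have /eqP := eqn _ x t0; rewrite addr_eq0 => /eqP <-.
Unshelve. all: by end_near. Qed.

Lemma compact_rV_ball (M : R) : compact [set x : 'rV[R]_N | `|x| <= M].
Proof.
apply: bounded_closed_compact.
  exists M; split; first exact: num_real.
  by move=> M' MM' x /= /le_trans; apply; exact: ltW.
apply: (@closed_comp _ _ (fun x : 'rV[R]_N => `|x|) [set r | r <= M]).
  by move=> x _; exact: norm_continuous.
exact: closed_le.
Qed.

Definition sqnorm x := \sum_(i < N) x ord0 i ^+ 2.

Lemma sqnorm_ge0 x : 0 <= sqnorm x.
Proof. by apply: sumr_ge0 => i _; exact: sqr_ge0. Qed.

Lemma norm_rV_le (M : R) x : 0 <= M -> `|x| <= M <-> forall i, `|x ord0 i| <= M.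
Proof.
move=> M0; rewrite /Num.norm/= mx_normrE; split.
  move=> h i; apply: le_trans h.
  by rewrite (le_bigmax _ (fun i => `|x i.1 i.2|) (ord0, i)).
move=> h; apply: bigmax_le => //= -[i j] _ /=.
by rewrite (ord1 i); exact: h.
Qed.

Lemma coord_le_norm x i : `|x ord0 i| <= `|x|.
Proof. by have [/(_ (lexx _))] := @norm_rV_le `|x| x (normr_ge0 _); exact. Qed.

Lemma norm_sqr_le_sqnorm x : `|x| ^+ 2 <= sqnorm x.
Proof.
rewrite -[leRHS]sqr_sqrtr ?sqnorm_ge0// lerXn2r ?nnegrE ?sqrtr_ge0//.
apply/norm_rV_le => [|i]; first exact: sqrtr_ge0.
rewrite -sqrtr_sqr ler_wsqrtr// /sqnorm (bigD1 i)//= lerDl.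
by apply: sumr_ge0 => j _; exact: sqr_ge0.
Qed.

Lemma sqnorm_line x i s : sqnorm (x + s *: 'e_i) = sqnorm x - x ord0 i ^+ 2 + (x ord0 i + s) ^+ 2.
Proof.
rewrite /sqnorm (bigD1 i)//= [X in _ = X - _ + _](bigD1 i)//= !mxE !eqxx mulr1.
rewrite (eq_bigr (fun j => x ord0 j ^+ 2)); first by ring.
by move=> j ji; rewrite !mxE (negPf ji) andbF mulr0 addr0.
Qed.

Lemma continuous_sqnorm : continuous sqnorm.
Proof.
move=> x; apply: (@cvg_big _ _ _ _ _ _ _ (nbhs x)) => [|i _]; first exact: add_continuous.
apply: (@cvg_comp _ _ _ (fun y : 'rV[R]_N => y ord0 i) (fun r => r ^+ 2)).
  exact: coord_continuous.
exact: exprn_continuous.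
Qed.

(* A small multiple of |x|^2 + (2N + 1)(t - t0) is subtracted so that the maximum
   is attained. *)
Theorem parabolic_max_principle (F : set 'rV[R]_N) (D : R -> 'rV[R]_N -> R) t0 T B :
  closed F ->
  (forall t x, t0 <= t <= T ->
    {for (t, x), continuous (fun p : R * 'rV[R]_N => D p.1 p.2)}) ->
  (forall t x, t0 <= t <= T -> F x -> D t x <= B) ->
  (forall x, F x -> D t0 x <= 0) ->
  (forall t x, t0 < t <= T -> F x -> 0 < D t x ->
     nbhs x F /\ exists2 c, c <= 0 & parab D t x c) ->
  forall t x, t0 <= t <= T -> F x -> D t x <= 0.
Proof.
move=> cF cD DB D0 subD t1 x1 t1T Fx1; rewrite leNgt; apply/negP => D1.
have N1 : 0 < (2 * N + 1)%:R :> R by rewrite addn1 ltr0n.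
(* With eta = D t1 x1 / (2 S) the penalty P at (t1, x1) is at most half of D t1 x1, so the penalised
   function E is still positive there. *)
pose S := 1 + sqnorm x1 + (2 * N + 1)%:R * (T - t0).
have S1 : 1 <= S.
  rewrite /S -addrA lerDl addr_ge0 ?sqnorm_ge0// mulr_ge0 ?(ltW N1)//.
  by case/andP: t1T; lra.
have S0 : 0 < S by exact: lt_le_trans S1.
pose eta := D t1 x1 / (2 * S).
have eta0 : 0 < eta by rewrite divr_gt0// mulr_gt0.
pose P (t : R) x := eta * sqnorm x + eta * (2 * N + 1)%:R * (t - t0).
have P1 : P t1 x1 < D t1 x1.
  apply: (@le_lt_trans _ _ (eta * S)); last first.
    by rewrite /eta invfM mulrA -mulrA mulVf ?gt_eqF// mulr1; lra.
  rewrite /P -mulrA -mulrDr ler_pM2l// /S.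
  have : (2 * N + 1)%:R * (t1 - t0) <= (2 * N + 1)%:R * (T - t0).
    by rewrite ler_pM2l// lerB// ; case/andP: t1T.
  lra.
pose E (p : R * 'rV[R]_N) := D p.1 p.2 - P p.1 p.2.
have P0 t x : t0 <= t -> eta * sqnorm x <= P t x.
  by move=> tt; rewrite /P lerDl mulr_ge0 ?subr_ge0// mulr_ge0 ?ltW.
have B0 : 0 < B by rewrite (lt_le_trans D1)// DB.
(* Beyond radius r >= 1 the penalty is at least eta |x|^2 >= eta r >= B, so E <= 0 there and the
   maximum can be sought on a compact set. *)
pose r := 1 + B / eta.
have r1 : 1 <= r by rewrite /r lerDl divr_ge0 ?ltW.
have Eout t x : t0 <= t <= T -> F x -> r < `|x| -> E (t, x) <= 0.
  move=> tT Fx rx; rewrite /E/= subr_le0 (le_trans (DB _ _ tT Fx))//.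
  apply: le_trans (P0 t x _); last by case/andP: tT.
  apply: (@le_trans _ _ (eta * r)); first by rewrite (_ : eta * r = eta + B) ?lerDr ?ltW// /r; field; rewrite gt_eqF.
  rewrite ler_pM2l// (le_trans _ (norm_sqr_le_sqnorm x))//.
  apply: (@le_trans _ _ `|x|); first exact: ltW.
  by rewrite expr2 ler_peMr//; apply: le_trans (ltW rx).
pose K := `[t0, T] `*` (F `&` [set x | `|x| <= r]).
have cE p : t0 <= p.1 <= T -> {for p, continuous E}.
  move=> pT; rewrite /E; apply: cvgB; first by case: p pT => t x; exact: cD.
  rewrite /P; apply: cvgD.
    apply: cvgMr; apply: (@cvg_comp _ _ _ snd sqnorm); first exact: cvg_snd.
    exact: continuous_sqnorm.
  apply: cvgMr; apply: cvgB; last exact: cvg_cst.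
  exact: cvg_fst.
have [[ts xs] /set_mem[/= tsT [Fxs xsr]] Emax] : exists2 p, p \in K & forall q, q \in K -> E q <= E p.
  apply: compact_EVT_max.
  - exists (t1, x1); split => //=; split => //; rewrite leNgt; apply/negP => /(Eout t1 x1 t1T Fx1).
    by rewrite /E/= leNgt subr_gt0 P1.
  - apply: compact_setX; first exact: segment_compact.
    rewrite setIC; apply: compact_closedI => //; exact: compact_rV_ball.
  - apply: continuous_in_subspaceT => p /set_mem[/= pT _].
    by apply: cE; move: pT; rewrite in_itv.
rewrite in_itv/= in tsT.
have E0 : 0 < E (ts, xs).
  have [rx|rx] := ltP r `|x1|.
    by have := Eout _ _ t1T Fx1 rx; rewrite leNgt /E/= subr_gt0 P1.
  apply: (@lt_le_trans _ _ (E (t1, x1))); first by rewrite /E/= subr_gt0.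
  by apply: Emax; rewrite inE/=; split => //=; rewrite in_itv.
have {}Emax t x : t0 <= t <= T -> F x -> E (t, x) <= E (ts, xs).
  move=> tT Fx; have [rx|rx] := ltP r `|x|.
    by rewrite (le_trans (Eout _ _ tT Fx rx))// ltW.
  by apply: Emax; rewrite inE/=; split => //=; rewrite in_itv.
have Ds : 0 < D ts xs.
  apply: lt_le_trans E0 _; rewrite /E/= lerBlDr lerDl.
  apply: le_trans (P0 _ _ _); last by case/andP: tsT.
  by rewrite mulr_ge0 ?sqnorm_ge0// ltW.
have t0ts : t0 < ts.
  rewrite lt_neqAle; case/andP: (tsT) => -> _; rewrite andbT.
  by apply: contraTneq Ds => <-; rewrite -leNgt D0.
have tsT' : t0 < ts <= T by rewrite t0ts; case/andP: tsT.
have [nF [c c0 [a [b [da db cE']]]]] := subD _ _ tsT' Fxs Ds.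
(* At the maximum the time derivative of D is at least (2N + 1) eta and each of its N second
   derivatives is at most 2 eta. The heat operator is then at least eta > 0, against c <= 0. *)
have ha : eta * (2 * N + 1)%:R <= a.
  rewrite -subr_ge0; apply: (@is_derive_ge0_left _ (fun t => E (t, xs)) ts (a - eta * (2 * N + 1)%:R)).
    rewrite /E /P /=.
    by apply: is_derive_eq; rewrite /GRing.scale/=; ring.
  have h : \forall s \near ts^'-, t0 < s < ts.
    near=> s; apply/andP; split; near: s; first exact: nbhs_left_gt.
    exact: nbhs_left_lt.
  apply: filterS h => s /andP[s1 s2]; apply: Emax => //.
  by rewrite ltW//= (le_trans (ltW s2))//; case/andP: tsT.
have hb i : b i <= 2 * eta.
  rewrite -subr_le0; apply: (@has_derive2_max _ (fun s => E (ts, xs + s *: 'e_i)) 0).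
    rewrite /E/= /P; apply: has_derive2B => //.
    rewrite -[2 * eta]addr0; apply: has_derive2D; last exact: has_derive2_cst.
    rewrite mulrC; apply: has_derive2Z.
    under eq_fun do rewrite sqnorm_line.
    rewrite -[X in has_derive2 _ _ X]add0r; apply: has_derive2D; first exact: has_derive2_cst.
    exact: has_derive2_sqr.
  have : (fun s : R => xs + s *: 'e_i) @ (0 : R) --> xs + (0 : R) *: 'e_i.
    by apply: cvgD; [exact: cvg_cst|apply: cvgZl; exact: cvg_id].
  rewrite scale0r addr0 => /(_ _ nF); rewrite nbhs_filterE /=.
  by apply: filterS => s Fs; rewrite Emax.
have : \sum_i b i <= (2 * N)%:R * eta.
  apply: (@le_trans _ _ (\sum_(i < N) 2 * eta)); first exact: ler_sum.
  by rewrite sumr_const card_ord -mulr_natl natrM; lra.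
move: ha; rewrite natrD; lra.
Unshelve. all: by end_near. Qed.

End parab.

(** * Integration on R^N and the heat kernel *)

Section product_integral.
Context {R : realType}.
Local Notation leb := (@lebesgue_measure R).

Lemma cons_rV0 n (p : R * 'rV[R]_n) : cons_rV p ord0 ord0 = p.1.
Proof. exact: (congr1 fst (cons_rVK p)). Qed.

Lemma cons_rVS n (p : R * 'rV[R]_n) (j : 'I_n) : cons_rV p ord0 (lift ord0 j) = p.2 ord0 j.
Proof.
by have /(congr1 (fun q : R * 'rV[R]_n => q.2 ord0 j)) := cons_rVK p; rewrite /= mxE.
Qed.

Lemma measurable_fun_prod_rV n (f : 'I_n -> R -> R) :
  (forall i, measurable_fun setT (f i : measurableTypeR R -> R)) ->
  measurable_fun setT (fun x : 'rV[R]_n => \prod_(i < n) f i (x ord0 i)).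
Proof.
move=> mf; apply: measurable_prod => i _.
exact: (measurableT_comp (mf i) (measurable_rV_coord i)).
Qed.

(** By induction on n: [lebesgue_rV] is built as the image of a product measure under [cons_rV], so
    Fubini splits off the first coordinate. The Gaussian integrals over R^N below are reduced to the
    line through this lemma. *)
Lemma integrable_integral_prod_rV n (f : 'I_n -> R -> R) :
  (forall i, leb.-integrable setT (EFin \o f i)) ->
  (lebesgue_rV n).-integrable setT
     (fun x : 'rV[R]_n => (\prod_(i < n) f i (x ord0 i))%:E) /\
  \int[lebesgue_rV n]_x (\prod_(i < n) f i (x ord0 i)) =
  \prod_(i < n) \int[leb]_x f i x.
Proof.
elim: n f => [|n IH] f intf.
  have E : (fun x : 'rV[R]_0 => (\prod_(i < 0) f i (x ord0 i))%:E) = cst 1%E.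
    by apply/funext => x; rewrite big_ord0.
  split.
    rewrite E; apply/integrableP; split; first exact: measurable_cst.
    rewrite [ltLHS](_ : _ = \int[\d_(0%R : 'rV[R]_0)]_x 1)%E; last first.
      by apply: eq_integral => x _; rewrite abse1.
    by rewrite integral_dirac// diracT mul1e ltry.
  rewrite /Rintegral E [X in fine X](_ : _ = \int[\d_(0%R : 'rV[R]_0)]_x 1)%E//.
  by rewrite integral_dirac// diracT mul1e big_ord0.
have {}IH := IH (fun i => f (lift ord0 i)) (fun i => intf (lift ord0 i)).
have [IHint IHE] := IH.
have mf i : measurable_fun setT (f i : measurableTypeR R -> R).
  by apply/measurable_EFinP; case/integrableP: (intf i).
pose P (y : 'rV[R]_n) := \prod_(i < n) f (lift ord0 i) (y ord0 i).
pose F (p : R * 'rV[R]_n) := (f ord0 p.1 * P p.2)%:E.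
have FE : (fun x : 'rV[R]_n.+1 => (\prod_(i < n.+1) f i (x ord0 i))%:E) \o
    @cons_rV R n = F.
  apply/funext => p; rewrite /F /P /= big_ord_recl cons_rV0; congr (_ * _)%:E.
  by apply: eq_bigr => i _; rewrite cons_rVS.
have mP : measurable_fun setT (P : _ -> R).
  exact: (measurable_fun_prod_rV (f := fun i => f (lift ord0 i)) (fun i => mf _)).
have mF : measurable_fun [set: measurableTypeR R * 'rV[R]_n] F.
  apply/measurable_EFinP; apply: measurable_funM.
    exact: (measurableT_comp (mf ord0) measurable_fst).
  exact: (measurableT_comp mP measurable_snd).
have fin0 := integrable_fin_num measurableT (intf ord0).
have finP := integrable_fin_num measurableT IHint.
have intF : (leb \x lebesgue_rV n)%E.-integrable setT F.
  apply/(integrable12ltyP leb (lebesgue_rV n) mF).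
  rewrite [ltLHS](_ : _ = \int[leb]_x (`|f ord0 x|%:E *
      \int[lebesgue_rV n]_y `|(P y)%:E|))%E; last first.
    apply: eq_integral => x _; rewrite -ge0_integralZl//.
    - by apply: eq_integral => y _; rewrite /F /= normrM EFinM.
    - exact/measurableT_comp/measurable_EFinP.
  have [_ ltP] := integrableP _ _ _ IHint.
  have [_ lt0] := integrableP _ _ _ (intf ord0).
  rewrite ge0_integralZr//.
  - by apply: lte_mul_pinfty => //; [exact: integral_ge0|rewrite ge0_fin_numE// integral_ge0].
  - by apply/measurable_EFinP; apply: measurableT_comp.
  - exact: integral_ge0.
have mprod : measurable_fun [set: 'rV[R]_n.+1]
    (fun x : 'rV[R]_n.+1 => (\prod_(i < n.+1) f i (x ord0 i))%:E).
  by apply/measurable_EFinP; exact: measurable_fun_prod_rV mf.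
split.
  apply: (integrable_pushforward (@measurable_cons_rV R n)
    (mu := (leb \x lebesgue_rV n)%E)) => //.
  by rewrite FE preimage_setT.
rewrite /Rintegral [X in fine X](_ : _ = \int[(leb \x lebesgue_rV n)]_p F p)%E; last first.
  rewrite -FE; apply: (integral_pushforward (@measurable_cons_rV R n)
    (mu := (leb \x lebesgue_rV n)%E) (D := setT)) => //.
  by rewrite FE preimage_setT.
rewrite -integral12_prod_meas1// [X in fine X](_ : _ =
   \int[leb]_x ((f ord0 x)%:E * \int[lebesgue_rV n]_y (P y)%:E))%E; last first.
  apply: eq_integral => x _; rewrite /fubini_F -integralZl//.
rewrite [X in fine X](_ : _ = (\int[leb]_x (f ord0 x)%:E) *
    (\int[lebesgue_rV n]_y (P y)%:E))%E; last first.
  by rewrite -(fineK finP); exact: (integralZr measurableT (intf ord0)).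
by rewrite fineM// big_ord_recl -IHE.
Qed.

End product_integral.

Section gauss.
Context {R : realType}.
Implicit Types (t z a b r : R).
Local Notation leb := (@lebesgue_measure R).

Definition gauss t z := (Num.sqrt (4 * pi * t))^-1 * expR (- (z ^+ 2 / (4 * t))).

Let pit0 t : 0 < t -> 0 < 4 * pi * t.
Proof. by move=> t0; rewrite !mulr_gt0// pi_gt0. Qed.

Lemma gauss_ge0 t z : 0 <= gauss t z.
Proof. by rewrite mulr_ge0 ?expR_ge0// invr_ge0 sqrtr_ge0. Qed.

Lemma gauss_even t z : gauss t (- z) = gauss t z.
Proof. by rewrite /gauss sqrrN. Qed.

Lemma gauss_ub t z : 0 < t -> gauss t z <= (Num.sqrt (4 * pi * t))^-1.
Proof.
move=> t0; rewrite ger_pMr ?invr_gt0 ?sqrtr_gt0 ?pit0// expR_le1 oppr_le0.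
by rewrite divr_ge0 ?sqr_ge0// mulr_ge0// ltW.
Qed.

(** Integrability and total mass 1 of the heat kernel are read off from the normal law of variance
    2t. *)
Lemma gauss_normal t a b : 0 < t ->
  gauss t (a - b) = normal_pdf a (Num.sqrt (2 * t)) b.
Proof.
move=> t0; have t20 : 0 < 2 * t by rewrite mulr_gt0.
rewrite normal_pdfE ?gt_eqF ?sqrtr_gt0// /normal_peak /normal_fun /gauss.
rewrite sqr_sqrtr ?(ltW t20)//; congr (_^-1 * expR _).
  by congr (Num.sqrt _); ring.
by field; rewrite gt_eqF.
Qed.

Lemma integrable_gauss t a : 0 < t ->
  leb.-integrable setT (EFin \o (fun b => gauss t (a - b))).
Proof.
move=> t0; rewrite (_ : _ \o _ = (fun b => (normal_pdf a (Num.sqrt (2 * t)) b)%:E)).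
  exact: integrable_normal_pdf.
by apply/funext => b /=; rewrite gauss_normal.
Qed.

Lemma integral_gauss t a : 0 < t -> \int[leb]_b gauss t (a - b) = 1.
Proof.
move=> t0; rewrite /Rintegral -[RHS]/(fine 1%:E).
rewrite -(@integral_normal_pdf R a (Num.sqrt (2 * t))); congr fine.
by apply: eq_integral => b _; rewrite gauss_normal.
Qed.

Lemma measurable_gauss t a : 0 < t ->
  measurable_fun setT (fun b : measurableTypeR R => gauss t (a - b)).
Proof.
by move=> t0; apply/measurable_EFinP; case/integrableP: (integrable_gauss a t0).
Qed.

(** Half of the exponent yields the decay in r, the other half is the Gaussian of time 2t; sqrt 2 is
    the ratio of the two normalising factors. *)
Lemma gauss_tail t r z : 0 < t -> 0 <= r -> r <= `|z| ->
  gauss t z <= Num.sqrt 2 * expR (- (r ^+ 2 / (8 * t))) * gauss (2 * t) z.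
Proof.
move=> t0 r0 rz; rewrite /gauss.
have -> : 4 * pi * (2 * t) = 2 * (4 * pi * t) by ring.
rewrite [Num.sqrt (2 * _)]sqrtrM//.
have s0 : 0 < Num.sqrt (4 * pi * t) by rewrite sqrtr_gt0 pit0.
have s2 : 0 < Num.sqrt 2 :> R by rewrite sqrtr_gt0.
rewrite [leRHS](_ : _ = (Num.sqrt (4 * pi * t))^-1 *
  (expR (- (r ^+ 2 / (8 * t))) * expR (- (z ^+ 2 / (4 * (2 * t)))))); last first.
  by field; rewrite !gt_eqF.
rewrite ler_pM2l ?invr_gt0// -expRD ler_expR -opprD lerN2.
have -> : z ^+ 2 / (4 * t) = z ^+ 2 / (8 * t) + z ^+ 2 / (4 * (2 * t)).
  by field; rewrite gt_eqF.
rewrite lerD2r ler_pM2r ?invr_gt0 ?mulr_gt0// -[z ^+ 2]real_normK ?num_real//.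
by rewrite lerXn2r ?nnegrE.
Qed.

Lemma is_derive_gauss_z t z : 0 < t ->
  is_derive z 1 (gauss t) (- (z / (2 * t)) * gauss t z).
Proof.
move=> t0; have d : is_derive z 1 (fun y : R => - (y ^+ 2 / (4 * t))) (- (z / (2 * t))).
  apply: is_derive_eq; rewrite /GRing.scale/=.
  by field; rewrite gt_eqF.
have d2 := @is_derive1_comp _ expR _ z _ _ (is_derive_expR _) d.
rewrite /gauss.
have := @is_deriveZ _ _ _ _ (Num.sqrt (4 * pi * t))^-1 z 1 _ d2.
by move=> h; apply: (is_derive_eq h); rewrite /GRing.scale/=; ring.
Qed.

Lemma is_derive_gauss_zz t z : 0 < t ->
  is_derive z 1 (fun z => - (z / (2 * t)) * gauss t z)
    ((z ^+ 2 / (4 * t ^+ 2) - (2 * t)^-1) * gauss t z).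
Proof.
move=> t0; have d : is_derive z 1 (fun y : R => - (y / (2 * t))) (- (2 * t)^-1).
  by apply: is_derive_eq; rewrite /GRing.scale/=; field; rewrite gt_eqF.
have := @is_deriveM _ _ _ _ z 1 _ _ d (is_derive_gauss_z z t0).
by move=> h; apply: (is_derive_eq h); rewrite /GRing.scale/=; field; rewrite gt_eqF.
Qed.

Lemma is_derive_gauss_t t z : 0 < t ->
  is_derive t 1 (gauss ^~ z) ((z ^+ 2 / (4 * t ^+ 2) - (2 * t)^-1) * gauss t z).
Proof.
move=> t0.
have E (s : R) : 0 < s -> (Num.sqrt (4 * pi * s))^-1 = (4 * pi * s) `^ (- 2^-1).
  by move=> s0; rewrite powRN powR12_sqrt// ltW// pit0.
apply: (@near_eq_is_derive _ _ _
    (fun s => (4 * pi * s) `^ (- 2^-1) * expR (- (z ^+ 2 / (4 * s))))).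
  by near=> s; rewrite /gauss E//; near: s; exact: lt_nbhsr.
have d0 : is_derive t 1 (fun s : R => 4 * pi * s) (4 * pi).
  by apply: is_derive_eq; rewrite /GRing.scale/=; ring.
have d1 := @is_derive1_comp _ (fun s => s `^ (- 2^-1)) _ t _ _ (is_derive1_powR _ (pit0 t0)) d0.
have t40 : 4 * t != 0 by rewrite mulf_neq0// gt_eqF.
have d4 : is_derive t 1 (fun s : R => 4 * s) 4.
  by apply: is_derive_eq; rewrite /GRing.scale/=; ring.
have d2 : is_derive t 1 (fun s : R => - (z ^+ 2 / (4 * s))) (z ^+ 2 / (4 * t ^+ 2)).
  have := @is_deriveZ _ _ _ _ (- z ^+ 2) t 1 _ (@is_deriveV _ _ t 4 1 t40 d4).
  rewrite /GRing.scale/= => h.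
  under eq_fun do rewrite -mulNr.
  by apply: (is_derive_eq h); field; rewrite gt_eqF.
have d3 := @is_derive1_comp _ expR _ t _ _ (is_derive_expR _) d2.
have := @is_deriveM _ _ _ _ t 1 _ _ d1 d3 => h.
apply: (is_derive_eq h); rewrite /GRing.scale/= /gauss E//.
rewrite powRD; last by rewrite (gt_eqF (pit0 t0)) implybT.
rewrite powR_inv1 ?(ltW (pit0 t0))//.
have pi0 : pi != 0 :> R by rewrite gt_eqF// pi_gt0.
set X := _ `^ _; set Y := expR _.
have tn : t != 0 by rewrite gt_eqF.
move: pi0 tn; clearbody X Y; move: (pi) => p p0 tn.
field.
by rewrite p0 tn.
Unshelve. all: by end_near. Qed.

(* The three bounds differ only by the polynomial prefactors, absorbed by half
   of the Gaussian exponent. *)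
Lemma gauss_derivatives_bound t1 t2 : 0 < t1 -> t1 <= t2 ->
  exists2 C, 0 <= C & forall t z, t1 <= t <= t2 ->
    [/\ gauss t z <= C * expR (- (z ^+ 2 / (8 * t2))),
        `|- (z / (2 * t)) * gauss t z| <= C * expR (- (z ^+ 2 / (8 * t2))) &
        `|(z ^+ 2 / (4 * t ^+ 2) - (2 * t)^-1) * gauss t z| <=
          C * expR (- (z ^+ 2 / (8 * t2)))].
Proof.
move=> t10 t12.
pose A := (Num.sqrt (4 * pi * t1))^-1.
have A0 : 0 < A by rewrite invr_gt0 sqrtr_gt0 pit0.
exists (A * (1 + 3 / t1 + 2 * t1^-1 + 3)).
  by rewrite mulr_ge0 ?(ltW A0)// !addr_ge0// ?divr_ge0 ?mulr_ge0 ?invr_ge0// ltW.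
move=> t z /andP[t1t tt2]; have t0 : 0 < t by exact: lt_le_trans t1t.
pose s := z ^+ 2 / (8 * t).
have s0 : 0 <= s by rewrite divr_ge0 ?sqr_ge0// mulr_ge0// ltW.
pose e := expR (- s).
have e0 : 0 < e by exact: expR_gt0.
have e1 : e <= 1 by rewrite expR_le1 oppr_le0.
have se : s * e <= 1.
  rewrite /e expRN -ler_pdivlMr ?invr_gt0 ?expR_gt0// mul1r invrK.
  by apply: le_trans (expR_ge1Dx s); rewrite lerDr.
have eE : e <= expR (- (z ^+ 2 / (8 * t2))).
  by rewrite ler_expR lerN2 ler_wpM2l ?sqr_ge0// lef_pV2 ?posrE ?mulr_gt0// ?ler_pM2l//; lra.
have gE : gauss t z <= A * e * e.
  rewrite /gauss -[leRHS]mulrA /e -expRD (_ : - s + - s = - (z ^+ 2 / (4 * t))); last first.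
    by rewrite /s; field; rewrite gt_eqF.
  rewrite ler_pM2r ?expR_gt0// lef_pV2 ?posrE ?sqrtr_gt0 ?pit0//.
  by rewrite ler_wsqrtr// ler_pM2l// mulr_gt0// pi_gt0.
have g0 := gauss_ge0 t z.
have tV : t^-1 <= t1^-1 by rewrite lef_pV2 ?posrE.
have tV0 : 0 < t^-1 by rewrite invr_gt0.
suff H P : 0 <= P -> P * e <= 1 + 3 / t1 + 2 * t1^-1 + 3 ->
    P * gauss t z <= A * (1 + 3 / t1 + 2 * t1^-1 + 3) * expR (- (z ^+ 2 / (8 * t2))).
  have z2 : z ^+ 2 = s * (8 * t) by rewrite /s divfK// mulf_neq0// gt_eqF.
  split.
  - rewrite -[leLHS]mul1r; apply: H => //; rewrite mul1r.
    by apply: le_trans e1 _; have := invr_gt0 t1; rewrite t10; lra.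
  - rewrite normrM (ger0_norm g0) normrN; apply: H => //.
    rewrite normrM normfV (gtr0_norm (_ : 0 < 2 * t)); last by rewrite mulr_gt0.
    have h : `|z| <= 1 + z ^+ 2.
      by rewrite -[z ^+ 2]real_normK ?num_real//; have := normr_ge0 z; set n := `|z| => n0; nra.
    apply: (@le_trans _ _ ((1 + z ^+ 2) / (2 * t) * e)).
      by rewrite ler_pM2r// ler_pM2r// invr_gt0 mulr_gt0.
    rewrite z2 (_ : _ * e = t^-1 * e / 2 + 4 * (s * e)); last first.
      by field; rewrite gt_eqF.
    have h1 : t^-1 * e <= t1^-1 by rewrite -[leRHS]mulr1 ler_pM// ltW.
    have := invr_gt0 t1; rewrite t10; lra.
  - rewrite normrM (ger0_norm g0); apply: H => //.
    apply: (@le_trans _ _ ((z ^+ 2 / (4 * t ^+ 2) + (2 * t)^-1) * e)).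
      rewrite ler_pM2r//; apply: le_trans (ler_normB _ _) _.
      have a0 : 0 <= z ^+ 2 / (4 * t ^+ 2) by rewrite divr_ge0 ?sqr_ge0// mulr_ge0 ?sqr_ge0.
      have b0 : 0 <= (2 * t)^-1 by rewrite invr_ge0 mulr_ge0// ltW.
      by rewrite !ger0_norm.
    rewrite z2 (_ : _ * e = 2 * (t^-1 * (s * e)) + t^-1 * e / 2); last first.
      by field; rewrite gt_eqF.
    have h1 : t^-1 * e <= t1^-1 by rewrite -[leRHS]mulr1 ler_pM// ltW.
    have h2 : t^-1 * (s * e) <= t1^-1 
      by rewrite -[leRHS]mulr1; exact: (ler_pM (ltW tV0) (mulr_ge0 s0 (ltW e0)) tV se).
    have := invr_gt0 t1; rewrite t10; lra.
move=> P0 Pe.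
apply: (@le_trans _ _ (P * (A * e * e))); first by rewrite ler_wpM2l.
rewrite (_ : P * _ = A * (P * e) * e); last by ring.
by apply: ler_pM; rewrite ?mulr_ge0 ?(ltW A0) ?(ltW e0)// ler_pM2l.
Qed.

End gauss.

(** * Heat potentials on the sector *)

Section under_integral.
Context {R : realType} d {Y : measurableType d} {mu : {measure set Y -> \bar R}}.

Lemma is_derive_under_integral (F F' : R -> Y -> R) (a u v : R) (G : Y -> R) :
  u < a < v ->
  (forall x, u < x < v -> mu.-integrable setT (EFin \o F x)) ->
  (forall x y, u < x < v -> is_derive x 1 (F ^~ y) (F' x y)) ->
  mu.-integrable setT (EFin \o G) ->
  (forall x y, u < x < v -> `|F' x y| <= G y) ->
  is_derive a 1 (fun x => \int[mu]_y F x y) (\int[mu]_y F' a y).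
Proof.
move=> auv intF dF intG FG.
have I x : `]u, v[%classic x -> u < x < v by rewrite /= in_itv.
have aI : `]u, v[%classic a by rewrite /= in_itv.
have dE x y : `]u, v[%classic x -> partial1of2 F x y = F' x y.
  by move=> /I xI; rewrite partial1of2E; case: (dF x y xI).
have G0 y : 0 <= G y by exact: le_trans (normr_ge0 _) (FG a y auv).
have dd x y : `]u, v[%classic x -> [set: Y] y -> derivable (F ^~ y) x 1.
  by move=> /I xI _; case: (dF x y xI).
have Gub x y : `]u, v[%classic x -> [set: Y] y -> `|partial1of2 F x y| <= G y.
  by move=> xI _; rewrite dE// FG//; exact: I.
have intF' x : `]u, v[%classic x -> mu.-integrable setT (EFin \o F x).
  by move=> /I; exact: intF.
apply: DeriveDef; first exact: (derivable_under_integral measurableT aI intF' dd G0 intG Gub).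
rewrite -derive1E.
rewrite (differentiation_under_integral measurableT aI intF' dd G0 intG Gub).
by apply: eq_Rintegral => y _; rewrite -/(partial1of2 F a y) dE.
Qed.

Lemma is_derive_prod n (F F' : 'I_n -> R -> R) (a : R) :
  (forall i, is_derive a 1 (F i) (F' i a)) ->
  is_derive a 1 (fun s => \prod_(j < n) F j s)
    (\sum_(i < n) \prod_(j < n) (if j == i then F' j a else F j a)).
Proof.
elim: n F F' => [|n IH] F F' dF.
  rewrite big_ord0; under eq_fun do rewrite big_ord0.
  exact: is_derive_cst.
have h := IH (fun i => F (lift ord0 i)) (fun i => F' (lift ord0 i)) (fun i => dF _).
have := @is_deriveM _ _ _ _ a 1 _ _ (dF ord0) h.
under [in X in _ -> X]eq_fun do rewrite big_ord_recl.
move=> k; apply: (is_derive_eq k); rewrite /GRing.scale/= [RHS]big_ord_recl addrC.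
congr (_ + _).
  by rewrite big_ord_recl eqxx mulrC.
rewrite mulr_sumr; apply: eq_bigr => i _; rewrite big_ord_recl /=.
by congr (_ * _).
Qed.

End under_integral.

Section kernel.
Context {R : realType} {N : nat}.
Implicit Types (t a b z : R) (x y : 'rV[R]_N) (phi : R -> R -> R).
Local Notation leb := (@lebesgue_measure R).
Local Notation "''e_' i" := (delta_mx (ord0 : 'I_1) (i : 'I_N) : 'rV[R]_N)
  (at level 8, i at level 2, format "''e_' i").

Definition gauss_z t z := - (z / (2 * t)) * gauss t z.
(** At once the time derivative and the second space derivative of [gauss]. Using one function for
    both makes the heat equation for [heat_pot] a cancellation of identical integrals. *)
Definition gauss_t t z := (z ^+ 2 / (4 * t ^+ 2) - (2 * t)^-1) * gauss t z.

Lemma cvg_gauss T (F : set_system T) (FF : Filter F) (tau zeta : T -> R) t z :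
  0 < t -> tau @ F --> t -> zeta @ F --> z ->
  (fun p => gauss (tau p) (zeta p)) @ F --> gauss t z.
Proof.
move=> t0 tF zF; have t40 : 4 * pi * t != 0 by rewrite gt_eqF// !mulr_gt0// pi_gt0.
apply: cvgM.
  apply: cvgV; first by rewrite sqrtr_eq0 -ltNge !mulr_gt0// pi_gt0.
  apply: (@cvg_comp _ _ _ (fun p => 4 * pi * tau p) (@Num.sqrt R)); last exact: sqrt_continuous.
  by apply: cvgMr.
apply: (@cvg_comp _ _ _ (fun p => - (zeta p ^+ 2 / (4 * tau p))) (@expR R)); last exact: continuous_expR.
apply: cvgN; apply: cvgM.
  by rewrite expr2; under eq_fun do rewrite expr2; exact: cvgM.
by apply: cvgV; [rewrite mulf_neq0// gt_eqF|exact: cvgMr].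
Qed.

(** For d = true and phi = [gauss], the Dirichlet heat kernel of the half-line obtained by the
    method of images; for d = false, the kernel of the whole line. Leaving phi free makes the
    derivatives in a of the same form. *)
Definition odd_kernel (d : bool) phi t a b :=
  phi t (a - b) - (if d then phi t (a + b) else 0).

Lemma is_derive_odd_kernel d phi psi t a b :
  (forall z, is_derive z 1 (phi t) (psi t z)) ->
  is_derive a 1 (fun a => odd_kernel d phi t a b) (odd_kernel d psi t a b).
Proof.
move=> dphi; rewrite /odd_kernel.
have shift c : is_derive a 1 (fun a => phi t (a + c)) (psi t (a + c)).
  have h : is_derive a 1 (fun a => a + c) 1 by apply: is_derive_eq; rewrite addr0.
  have := @is_derive1_comp _ (phi t) (fun a => a + c) a _ _ (dphi _) h.
  by rewrite mulr1.
case: d; last by apply: (is_derive_eq (is_deriveB (shift _) (is_derive_cst _ _ _))); rewrite subr0.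
exact: (is_deriveB (shift _) (shift _)).
Qed.

Lemma is_derive_odd_kernel_t d t a b : 0 < t ->
  is_derive t 1 (fun t => odd_kernel d gauss t a b) (odd_kernel d gauss_t t a b).
Proof.
move=> t0; rewrite /odd_kernel; have h z := is_derive_gauss_t z t0.
case: d; last by apply: (is_derive_eq (is_deriveB (h _) (is_derive_cst _ _ _))); rewrite subr0.
exact: (is_deriveB (h _) (h _)).
Qed.

(** The bound is uniform for bounded a: (a + b)^2 >= b^2/2 - a^2, since twice the difference of the
    two sides is (2a + b)^2. The loss of one half in the exponent turns 8 t2 into 16 t2, whence the
    Gaussian of time 4 t2. *)
Lemma odd_kernel_bound t1 t2 A : 0 < t1 -> t1 <= t2 -> 0 <= A ->
  exists2 C, 0 <= C & forall d t a b, t1 <= t <= t2 -> `|a| <= A ->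
    [/\ `|odd_kernel d gauss t a b| <= C * gauss (4 * t2) b,
        `|odd_kernel d gauss_z t a b| <= C * gauss (4 * t2) b &
        `|odd_kernel d gauss_t t a b| <= C * gauss (4 * t2) b].
Proof.
move=> t10 t12 A0; have [C C0 HC] := gauss_derivatives_bound t10 t12.
have t20 : 0 < t2 by exact: lt_le_trans t12.
pose S := Num.sqrt (4 * pi * (4 * t2)).
have S0 : 0 < S by rewrite sqrtr_gt0 !mulr_gt0// pi_gt0.
pose C' := C * expR (A ^+ 2 / (8 * t2)) * S.
have C'0 : 0 <= C' by rewrite !mulr_ge0 ?expR_ge0// ltW.
have shift a b : `|a| <= A ->
    C * expR (- ((a + b) ^+ 2 / (8 * t2))) <= C' * gauss (4 * t2) b.
  move=> aA; rewrite /C' /gauss -/S.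
  rewrite (_ : _ * (S^-1 * _) = C * (expR (A ^+ 2 / (8 * t2)) *
      expR (- (b ^+ 2 / (4 * (4 * t2)))))); last by field; rewrite gt_eqF.
  rewrite ler_wpM2l// -expRD ler_expR.
  have -> : b ^+ 2 / (4 * (4 * t2)) = (b ^+ 2 / 2) / (8 * t2).
    by field; rewrite gt_eqF.
  rewrite -mulrN1 mulrAC -mulNr mulrN1 -mulrDl ler_pM2r ?invr_gt0 ?mulr_gt0//.
  have : a ^+ 2 <= A ^+ 2 by rewrite -[a ^+ 2]real_normK ?num_real// lerXn2r ?nnegrE.
  by have := sqr_ge0 (2 * a + b); rewrite !expr2; lra.
exists (2 * C'); first by rewrite mulr_ge0.
have key d phi t a b : (forall z, `|phi t z| <= C * expR (- (z ^+ 2 / (8 * t2)))) ->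
    `|a| <= A -> `|odd_kernel d phi t a b| <= 2 * C' * gauss (4 * t2) b.
  move=> Hphi aA; rewrite /odd_kernel.
  have h1 := le_trans (Hphi (a - b)) (shift a (- b) aA); rewrite gauss_even in h1.
  have h2 := le_trans (Hphi (a + b)) (shift a b aA).
  have h3 : 0 <= C' * gauss (4 * t2) b by rewrite mulr_ge0// gauss_ge0.
  apply: le_trans (ler_normB _ _) _; case: d; rewrite ?normr0; lra.
move=> d t a b tt aA; split; apply: key => // z; have [h1 h2 h3] := HC t z tt => //.
by rewrite ger0_norm// gauss_ge0.
Qed.

Lemma measurable_odd_kernel d phi t a : (forall z, exists c, is_derive z 1 (phi t) c) ->
  measurable_fun setT (odd_kernel d phi t a : measurableTypeR R -> R).
Proof.
move=> dphi; have cphi : continuous (phi t).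
  by move=> z; apply/differentiable_continuous/derivable1_diffP; have [c []] := dphi z.
apply: continuous_measurable_fun => b; rewrite /odd_kernel; apply: cvgB.
  apply: (@cvg_comp _ _ _ (fun b => a - b) (phi t)); last exact: cphi.
  by apply: cvgB; [exact: cvg_cst|exact: cvg_id].
case: d; last exact: cvg_cst.
apply: (@cvg_comp _ _ _ (fun b => a + b) (phi t)); last exact: cphi.
by apply: cvgD; [exact: cvg_cst|exact: cvg_id].
Qed.

Variable m : nat.

(** The factor of index i is made from phi, the others from [gauss]: phi = [gauss_z] and phi =
    [gauss_t] give the first and second derivatives of [okernel] along the i-th axis. *)
Definition kernel_at (i : 'I_N) phi t x y :=
  \prod_(j < N) odd_kernel (j < m)%N (if j == i then phi else gauss) t (x ord0 j) (y ord0 j).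

Definition okernel t x y :=
  \prod_(j < N) odd_kernel (j < m)%N gauss t (x ord0 j) (y ord0 j).

Lemma kernel_at_line i phi t x y s : kernel_at i phi t (x + s *: 'e_i) y =
  odd_kernel (i < m)%N phi t (x ord0 i + s) (y ord0 i) *
  \prod_(j < N | j != i) odd_kernel (j < m)%N gauss t (x ord0 j) (y ord0 j).
Proof.
rewrite /kernel_at (bigD1 i)//= eqxx !mxE !eqxx mulr1; congr (_ * _).
apply: eq_bigr => j ji; rewrite (negPf ji) !mxE (negPf ji) andbF mulr0 addr0//.
Qed.

Lemma is_derive_kernel_line i phi psi t x y (s : R) :
  (forall z, is_derive z 1 (phi t) (psi t z)) ->
  is_derive s 1 (fun s => kernel_at i phi t (x + s *: 'e_i) y)
    (kernel_at i psi t (x + s *: 'e_i) y).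
Proof.
move=> h; rewrite kernel_at_line; under eq_fun do rewrite kernel_at_line.
set P := \prod_(_ < N | _) _.
have h1 : is_derive s 1 (fun s => x ord0 i + s) 1.
  exact: (is_derive_eq (is_deriveD (is_derive_cst (x ord0 i) s 1) (is_derive_id s 1)) (add0r 1)).
have h2 := is_derive_odd_kernel (i < m)%N (x ord0 i + s) (y ord0 i) h.
have h3 := @is_derive1_comp _ (fun a => odd_kernel (i < m)%N phi t a (y ord0 i)) (fun s => x ord0 i + s) s _ _ h2 h1.
have := @is_deriveZ _ _ _ _ P s 1 _ h3; rewrite /GRing.scale/= mulr1 => h4.
under eq_fun do rewrite mulrC.
by apply: (is_derive_eq h4); rewrite mulrC.
Qed.

Lemma okernelE i t x y : okernel t x y = kernel_at i gauss t x y.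
Proof. by apply: eq_bigr => j _; case: ifP. Qed.

Lemma is_derive_kernel_t t x y : 0 < t ->
  is_derive t 1 (fun t => okernel t x y) (\sum_(i < N) kernel_at i gauss_t t x y).
Proof.
move=> t0.
have := @is_derive_prod R N (fun j s => odd_kernel (j < m)%N gauss s (x ord0 j) (y ord0 j))
  (fun j s => odd_kernel (j < m)%N gauss_t s (x ord0 j) (y ord0 j)) t
  (fun j => is_derive_odd_kernel_t _ _ _ t0).
move=> h; apply: (is_derive_eq h); apply: eq_bigr => i _; apply: eq_bigr => j _.
by case: ifP.
Qed.

Lemma kernel_dominated t1 t2 A : 0 < t1 -> t1 <= t2 -> 0 <= A ->
  exists G : 'rV[R]_N -> R,
    (lebesgue_rV N).-integrable setT (EFin \o G) /\
    forall t x y, t1 <= t <= t2 -> `|x| <= A ->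
     `|okernel t x y| <= G y /\
     forall i, `|kernel_at i gauss_z t x y| <= G y /\
               `|kernel_at i gauss_t t x y| <= G y.
Proof.
move=> t10 t12 A0; have [C C0 HC] := odd_kernel_bound t10 t12 A0.
have t20 : 0 < 4 * t2 by rewrite mulr_gt0// (lt_le_trans t10).
exists (fun y => \prod_(j < N) (C * gauss (4 * t2) (y ord0 j))); split.
  have h := @integrable_integral_prod_rV R N (fun _ b => C * gauss (4 * t2) b).
  apply: (proj1 (h _)) => _.
  rewrite (_ : _ \o _ = (fun b => C%:E * (gauss (4 * t2) (0 - b))%:E)%E).
    by apply: integrableZl => //; exact: integrable_gauss.
  by apply/funext => b /=; rewrite sub0r gauss_even.
move=> t x y tt xA.
have hx j : `|x ord0 j| <= A by exact: le_trans (coord_le_norm _ _) xA.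
split=> [|i]; [|split]; rewrite normr_prod; apply: ler_prod => j _; rewrite normr_ge0/=.
- by have [] := HC (j < m)%N t (x ord0 j) (y ord0 j) tt (hx j).
- by case: ifP => _; have [] := HC (j < m)%N t (x ord0 j) (y ord0 j) tt (hx j).
- by case: ifP => _; have [] := HC (j < m)%N t (x ord0 j) (y ord0 j) tt (hx j).
Qed.

Lemma measurable_kernel_at i phi t x : 0 < t ->
  (forall z, exists c, is_derive z 1 (phi t) c) ->
  measurable_fun setT (kernel_at i phi t x).
Proof.
move=> t0 dphi; apply: (measurable_fun_prod_rV (f := fun j =>
   odd_kernel (j < m)%N (if j == i then phi else gauss) t (x ord0 j))) => j.
apply: measurable_odd_kernel => z; case: ifP => // _.
by eexists; exact: is_derive_gauss_z.
Qed.

Lemma measurable_okernel t x : 0 < t -> measurable_fun setT (okernel t x).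
Proof.
move=> t0; apply: (measurable_fun_prod_rV (f := fun j =>
   odd_kernel (j < m)%N gauss t (x ord0 j))) => j.
apply: measurable_odd_kernel => z.
by eexists; exact: is_derive_gauss_z.
Qed.

Section potential.
Variables (f : 'rV[R]_N -> R) (M : R).
Hypotheses (mf : measurable_fun setT f) (fM : forall y, `|f y| <= M).

(** For f vanishing outside the sector, as in the comparisons below, this is the heat evolution of f
    on the sector with zero values on the faces. *)
Definition heat_pot t x := \int[lebesgue_rV N]_y (okernel t x y * f y).

Let M0 : 0 <= M. Proof. exact: le_trans (normr_ge0 _) (fM 0). Qed.

Let integrable_mul (K G : 'rV[R]_N -> R) : measurable_fun setT K ->
  (lebesgue_rV N).-integrable setT (EFin \o G) ->
  (forall y, `|K y| <= G y) ->
  (lebesgue_rV N).-integrable setT (EFin \o (fun y => K y * f y)).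
Proof.
move=> mK iG KG.
apply: (@le_integrable _ _ _ _ _ measurableT _ (fun y => M%:E * (G y)%:E)%E).
- by apply/measurable_EFinP; exact: measurable_funM.
- move=> y _ /=; rewrite lee_fin !normrM [leRHS]mulrC.
  by apply: ler_pM => //; [exact: le_trans (KG y) (ler_norm _)|exact: le_trans (fM y) (ler_norm _)].
- exact: integrableZl.
Qed.

Let integrable_scale (G : 'rV[R]_N -> R) :
  (lebesgue_rV N).-integrable setT (EFin \o G) ->
  (lebesgue_rV N).-integrable setT (EFin \o (fun y => M * G y)).
Proof.
move=> iG; rewrite (_ : _ \o _ = (fun y => M%:E * (G y)%:E)%E)//.
exact: integrableZl.
Qed.

Let bound_mul (k g fy : R) : `|k| <= g -> `|fy| <= M -> `|k * fy| <= M * g.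
Proof. by move=> kg fyM; rewrite normrM mulrC; exact: ler_pM. Qed.

Lemma integrable_heat_pot t x : 0 < t ->
  (lebesgue_rV N).-integrable setT (EFin \o (fun y => okernel t x y * f y)).
Proof.
move=> t0; have [G [iG HG]] := kernel_dominated t0 (lexx t) (normr_ge0 x).
apply: (integrable_mul (measurable_okernel _ t0) iG) => y.
by have [] := HG t x y _ (lexx _); rewrite ?lexx.
Qed.

Lemma parab_heat_pot t x : 0 < t -> parab heat_pot t x 0.
Proof.
move=> t0; have t20 : 0 < t / 2 by rewrite divr_gt0.
have A0 : 0 <= `|x| + 1 by rewrite addr_ge0.
have tt2 : t / 2 <= 2 * t by lra.
have [G [iG HG]] := kernel_dominated t20 tt2 A0.
have xA : `|x| <= `|x| + 1 by rewrite lerDl.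
have tt : t / 2 <= t <= 2 * t by apply/andP; split; lra.
have mt s : 0 < s -> forall i x, measurable_fun setT (kernel_at i gauss_t s x).
  move=> s0 i x'; apply: measurable_kernel_at => // z.
  have h := is_derive_gauss_z z s0.
  have h2 : is_derive z 1 (fun z : R => z ^+ 2 / (4 * s ^+ 2) - (2 * s)^-1) (z / (2 * s ^+ 2)).
    by apply: is_derive_eq; rewrite /GRing.scale/=; field; rewrite gt_eqF.
  by eexists; exact: (@is_deriveM _ _ _ _ z 1 _ _ h2 h).
have it i : (lebesgue_rV N).-integrable setT
    (EFin \o (fun y => kernel_at i gauss_t t x y * f y)).
  apply: (integrable_mul (mt _ t0 _ _) iG) => y.
  by have [_ /(_ i)[]] := HG t x y tt xA.
exists (\int[lebesgue_rV N]_y ((\sum_(i < N) kernel_at i gauss_t t x y) * f y)),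
  (fun i => \int[lebesgue_rV N]_y (kernel_at i gauss_t t x y * f y)); split.
- apply: (@is_derive_under_integral _ _ _ _ (fun s y => okernel s x y * f y)
    (fun s y => (\sum_(i < N) kernel_at i gauss_t s x y) * f y) t (t / 2) (2 * t)
    (fun y => M * (N%:R * G y))).
  + by apply/andP; split; lra.
  + by move=> s /andP[s1 _]; apply: integrable_heat_pot; exact: lt_trans s1.
  + move=> s y /andP[s1 _]; have s0 : 0 < s by exact: lt_trans s1.
    have := @is_deriveZ _ _ _ _ (f y) s 1 _ (is_derive_kernel_t x y s0).
    rewrite /GRing.scale/= => h; under eq_fun do rewrite mulrC.
    by apply: (is_derive_eq h); rewrite mulrC.
  + apply: integrable_scale; rewrite (_ : _ \o _ = (fun y => N%:R%:E * (G y)%:E)%E)//.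
    exact: integrableZl.
  + move=> s y /andP[s1 s2]; apply: bound_mul => //.
    apply: le_trans (ler_norm_sum _ _ _) _.
    apply: (@le_trans _ _ (\sum_(i < N) G y)); last by rewrite sumr_const card_ord mulr_natl.
    apply: ler_sum => i _.
    by have [|_ /(_ i)[]] := HG s x y _ xA; first by rewrite !ltW.
- move=> i.
  have line s : -1 < s < 1 -> `|x + s *: 'e_i| <= `|x| + 1.
    rewrite -ltr_norml => s1; apply: le_trans (ler_normD _ _) _; rewrite lerD2l normrZ.
    rewrite -[leRHS]mulr1 ler_pM// ?(ltW s1)//.
    by apply/norm_rV_le => // j; rewrite !mxE eqxx /= normr_nat lern1 leq_b1.
  have der (phi psi : R -> R -> R) (s : R) : -1 < s < 1 ->
      (forall z, is_derive z 1 (phi t) (psi t z)) ->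
      (forall r y, -1 < r < 1 -> `|kernel_at i phi t (x + r *: 'e_i) y| <= G y /\
                                `|kernel_at i psi t (x + r *: 'e_i) y| <= G y) ->
      is_derive s 1 (fun s => \int[lebesgue_rV N]_y (kernel_at i phi t (x + s *: 'e_i) y * f y))
        (\int[lebesgue_rV N]_y (kernel_at i psi t (x + s *: 'e_i) y * f y)).
    move=> s1 dphi HGp.
    apply: (@is_derive_under_integral _ _ _ _ (fun s y => kernel_at i phi t (x + s *: 'e_i) y * f y)
      (fun s y => kernel_at i psi t (x + s *: 'e_i) y * f y) s (-1) 1
      (fun y => M * G y)) => //.
    - move=> r r1; apply: (integrable_mul _ iG) => [|y]; last by case: (HGp r y r1).
      by apply: measurable_kernel_at => // z; eexists; exact: dphi.
    - move=> r y r1.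
      have := @is_deriveZ _ _ _ _ (f y) r 1 _ (is_derive_kernel_line i x y r dphi).
      rewrite /GRing.scale/= => h; under eq_fun do rewrite mulrC.
      by apply: (is_derive_eq h); rewrite mulrC.
    - exact: integrable_scale.
    - by move=> r y r1; apply: bound_mul => //; case: (HGp r y r1).
  exists (fun s => \int[lebesgue_rV N]_y (kernel_at i gauss_z t (x + s *: 'e_i) y * f y)).
    near=> s.
    have s1 : -1 < s < 1.
      by apply/andP; split; near: s; [apply: lt_nbhsr|apply: lt_nbhsl]; lra.
    rewrite /heat_pot; under eq_fun do under eq_Rintegral do rewrite (okernelE i).
    apply: der => // [z|r y r1]; first exact: is_derive_gauss_z.
    have [h1 /(_ i)[h2 _]] := HG t (x + r *: 'e_i) y tt (line _ r1).
    by rewrite -okernelE.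
  have xE : x = x + 0 *: 'e_i by rewrite scale0r addr0.
  rewrite [X in is_derive _ _ _ X](_ : _ =
    \int[lebesgue_rV N]_y (kernel_at i gauss_t t (x + 0 *: 'e_i) y * f y)); last by rewrite -xE.
  apply: der => [|z|r y r1]; [by apply/andP; split; lra|exact: is_derive_gauss_zz|].
  by have [_ /(_ i)[]] := HG t (x + r *: 'e_i) y tt (line _ r1).
- rewrite /Rintegral [X in fine X](_ : _ = \sum_(i < N)
    \int[lebesgue_rV N]_y (kernel_at i gauss_t t x y * f y)%:E)%E; last first.
    rewrite -integral_sum//; apply: eq_integral => y _.
    by rewrite mulr_suml sumEFin.
  rewrite -sum_fine ?subrr// => i _.
  exact: integrable_fin_num (it i).
Unshelve. all: by end_near. Qed.

Lemma near_pair (P : R -> Prop) (Q : 'rV[R]_N -> Prop) t x :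
  (\forall s \near t, P s) -> (\forall y \near x, Q y) ->
  \forall p \near (t, x), P p.1 /\ Q p.2.
Proof.
move=> nP nQ; exists ([set s | P s], [set y | Q y]) => //= -[s y] [].
Qed.

Lemma continuous_heat_pot t x : 0 < t ->
  {for (t, x), continuous (fun p : R * 'rV[R]_N => heat_pot p.1 p.2)}.
Proof.
move=> t0; have t20 : 0 < t / 2 by rewrite divr_gt0.
have A0 : 0 <= `|x| + 1 by rewrite addr_ge0.
have tt2 : t / 2 <= 2 * t by lra.
have [G [iG HG]] := kernel_dominated t20 tt2 A0.
have nearp : \forall p \near (t, x), t / 2 < p.1 < 2 * t /\ `|p.2| <= `|x| + 1.
  have n1 : \forall s \near t, t / 2 < s by apply: lt_nbhsr; lra.
  have n2 : \forall s \near t, s < 2 * t by apply: lt_nbhsl; lra.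
  have n3 : \forall y \near x, `|y| <= `|x| + 1.
    have : `|y| @[y --> x] --> `|x| by exact: norm_continuous.
    by move/cvgr_le; apply; rewrite ltrDl.
  apply: (@near_pair (fun s => t / 2 < s < 2 * t) (fun y => `|y| <= `|x| + 1)) => //.
  by apply: filterS2 n1 n2 => s h1 h2; rewrite h1 h2.
have ck y : {for (t, x), continuous (fun p : R * 'rV[R]_N => okernel p.1 p.2 y)}.
  rewrite /okernel; apply: (@cvg_big _ _ _ _ _ _ _ (nbhs (t, x))) => [|j _].
    exact: mul_continuous.
  have c1 : (fun p : R * 'rV[R]_N => p.1) @ nbhs (t, x) --> t by exact: cvg_fst.
  have c2 : (fun p : R * 'rV[R]_N => p.2 ord0 j) @ nbhs (t, x) --> x ord0 j.
    apply: (@cvg_comp _ _ _ snd (fun x : 'rV[R]_N => x ord0 j)); first exact: cvg_snd.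
    exact: coord_continuous.
  rewrite /odd_kernel; apply: cvgB.
    by apply: cvg_gauss => //; apply: cvgB => //; exact: cvg_cst.
  case: ifP => _; last exact: cvg_cst.
  by apply: cvg_gauss => //; apply: cvgD => //; exact: cvg_cst.
(* Dominated convergence works along sequences: a failure of continuity is turned into points [p n]
   tending to (t, x) at which the potential stays e away from its value. *)
apply: contrapT => nc.
have [e e0 He] : exists2 e, 0 < e & forall B, nbhs (t, x) B ->
    exists2 p, B p & e <= `|heat_pot t x - heat_pot p.1 p.2|.
  apply: contrapT => h; apply: nc; apply/cvgrPdist_lt => e e0.
  apply: contrapT => h'; apply: h; exists e => // B nB; apply: contrapT => h.
  apply: h'; apply: filterS nB => p Bp; rewrite ltNge; apply/negP => ep.
  by apply: h; exists p.
pose B n := ball (t, x) n.+1%:R^-1 `&` [set p : R * 'rV[R]_N | t / 2 < p.1 < 2 * t /\ `|p.2| <= `|x| + 1].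
have nB n : nbhs (t, x) (B n).
  by apply: filterI nearp; apply: nbhsx_ballx.
have /choice[p Hp] : forall n, exists p, B n p /\ e <= `|heat_pot t x - heat_pot p.1 p.2|.
  by move=> n; have [p Bp ep] := He _ (nB n); exists p.
have pcvg : p n @[n --> \oo] --> (t, x).
  apply/cvg_ballP => d d0; near=> n.
  have [[+ _] _] := Hp n; apply: le_ball.
  by apply: ltW; near: n; exact: near_infty_natSinv_lt (PosNum d0).
have cv : (fun n => heat_pot (p n).1 (p n).2) @ \oo --> heat_pot t x.
  apply: fine_cvg; rewrite /heat_pot /Rintegral fineK; last first.
    exact: integrable_fin_num (integrable_heat_pot x t0).
  apply: (@dominated_cvg _ _ _ (lebesgue_rV N) setT measurableT
    (fun n y => (okernel (p n).1 (p n).2 y * f y)%:E)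
    (fun y => (okernel t x y * f y)%:E) (fun y => (M * G y)%:E)) => //.
  - move=> n; apply/measurable_EFinP; apply: measurable_funM => //.
    by apply: measurable_okernel; have [[_ /= [/andP[h _] _]] _] := Hp n; exact: lt_trans h.
  - move=> y _; apply: cvg_EFin; first exact: nearW.
    by apply: cvgMl; exact: (@cvg_comp _ _ _ p (fun q : R * 'rV[R]_N => okernel q.1 q.2 y) _ _ _ pcvg (ck y)).
  - exact: integrable_scale.
  - move=> n y _; rewrite lee_fin; apply: bound_mul => //.
    have [[_ /= [/andP[h1 h2] h3]] _] := Hp n.
    by have [] := HG (p n).1 (p n).2 y _ h3; rewrite ?(ltW h1) ?(ltW h2).
move/cvgrPdist_lt : cv => /(_ _ e0) [n _ /(_ n (leqnn _))].
by rewrite ltNge (proj2 (Hp n)).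
Unshelve. all: by end_near. Qed.

End potential.

End kernel.

(** * Gaussian masses *)

Section measurable_continuous.
Context {R : realType} {n : nat}.

(** The sigma-algebra is generated by coordinates, so U is written as a countable union of cubes
    with rational centre and half-width 1/(k + 1), enumerated by [unpickle]. *)
Lemma measurable_open_rV (U : set 'rV[R]_n) : open U -> measurable U.
Proof.
move=> oU.
pose B (p : 'rV[rat]_n * nat) : set 'rV[R]_n :=
  [set y | forall i, `|y ord0 i - ratr (p.1 ord0 i)| < p.2.+1%:R^-1].
have mB p : measurable (B p).
  rewrite (_ : B p = \bigcap_(i in [set: 'I_n]) ((fun y : 'rV[R]_n => y ord0 i) @^-1`
      [set r | `|r - ratr (p.1 ord0 i)| < p.2.+1%:R^-1])); last first.
    by apply/seteqP; split => y /= By i; [move=> _; exact: By|exact: (By i I)].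
  apply: fin_bigcap_measurable => // i _.
  rewrite -[X in measurable X]setTI; apply: (measurable_rV_coord _ measurableT).
  rewrite (_ : [set r | _] = ball (ratr (p.1 ord0 i) : R) p.2.+1%:R^-1); last first.
    by apply/seteqP; split => r /=; rewrite /ball/= distrC.
  exact: measurable_ball.
pose F (k : nat) : set 'rV[R]_n := if unpickle k is Some p then
  (if pselect (B p `<=` U) then B p else set0) else set0.
have -> : U = \bigcup_k F k.
  apply/seteqP; split=> [x Ux|x [k _]]; last first.
    by rewrite /F; case: unpickle => // p; case: pselect => // BU /BU.
  have [e e0 eU] : exists2 e : R, 0 < e & forall y : 'rV[R]_n, (forall i, `|x ord0 i - y ord0 i| < e) -> U y.
    have := open_nbhs_nbhs (conj oU Ux); rewrite -nbhs_ballE => -[e /= e0 eU].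
    by exists e => // y xy; apply: eU; split => // i j; rewrite (ord1 i); exact: xy.
  have [k ke] : exists k : nat, k.+1%:R^-1 < e / 2.
    have e20 : 0 < e / 2 by rewrite divr_gt0.
    by have [k _ /(_ k (leqnn _))] := near_infty_natSinv_lt (PosNum e20); exists k.
  have /choice[q Hq] : forall i, exists q : rat, `|x ord0 i - ratr q| < k.+1%:R^-1.
    move=> i; have k0 : 0 < k.+1%:R^-1 :> R by rewrite invr_gt0.
    have xk : x ord0 i - k.+1%:R^-1 < x ord0 i + k.+1%:R^-1.
      by rewrite ltrBlDr -addrA ltrDl addr_gt0.
    have [q] := rat_in_itvoo xk.
    rewrite in_itv/= => /andP[q1 q2]; exists q.
    move: q1 q2; move: (k.+1%:R^-1) (x ord0 i) => d xi q1 q2.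
    by rewrite ltr_norml; apply/andP; split; lra.
  pose p := (\row_i q i, k) : 'rV[rat]_n * nat.
  have BU : B p `<=` U.
    move=> y By; apply: eU => i; have := By i; rewrite /p/= mxE => h1.
    have h2 := Hq i.
    rewrite (_ : x ord0 i - y ord0 i = (x ord0 i - ratr (q i)) - (y ord0 i - ratr (q i))); last by ring.
    apply: le_lt_trans (ler_normB _ _) _.
    rewrite [ltRHS](splitr e); apply: ltrD; first exact: lt_trans ke.
    exact: lt_trans ke.
  exists (pickle p) => //; rewrite /F pickleK; case: pselect => // _ i.
  by rewrite /p/= mxE; exact: Hq.
apply: bigcup_measurable => k _; rewrite /F; case: unpickle => // p.
by case: pselect => _ /=; [exact: mB|exact: measurable0].
Qed.

Lemma measurable_continuous_rV (f : 'rV[R]_n -> R) : continuous f ->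
  measurable_fun setT f.
Proof.
move=> /continuousP cf; apply: (measurability _ (RGenOInfty.measurableE R)).
move=> _ [_ [a ->] <-]; rewrite setTI.
by apply: measurable_open_rV; apply: cf; exact: interval_open.
Qed.

End measurable_continuous.

(** * Reflection of the line, and integrability of powers near 0 *)

Section oppr.
Context {R : realType}.
Local Notation leb := (@lebesgue_measure R).

Lemma measurable_oppr :
  measurable_fun setT (-%R : measurableTypeR R -> measurableTypeR R).
Proof. by apply: continuous_measurable_fun; exact: opp_continuous. Qed.

Lemma ge0_integral_oppr (f : R -> \bar R) : measurable_fun setT f ->
  (forall x, 0 <= f x)%E -> (\int[leb]_x f (- x)%R = \int[leb]_x f x)%E.
Proof.
move=> mf f0.
have := @ge0_integral_pushforward _ _ _ _ _ _ measurable_oppr leb setT f measurableT mf (fun x _ => f0 x).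
rewrite preimage_setT => <-.
by apply: eq_measure_integral => //= A mA _; exact: lebesgue_measureN.
Qed.

Lemma integrable_oppr (f : R -> R) : leb.-integrable setT (EFin \o f) ->
  leb.-integrable setT (EFin \o (fun x => f (- x))).
Proof.
move=> /integrableP[mf fi]; apply/integrableP; split.
  exact: (measurableT_comp mf measurable_oppr).
have := @ge0_integral_oppr (fun x => `|(f x)%:E|%E).
move=> -> //; apply: (measurableT_comp (f := abse) _ mf).
exact: abse_measurable.
Qed.

Lemma Rintegral_oppr (f : R -> R) : leb.-integrable setT (EFin \o f) ->
  \int[leb]_x f (- x) = \int[leb]_x f x.
Proof.
move=> fi.
have [mf _] := integrableP _ _ _ fi.
rewrite /Rintegral; congr fine.
have := @integral_pushforward _ _ _ _ _ _ measurable_oppr leb setT (EFin \o f) mf.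
rewrite preimage_setT => /(_ (integrable_oppr fi) measurableT) <-.
by apply: eq_measure_integral => //= A mA _; exact: lebesgue_measureN.
Qed.

(* The monotone limit of the integrals over [1/(n+1), 1]. *)
Lemma integrable_powR01 (p : R) : p < 1 ->
  leb.-integrable setT (EFin \o ((fun b => b `^ (- p)) \_ `]0, 1])).
Proof.
move=> p1; have q0 : 0 < 1 - p by rewrite subr_gt0.
pose f n : R -> R := (fun b => b `^ (- p)) \_ `[n.+1%:R^-1, 1].
have mpow : measurable_fun setT (fun b : measurableTypeR R => b `^ (- p)).
  exact: measurable_powR.
have mres (D : set (measurableTypeR R)) : measurable D ->
    measurable_fun setT (((fun b => b `^ (- p)) \_ D) : measurableTypeR R -> R).
  by move=> mD; apply/(measurable_restrictT _ mD); exact: measurable_funS mpow.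
have f0 n b : 0 <= f n b by rewrite /f patchE; case: ifP => // _; exact: powR_ge0.
apply/integrableP; split; first by apply/measurable_EFinP; exact: mres.
have E b : (`|(((fun b : R => b `^ (- p)) \_ `]0, 1]) b)%:E| =
    limn (fun n => (f n b)%:E))%E.
  apply/esym/cvg_lim => //.
  have [b01|b01] := boolP (b \in (`]0, 1]%classic : set R)); last first.
    apply: cvg_near_cst; near=> n.
    rewrite patchE (negPf b01) abse0 /f patchE ifF//.
    apply: contraNF b01 => /set_mem/=; rewrite !in_itv/= => /andP[b1 b2].
    rewrite inE/= in_itv/= b2 andbT.
    by apply: lt_le_trans b1; rewrite invr_gt0.
  apply: cvg_near_cst.
  move: (b01) => /set_mem/=; rewrite in_itv/= => /andP[b0 b1].
  have := near_infty_natSinv_lt (PosNum b0); apply: filterS => n /= nb.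
  rewrite /f !patchE b01 ifT; first by rewrite ger0_norm// powR_ge0.
  by rewrite inE/= in_itv/= b1 ltW.
rewrite [ltLHS](_ : _ = \int[leb]_b limn (fun n => (f n b)%:E))%E; last first.
  by apply: eq_integral => b _; exact: E.
rewrite monotone_convergence//; first last.
- move=> b _ n1 n2 n12; rewrite lee_fin /f !patchE.
  case: ifPn => [/set_mem/=|_]; last by case: ifP => _ //; exact: powR_ge0.
  rewrite in_itv/= => /andP[h1 h2]; rewrite ifT// inE/= in_itv/= h2 andbT.
  by apply: le_trans h1; rewrite lef_pV2 ?posrE// ler_nat ltnS.
- by move=> n b _; rewrite lee_fin.
- by move=> n; apply/measurable_EFinP; exact: mres.
(* The integral over [1/(n+1), 1] is (1 - (n+1)^(p-1)) / (1 - p) by the fundamental theorem of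
   calculus. *)
apply: (@le_lt_trans _ _ ((1 - p)^-1)%:E); last by rewrite ltry.
apply: lime_le.
  apply: ereal_nondecreasing_is_cvgn => n1 n2 n12.
  apply: ge0_le_integral => //.
  - by move=> b _; rewrite lee_fin.
  - by apply/measurable_EFinP; exact: mres.
  - by apply/measurable_EFinP; exact: mres.
  - move=> b _; rewrite lee_fin /f !patchE.
    case: ifPn => [/set_mem/=|_]; last by case: ifP => _ //; exact: powR_ge0.
    rewrite in_itv/= => /andP[h1 h2]; rewrite ifT// inE/= in_itv/= h2 andbT.
    by apply: le_trans h1; rewrite lef_pV2 ?posrE// ler_nat ltnS.
near=> n.
rewrite [leLHS](_ : _ = \int[leb]_(b in `[(n.+1%:R^-1)%R, 1%R]) (b `^ (- p))%:E)%E; last first.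
  by rewrite [RHS]integral_mkcond restrict_EFin.
have n1 : n.+1%:R^-1 < 1 :> R by rewrite invf_lt1// ltr1n; near: n; exists 1%N.
have n0 : 0 < n.+1%:R^-1 :> R by rewrite invr_gt0.
have dF (x : R) : 0 < x -> is_derive x 1 (fun x => (1 - p)^-1 * x `^ (1 - p)) (x `^ (- p)).
  move=> x0; have := @is_deriveZ _ _ _ _ (1 - p)^-1 x 1 _ (is_derive1_powR (1 - p) x0).
  move=> h; apply: (is_derive_eq h); rewrite /GRing.scale/= mulrA mulVf ?gt_eqF// mul1r.
  by congr (_ `^ _); ring.
have cpow (r x : R) : 0 < x -> {for x, continuous (fun b => b `^ r)}.
  move=> x0; apply/differentiable_continuous/derivable1_diffP.
  by have [] := is_derive1_powR r x0.
rewrite (@continuous_FTC2 _ (fun b => b `^ (- p)) (fun x => (1 - p)^-1 * x `^ (1 - p))) //.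
- rewrite powR1 mulr1 -EFinB lee_fin lerBlDr lerDl mulr_ge0 ?powR_ge0// invr_ge0 ltW//.
- apply: continuous_in_subspaceT => x /set_mem/=; rewrite in_itv/= => /andP[x1 _].
  by apply: cpow; exact: lt_le_trans x1.
- split.
  + by move=> x; rewrite in_itv/= => /andP[x1 _]; have [] := dF x (lt_trans n0 x1).
  + by apply: cvg_at_right_filter; apply: cvgMr; exact: cpow.
  + by apply: cvg_at_left_filter; apply: cvgMr; exact: cpow.
- move=> x; rewrite in_itv/= => /andP[x1 _]; rewrite derive1E.
  by have [] := dF x (lt_trans n0 x1).
Unshelve. all: by end_near. Qed.

End oppr.

Section gauss_mass.
Context {R : realType}.
Implicit Types (t a b r c : R).
Local Notation leb := (@lebesgue_measure R).

(** An upper bound for, not the value of, the Gaussian mass at distance at least r; see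
    [gauss_tail]. *)
Definition tail t r : R := Num.sqrt 2 * expR (- (r ^+ 2 / (8 * t))).

Lemma tail_ge0 t r : 0 <= tail t r.
Proof. by rewrite mulr_ge0 ?sqrtr_ge0 ?expR_ge0. Qed.

Lemma integrable_gaussM t a (phi : R -> R) (M : R) : 0 < t ->
  measurable_fun setT (phi : measurableTypeR R -> R) -> (forall b, `|phi b| <= M) ->
  leb.-integrable setT (EFin \o (fun b => gauss t (a - b) * phi b)).
Proof.
move=> t0 mphi phiM.
have ig : leb.-integrable setT (EFin \o (fun b => M * gauss t (a - b))).
  rewrite (_ : _ \o _ = (fun b => M%:E * (gauss t (a - b))%:E)%E)//.
  by apply: integrableZl => //; exact: integrable_gauss.
apply: (le_integrable measurableT _ _ ig).
- by apply/measurable_EFinP; apply: measurable_funM => //; exact: measurable_gauss.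
- move=> b _ /=; rewrite lee_fin !normrM [leRHS]mulrC ler_wpM2l//.
  exact: le_trans (phiM b) (ler_norm _).
Qed.

Lemma integral_gauss_le t a (phi : R -> R) : 0 < t ->
  measurable_fun setT (phi : measurableTypeR R -> R) -> (forall b, `|phi b| <= 1) ->
  `|\int[leb]_b (gauss t (a - b) * phi b)| <= 1.
Proof.
move=> t0 mphi phi1; have ig := integrable_gaussM a t0 mphi phi1.
apply: le_trans (le_normr_Rintegral measurableT ig) _.
rewrite -(integral_gauss a t0); apply: le_Rintegral => //.
- rewrite (_ : _ \o _ = abse \o (EFin \o (fun b => gauss t (a - b) * phi b)))//.
  exact: integrable_abse.
- exact: integrable_gauss.
- by move=> b _; rewrite normrM ger0_norm ?gauss_ge0// ler_piMr ?gauss_ge0.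
Qed.

Lemma integral_gauss_tail t r a (phi : R -> R) : 0 < t -> 0 <= r ->
  measurable_fun setT (phi : measurableTypeR R -> R) -> (forall b, 0 <= phi b <= 1) ->
  (forall b, `|a - b| < r -> phi b = 0) ->
  \int[leb]_b (gauss t (a - b) * phi b) <= tail t r.
Proof.
move=> t0 r0 mphi phi01 phi0; have t20 : 0 < 2 * t by rewrite mulr_gt0.
have phi1 b : `|phi b| <= 1 by case/andP: (phi01 b) => h1 h2; rewrite ger0_norm.
have i2 : leb.-integrable setT (EFin \o (fun b => tail t r * gauss (2 * t) (a - b))).
  rewrite (_ : _ \o _ = (fun b => (tail t r)%:E * (gauss (2 * t) (a - b))%:E)%E)//.
  by apply: integrableZl => //; exact: integrable_gauss.
apply: (@le_trans _ _ (\int[leb]_b (tail t r * gauss (2 * t) (a - b)))).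
  apply: le_Rintegral => //; first exact: integrable_gaussM phi1.
  move=> b _; have [ab|ab] := ltP `|a - b| r.
    by rewrite phi0// mulr0 mulr_ge0 ?tail_ge0 ?gauss_ge0.
  apply: le_trans (gauss_tail t0 r0 ab).
  by rewrite ler_piMr ?gauss_ge0//; case/andP: (phi01 b).
rewrite RintegralZl//; first by rewrite integral_gauss// mulr1.
exact: integrable_gauss.
Qed.

Lemma integral_gauss_strip t a c (phi : R -> R) : 0 < t -> 0 <= c ->
  measurable_fun setT (phi : measurableTypeR R -> R) -> (forall b, 0 <= phi b <= 1) ->
  (forall b, ~~ (0 <= b <= c) -> phi b = 0) ->
  \int[leb]_b (gauss t (a - b) * phi b) <= c / Num.sqrt (4 * pi * t).
Proof.
move=> t0 c0 mphi phi01 phi0.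
have phi1 b : `|phi b| <= 1 by case/andP: (phi01 b) => h1 h2; rewrite ger0_norm.
rewrite -lee_fin fineK; last exact: integrable_fin_num (integrable_gaussM a t0 mphi phi1).
apply: (@le_trans _ _ (\int[leb]_b (cst ((Num.sqrt (4 * pi * t))^-1)%:E \_ `[0%R, c]) b)%E).
  apply: ge0_le_integral => //.
  - by move=> b _; rewrite lee_fin mulr_ge0 ?gauss_ge0//; case/andP: (phi01 b).
  - by apply/measurable_EFinP; apply: measurable_funM => //; exact: measurable_gauss.
  - by apply: (proj1 (measurable_restrictT _ _)).
  - move=> b _; rewrite patchE; case: ifPn => bc.
      rewrite lee_fin; apply: le_trans (gauss_ub (a - b) t0).
      by rewrite ler_piMr ?gauss_ge0//; case/andP: (phi01 b).
    by rewrite phi0 ?mulr0//; apply: contra bc => h; rewrite inE/= in_itv.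
rewrite -integral_mkcond integral_cst//= lebesgue_measure_itv/= lte_fin.
case: ifPn => _; last by rewrite mule0 lee_fin divr_ge0 ?sqrtr_ge0.
by rewrite oppr0 adde0 -EFinM lee_fin mulrC.
Qed.

(** The heat evolution of the sign function on the line; the evolution of the antisymmetric function
    h is a product of such factors. *)
Definition gauss_sg t a : R := \int[leb]_b (gauss t (a - b) * Num.sg b).

Lemma measurable_sgr : measurable_fun setT (Num.sg : measurableTypeR R -> R).
Proof.
rewrite (_ : Num.sg = (fun b => (\1_(`]0%R, +oo[%classic : set R) b - \1_(`]-oo, 0%R[%classic : set R) b) : R)).
  by apply: measurable_funB; exact: measurable_indic.
apply/funext => b; rewrite !indicE !mem_setE !in_itv/= andbT.
have [b0|b0|->] := ltrgt0P b.
- by rewrite gtr0_sg// subr0.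
- by rewrite ltr0_sg// sub0r.
- by rewrite sgr0 subrr.
Qed.

Let sg1 b : `|Num.sg b| <= 1 :> R.
Proof. by rewrite normr_sg lern1 leq_b1. Qed.

Lemma integrable_gauss_sg t a : 0 < t ->
  leb.-integrable setT (EFin \o (fun b => gauss t (a - b) * Num.sg b)).
Proof. by move=> t0; exact: integrable_gaussM measurable_sgr sg1. Qed.

Lemma gauss_sg_le t a : 0 < t -> `|gauss_sg t a| <= 1.
Proof. by move=> t0; exact: integral_gauss_le measurable_sgr sg1. Qed.

Lemma gauss_sgN t a : 0 < t -> gauss_sg t (- a) = - gauss_sg t a.
Proof.
move=> t0; rewrite /gauss_sg -(Rintegral_oppr (integrable_gauss_sg (- a) t0)).
rewrite -[RHS]mulN1r -RintegralZl//; last exact: integrable_gauss_sg.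
apply: eq_Rintegral => b _; rewrite sgrN -opprD gauss_even; ring.
Qed.

(** By oddness twice the value is the integral of (gauss(a - b) - gauss(a + b)) sg b, in which both
    factors have the sign of b. *)
Lemma gauss_sg_ge0 t a : 0 < t -> 0 <= a -> 0 <= gauss_sg t a.
Proof.
move=> t0 a0.
suff : 0 <= gauss_sg t a - gauss_sg t (- a) by rewrite gauss_sgN//; lra.
rewrite /gauss_sg -RintegralB//; try exact: integrable_gauss_sg.
apply: Rintegral_ge0 => b _; rewrite -mulrBl -opprD gauss_even.
have key c : 0 <= c -> gauss t (a + c) <= gauss t (a - c).
  move=> c0; rewrite /gauss ler_wpM2l ?invr_ge0 ?sqrtr_ge0// ler_expR lerN2.
  rewrite ler_pM2r ?invr_gt0 ?mulr_gt0//.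
  by have := mulr_ge0 a0 c0; rewrite !expr2; lra.
have [b0|b0] := leP 0 b.
  by rewrite mulr_ge0 ?sgr_ge0// subr_ge0 key.
rewrite mulr_le0//; last by rewrite sgr_le0 ltW.
by rewrite subr_le0; have := key (- b); rewrite opprK; apply; rewrite oppr_ge0 ltW.
Qed.

Lemma gauss_sg_ge t a r : 0 < t -> 0 <= r -> r <= a -> 1 - 2 * tail t r <= gauss_sg t a.
Proof.
move=> t0 r0 ra.
have iB := integrable_gauss a t0; have iS := integrable_gauss_sg a t0.
suff : 1 - gauss_sg t a <= 2 * tail t r by lra.
rewrite -[X in X - _](integral_gauss a t0) /gauss_sg -RintegralB//.
pose phi b := (1 - Num.sg b) / 2.
have mphi : measurable_fun setT (phi : measurableTypeR R -> R).
  by apply: measurable_funM => //; apply: measurable_funB => //; exact: measurable_sgr.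
have phi01 b : 0 <= phi b <= 1.
  by rewrite /phi; have := sg1 b; rewrite ler_norml => /andP[]; lra.
have phi0 b : `|a - b| < r -> phi b = 0.
  by move=> ab; rewrite /phi gtr0_sg ?subrr ?mul0r//; move: ab; rewrite ltr_norml; lra.
have phi1 b : `|phi b| <= 1 by case/andP: (phi01 b) => h1 h2; rewrite ger0_norm.
rewrite (_ : \int[leb]_b _ = 2 * \int[leb]_b (gauss t (a - b) * phi b)).
  by rewrite ler_pM2l// integral_gauss_tail.
rewrite -RintegralZl//; last exact: integrable_gaussM phi1.
by apply: eq_Rintegral => b _; rewrite /phi; field.
Qed.

(** One [tail] is lost outside the window of radius r about a. The image term loses another: its
    centre -a is at distance at least r from the window because a >= r. *)
Lemma odd_kernel_mass (d : bool) t a r : 0 < t -> 0 <= r -> (d -> r <= a) ->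
  let phi := fun b => \1_(`]a - r, a + r[%classic : set R) b in
  leb.-integrable setT (EFin \o (fun b => odd_kernel d gauss t a b * phi b)) /\
  1 - 2 * tail t r <= \int[leb]_b (odd_kernel d gauss t a b * phi b).
Proof.
move=> t0 r0 dra phi.
have mphi : measurable_fun setT (phi : measurableTypeR R -> R).
  exact: measurable_indic.
have phi01 b : 0 <= phi b <= 1 by rewrite /phi indicE ler0n lern1 leq_b1.
have phi1 b : `|phi b| <= 1 by case/andP: (phi01 b) => h1 h2; rewrite ger0_norm.
have i1 := integrable_gaussM a t0 mphi phi1.
have i2 : leb.-integrable setT (EFin \o (fun b => gauss t (- a - b) * phi b)).
  exact: integrable_gaussM phi1.
have c01 b : 0 <= 1 - phi b <= 1 by have /andP[] := phi01 b; lra.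
have c1 b : `|1 - phi b| <= 1 by case/andP: (c01 b) => h1 h2; rewrite ger0_norm.
have mc : measurable_fun setT ((fun b => 1 - phi b) : measurableTypeR R -> R).
  exact: measurable_funB.
have i3 := integrable_gaussM a t0 mc c1.
have h1 : 1 - tail t r <= \int[leb]_b (gauss t (a - b) * phi b).
  have h : \int[leb]_b (gauss t (a - b) * (1 - phi b)) <= tail t r.
    apply: integral_gauss_tail => // b ab; rewrite /phi indicE mem_set ?subrr//=.
    by rewrite in_itv/=; move: ab; rewrite ltr_norml; lra.
  rewrite -[leLHS]/(1 - tail t r) -(integral_gauss a t0).
  suff : \int[leb]_b gauss t (a - b) = \int[leb]_b (gauss t (a - b) * phi b) +
    \int[leb]_b (gauss t (a - b) * (1 - phi b)) by lra.
  by rewrite -RintegralD//; apply: eq_Rintegral => b _; ring.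
case: d dra => [dra|_]; last first.
  rewrite /odd_kernel; under eq_fun do rewrite subr0.
  by split=> //; have := tail_ge0 t r; lra.
have h2 : \int[leb]_b (gauss t (- a - b) * phi b) <= tail t r.
  apply: integral_gauss_tail => // b ab; rewrite /phi indicE memNset//= in_itv/=.
  move=> /andP[b1 b2]; move: ab; rewrite -opprD normrN ltr_norml.
  by have := dra isT; lra.
have E : (fun b => odd_kernel true gauss t a b * phi b) =
    (fun b => gauss t (a - b) * phi b - gauss t (- a - b) * phi b).
  by apply/funext => b; rewrite /odd_kernel -mulrBl -opprD gauss_even.
rewrite E; split.
  rewrite (_ : _ \o _ = (fun b => (gauss t (a - b) * phi b)%:E - (gauss t (- a - b) * phi b)%:E)%E)//.
  exact: integrableB.
rewrite RintegralB//; lra.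
Qed.

End gauss_mass.

(** * Gaussian masses and kernel bounds on R^N *)

Section mass_rV.
Context {R : realType} {N : nat}.
Variable m : nat.
Implicit Types (t a b r : R) (x y : 'rV[R]_N).
Local Notation leb := (@lebesgue_measure R).

Definition gaussN t x y := \prod_(j < N) gauss t (x ord0 j - y ord0 j).

Lemma gaussN_ge0 t x y : 0 <= gaussN t x y.
Proof. by apply: prodr_ge0 => j _; exact: gauss_ge0. Qed.

Lemma heat_kernelE t x y : 0 < t -> heat_kernel t (x - y) = gaussN t x y.
Proof.
move=> t0; have pt0 : 0 < 4 * pi * t by rewrite !mulr_gt0// pi_gt0.
rewrite /heat_kernel /gaussN /gauss big_split/= prodr_const card_ord; congr (_ * _).
  rewrite -powR12_sqrt ?(ltW pt0)// -powRN -powR_mulrn ?powR_ge0// -powRrM.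
  by congr (_ `^ _); rewrite mulNr mulrC.
rewrite /enorm sqr_sqrtr; last by apply: sumr_ge0 => i _; exact: sqr_ge0.
rewrite mulr_suml -sumrN -(big_morph _ (@expRD R) (@expR0 R)).
by congr expR; apply: eq_bigr => j _; rewrite !mxE.
Qed.

Lemma integrable_gaussN t x : 0 < t ->
  (lebesgue_rV N).-integrable setT (EFin \o gaussN t x) /\
  \int[lebesgue_rV N]_y gaussN t x y = 1.
Proof.
move=> t0.
have [h1 h2] := @integrable_integral_prod_rV R N (fun j b => gauss t (x ord0 j - b))
  (fun j => integrable_gauss (x ord0 j) t0).
split=> //; rewrite [LHS]h2 big1// => j _; exact: integral_gauss.
Qed.

Lemma integrable_gaussN_factor t x i (phi : R -> R) : 0 < t ->
  measurable_fun setT (phi : measurableTypeR R -> R) -> (forall b, `|phi b| <= 1) ->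
  (lebesgue_rV N).-integrable setT (EFin \o (fun y => gaussN t x y * phi (y ord0 i))) /\
  \int[lebesgue_rV N]_y (gaussN t x y * phi (y ord0 i)) =
    \int[leb]_b (gauss t (x ord0 i - b) * phi b).
Proof.
move=> t0 mphi phi1.
pose f j b := gauss t (x ord0 j - b) * (if j == i then phi b else 1).
have fi j : leb.-integrable setT (EFin \o f j).
  apply: (integrable_gaussM _ (M := 1) t0); first by case: (j == i).
  by move=> b; case: ifP => // _; rewrite normr1.
have [h1 h2] := integrable_integral_prod_rV fi.
have E y : gaussN t x y * phi (y ord0 i) = \prod_(j < N) f j (y ord0 j).
  rewrite /f big_split/=; congr (_ * _).
  by rewrite (bigD1 i)//= eqxx big1 ?mulr1// => j /negPf ->.
split.
  rewrite (_ : _ \o _ = (fun y => (\prod_(j < N) f j (y ord0 j))%:E))//.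
  by apply/funext => y /=; rewrite E.
under eq_Rintegral do rewrite E.
rewrite h2 (bigD1 i)//= [X in _ * X]big1 ?mulr1.
  by apply: eq_Rintegral => b _; rewrite /f eqxx.
move=> j /negPf ji; rewrite -[RHS](integral_gauss (x ord0 j) t0).
by apply: eq_Rintegral => b _; rewrite /f ji mulr1.
Qed.

(** Here b is a coordinate of x and c the same coordinate of the integration point, bad when in
    [0, a] or at distance at least r from b. Adding the indicators lets the two masses be estimated
    separately; the value 2 on the overlap is harmless in an upper bound, as is counting the strip
    for the coordinates beyond m. *)
Definition bad_weight (a r b c : R) : R :=
  \1_(`[0, a]%classic : set R) c + \1_(~` `]b - r, b + r[%classic : set R) c.

Lemma integral_bad_mass t x a r : 0 < t -> 0 <= a -> 0 <= r ->
  let B := fun y => \sum_(i < N) gaussN t x y * bad_weight a r (x ord0 i) (y ord0 i) in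
  [/\ (lebesgue_rV N).-integrable setT (EFin \o B), (forall y, 0 <= B y) &
   \int[lebesgue_rV N]_y B y <= N%:R * (a / Num.sqrt (4 * pi * t) + tail t r)].
Proof.
move=> t0 a0 r0 B.
have m1 : measurable_fun setT ((fun c => \1_(`[0, a]%classic : set R) c) : measurableTypeR R -> R).
  exact: measurable_indic.
have m2 b : measurable_fun setT ((fun c => \1_(~` `]b - r, b + r[%classic : set R) c) : measurableTypeR R -> R).
  by apply: measurable_indic; exact: measurableC.
have ind01 (A : set R) c : 0 <= (\1_A c : R) <= 1 by rewrite indicE ler0n lern1 leq_b1.
have ind1 (A : set R) c : `|(\1_A c : R)| <= 1 by case/andP: (ind01 A c) => ? ?; rewrite ger0_norm.
have F1 i := @integrable_gaussN_factor t x i _ t0 m1 (ind1 _).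
have F2 i := @integrable_gaussN_factor t x i _ t0 (m2 (x ord0 i)) (ind1 _).
have E i y : (gaussN t x y * bad_weight a r (x ord0 i) (y ord0 i))%:E =
  ((gaussN t x y * \1_(`[0, a]%classic : set R) (y ord0 i))%:E +
   (gaussN t x y * \1_(~` `](x ord0 i) - r, (x ord0 i) + r[%classic : set R) (y ord0 i))%:E)%E.
  by rewrite -EFinD -mulrDr.
have iB i : (lebesgue_rV N).-integrable setT (fun y =>
   (gaussN t x y * bad_weight a r (x ord0 i) (y ord0 i))%:E).
  under eq_fun do rewrite E.
  by apply: integrableD => //; [exact: (F1 i).1|exact: (F2 i).1].
have EB : EFin \o B = (fun y => \sum_(i < N) (gaussN t x y * bad_weight a r (x ord0 i) (y ord0 i))%:E)%E.
  by apply/funext => y /=; rewrite sumEFin.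
split.
- by rewrite EB; apply: integrable_sum.
- move=> y; apply: sumr_ge0 => i _; rewrite mulr_ge0 ?gaussN_ge0// addr_ge0//.
rewrite /Rintegral -[X in fine X]/(\int[lebesgue_rV N]_y (EFin \o B) y)%E EB integral_sum//.
rewrite -sum_fine; last by move=> i _; exact: integrable_fin_num (iB i).
rewrite [leRHS](_ : _ = \sum_(i < N) (a / Num.sqrt (4 * pi * t) + tail t r)); last first.
  by rewrite sumr_const card_ord mulr_natl.
apply: ler_sum => i _.
rewrite (_ : fine _ = \int[lebesgue_rV N]_y (gaussN t x y * \1_(`[0, a]%classic : set R) (y ord0 i)) +
  \int[lebesgue_rV N]_y (gaussN t x y * \1_(~` `](x ord0 i) - r, (x ord0 i) + r[%classic : set R) (y ord0 i))); last first.
  rewrite -RintegralD//; [|exact: (F1 i).1|exact: (F2 i).1].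
  by apply: eq_Rintegral => y _; rewrite -mulrDr.
rewrite (F1 i).2 (F2 i).2; apply: lerD.
  apply: integral_gauss_strip => // c h; rewrite indicE memNset//=.
  by rewrite in_itv; exact/negP.
apply: integral_gauss_tail => // c h; rewrite indicE memNset//= => h'; apply: h'.
by rewrite in_itv/=; move: h; rewrite ltr_norml; lra.
Qed.

Lemma okernel_ge0 t x y : 0 < t ->
  (forall i : 'I_N, (i < m)%N -> 0 <= x ord0 i) ->
  (forall i : 'I_N, (i < m)%N -> 0 <= y ord0 i) ->
  forall j : 'I_N, 0 <= odd_kernel (j < m)%N gauss t (x ord0 j) (y ord0 j)
         <= gauss t (x ord0 j - y ord0 j).
Proof.
move=> t0 x0 y0 j; rewrite /odd_kernel; case: ifP => jm; last first.
  by rewrite subr0 gauss_ge0 lexx.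
rewrite gerBl gauss_ge0 andbT subr_ge0 /gauss.
rewrite ler_wpM2l ?invr_ge0 ?sqrtr_ge0// ler_expR lerN2.
rewrite ler_pM2r ?invr_gt0 ?mulr_gt0//.
by have := mulr_ge0 (x0 j jm) (y0 j jm); rewrite !expr2; lra.
Qed.

Lemma okernel_le_gaussN t x y : 0 < t ->
  (forall i : 'I_N, (i < m)%N -> 0 <= x ord0 i) ->
  (forall i : 'I_N, (i < m)%N -> 0 <= y ord0 i) ->
  0 <= okernel m t x y <= gaussN t x y.
Proof.
move=> t0 x0 y0; have h := okernel_ge0 t0 x0 y0; apply/andP; split.
  by apply: prodr_ge0 => j _; case/andP: (h j).
exact: ler_prod.
Qed.

(** Each reflected factor is gauss(x_j - y_j) (1 - exp(- x_j y_j / t)), and 1 - exp(-s) <= s. The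
    gain y_1...y_m compensates the singularity of v0 at the origin. *)
Lemma okernel_le_coord t1 x : 0 < t1 ->
  (forall i : 'I_N, (i < m)%N -> 0 <= x ord0 i) ->
  exists2 C, 0 <= C & forall t y, t1 <= t ->
    (forall i : 'I_N, (i < m)%N -> 0 <= y ord0 i) ->
    okernel m t x y <= C * \prod_(i < N | (i < m)%N) y ord0 i.
Proof.
move=> t10 x0.
pose A := (Num.sqrt (4 * pi * t1))^-1.
have A0 : 0 <= A by rewrite invr_ge0 sqrtr_ge0.
exists (\prod_(j < N) (if (j < m)%N then A * (x ord0 j / t1) else A)).
  apply: prodr_ge0 => j _; case: ifP => // jm.
  by rewrite mulr_ge0// divr_ge0 ?x0// ltW.
move=> t y t1t y0; have t0 : 0 < t by exact: lt_le_trans t1t.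
rewrite [X in _ * X]big_mkcond -big_split/=; apply: ler_prod => j _.
have /andP[-> /=] := okernel_ge0 t0 x0 y0 j.
have tV : t^-1 <= t1^-1 by rewrite lef_pV2 ?posrE.
have pt0 s : 0 < s -> 0 < 4 * pi * s by move=> s0; rewrite !mulr_gt0// pi_gt0.
have AE : (Num.sqrt (4 * pi * t))^-1 <= A.
  rewrite lef_pV2 ?posrE ?sqrtr_gt0 ?pt0//.
  by rewrite ler_wsqrtr// ler_pM2l// mulr_gt0// pi_gt0.
case: ifP => jm h; last first.
  by rewrite mulr1; apply: le_trans h (le_trans (gauss_ub _ t0) AE).
have xj := x0 j jm; have yj := y0 j jm.
rewrite /odd_kernel /gauss -mulrBr -[leRHS]mulrA.
apply: ler_pM => //.
  rewrite subr_ge0 ler_expR lerN2 ler_pM2r ?invr_gt0 ?mulr_gt0//.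
  by have := mulr_ge0 xj yj; rewrite !expr2; lra.
have -> : - ((x ord0 j + y ord0 j) ^+ 2 / (4 * t)) =
    - ((x ord0 j - y ord0 j) ^+ 2 / (4 * t)) + - (x ord0 j * y ord0 j / t).
  by field; rewrite gt_eqF.
rewrite expRD -[X in X - _]mulr1 -mulrBr.
apply: (@le_trans _ _ (1 - expR (- (x ord0 j * y ord0 j / t)))).
  rewrite ler_piMl//; last by rewrite expR_le1 oppr_le0 divr_ge0 ?sqr_ge0// mulr_ge0// ltW.
  by rewrite subr_ge0 expR_le1 oppr_le0 divr_ge0 ?mulr_ge0// ltW.
have h1 := expR_ge1Dx (- (x ord0 j * y ord0 j / t)).
apply: (@le_trans _ _ (x ord0 j * y ord0 j / t)); first lra.
rewrite [leRHS](_ : _ = x ord0 j * y ord0 j * t1^-1); last by ring.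
by rewrite ler_wpM2l// mulr_ge0.
Qed.

(** Keep only the cube of half-width r about x. It lies in the sector because r <= x_i, f is at
    least c on it, and the kernel mass of the cube factorises into windows. *)
Lemma heat_pot_ge (f : 'rV[R]_N -> R) M c t x r : 0 < t -> 0 <= r -> 0 <= c ->
  2 * tail t r <= 1 ->
  (forall i : 'I_N, (i < m)%N -> r <= x ord0 i) ->
  measurable_fun setT f -> (forall y, 0 <= f y <= M) ->
  (forall y, ~ (forall i : 'I_N, (i < m)%N -> 0 <= y ord0 i) -> f y = 0) ->
  (forall y, (forall j, `|x ord0 j - y ord0 j| < r) -> c <= f y) ->
  c * (1 - 2 * tail t r) ^+ N <= heat_pot m f t x.
Proof.
move=> t0 r0 c0 t1 xr mf f0M fO fc.
have x0 (i : 'I_N) : (i < m)%N -> 0 <= x ord0 i by move=> im; apply: le_trans (xr i im).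
pose phi (j : 'I_N) b := \1_(`](x ord0 j) - r, (x ord0 j) + r[%classic : set R) b : R.
have H (j : 'I_N) := @odd_kernel_mass R (j < m)%N t (x ord0 j) r t0 r0 (xr j).
pose F (j : 'I_N) b := odd_kernel (j < m)%N gauss t (x ord0 j) b * phi j b.
have [h1 h2] := @integrable_integral_prod_rV R N F (fun j => (H j).1).
have h3 : (1 - 2 * tail t r) ^+ N <= \prod_(j < N) \int[leb]_b F j b.
  rewrite [leLHS](_ : _ = \prod_(j < N) (1 - 2 * tail t r)); last first.
    by rewrite prodr_const card_ord.
  apply: ler_prod => j _.
  by rewrite subr_ge0 t1/=; exact: (H j).2.
apply: (@le_trans _ _ (c * \prod_(j < N) \int[leb]_b F j b)); first by rewrite ler_wpM2l.
rewrite -h2 -RintegralZl//; apply: le_Rintegral => //.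
- rewrite (_ : _ \o _ = (fun y => c%:E * (\prod_(j < N) F j (y ord0 j))%:E)%E)//.
  exact: integrableZl.
- have fM y : `|f y| <= M by case/andP: (f0M y) => ? ?; rewrite ger0_norm.
  exact: (integrable_heat_pot m mf fM).
move=> y _; rewrite /F big_split/= -/(okernel m t x y).
have [yx|nyx] := pselect (forall j, `|x ord0 j - y ord0 j| < r).
  have y0 (i : 'I_N) : (i < m)%N -> 0 <= y ord0 i.
    by move=> im; have := yx i; have := xr i im; rewrite ltr_norml; lra.
  have /andP[k0 _] := okernel_le_gaussN t0 x0 y0.
  rewrite big1 ?mulr1; first by rewrite mulrC ler_wpM2l// fc.
  move=> j _; rewrite /phi indicE mem_set//= in_itv/=.
  by have := yx j; rewrite ltr_norml; lra.
have [y0|ny0] := pselect (forall i : 'I_N, (i < m)%N -> 0 <= y ord0 i); last first.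
  have [j nj] : exists j, ~ `|x ord0 j - y ord0 j| < r by exact/existsNP.
  rewrite (bigD1 j)//= {1}/phi indicE memNset ?mul0r ?mulr0 ?fO ?mulr0//=.
  by rewrite in_itv/= => /andP[b1 b2]; apply: nj; rewrite ltr_norml; lra.
have /andP[k0 _] := okernel_le_gaussN t0 x0 y0.
have [j nj] : exists j, ~ `|x ord0 j - y ord0 j| < r by exact/existsNP.
rewrite (bigD1 j)//= {1}/phi indicE memNset ?mul0r ?mulr0.
  by rewrite mulr_ge0//; case/andP: (f0M y).
by rewrite /= in_itv/= => /andP[b1 b2]; apply: nj; rewrite ltr_norml; lra.
Qed.

Lemma heat_antisym_sign t x : 0 < t ->
  heat t (antisym_ext m (cst 1)) x =
  \prod_(j < N) (if (j < m)%N then gauss_sg t (x ord0 j) else 1).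
Proof.
move=> t0; rewrite /heat.
pose F (j : 'I_N) b := gauss t (x ord0 j - b) * (if (j < m)%N then Num.sg b else 1).
have iF j : leb.-integrable setT (EFin \o F j).
  rewrite (_ : F j = (fun b => gauss t (x ord0 j - b) * (if (j < m)%N then Num.sg b else 1)))//.
  case: (j < m)%N; first exact: integrable_gauss_sg.
  by under eq_fun do rewrite mulr1; exact: integrable_gauss.
have [h1 h2] := integrable_integral_prod_rV iF.
rewrite (_ : \int[lebesgue_rV N]_y _ = \int[lebesgue_rV N]_y \prod_(j < N) F j (y ord0 j)).
  rewrite h2; apply: eq_bigr => j _; rewrite /F; case: (j < m)%N => //.
  by under eq_Rintegral do rewrite mulr1; exact: integral_gauss.
apply: eq_Rintegral => y _; rewrite heat_kernelE// /F big_split/=; congr (_ * _).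
by rewrite /antisym_ext mulr1 big_mkcond.
Qed.

End mass_rV.

(** * Comparison on the sector *)

Section uniform.
Context {R : realType} {N : nat}.
Implicit Types (x y : 'rV[R]_N) (f : 'rV[R]_N -> R) (u : R -> 'rV[R]_N -> R).

Lemma uniform_cvgP (X : choiceType) T (F : set_system T) (FF : Filter F) (K : set X)
    (u : T -> X -> R) (f : X -> R) :
  {uniform K, u @ F --> f} <->
  forall e, 0 < e -> \forall t \near F, forall x : X, K x -> `|f x - u t x| < e.
Proof.
split=> [uf e e0|h].
  apply: (uf [set h | forall x : X, K x -> `|f x - h x| < e]).
  apply/uniform_nbhs; exists [set p : R * R | `|p.1 - p.2| < e]; split=> //.
  by rewrite -entourage_ballE; exists e.
move=> P /uniform_nbhs[E []]; rewrite -entourage_ballE => -[e /= e0 eE] EP.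
rewrite nbhs_filterE /=; apply: filterS (h e e0) => t ht; apply: EP => x Kx.
by apply: eE; exact: ht.
Qed.

Definition ucont f := forall e, 0 < e -> exists2 d, 0 < d &
  forall x y, (forall j, `|x ord0 j - y ord0 j| < d) -> `|f x - f y| < e.

Lemma unif_continuous_ucont f : unif_continuous f <-> ucont f.
Proof.
split=> [/unif_continuousP h e e0|h].
  have [d d0 hd] := h e e0; exists d => // x y xy.
  apply: (hd (x, y)); split => // i j; rewrite (ord1 i); exact: xy.
apply/unif_continuousP => e e0; have [d d0 hd] := h e e0; exists d => //.
by move=> [x y] /= [_ xy]; apply: hd => j; exact: xy.
Qed.

Lemma nbhs_rV x (P : set 'rV[R]_N) : nbhs x P <->
  exists2 d, 0 < d & forall y, (forall j, `|x ord0 j - y ord0 j| < d) -> P y.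
Proof.
rewrite -nbhs_ballE; split=> -[d /= d0 h]; exists d => //= y.
  by move=> xy; apply: h; split=> // i j; rewrite (ord1 i); exact: xy.
by move=> [_ xy]; apply: h => j; exact: xy.
Qed.

Lemma norm_le_enorm x : `|x| <= enorm x.
Proof.
rewrite -[leLHS]ger0_norm// -sqrtr_sqr ler_wsqrtr//.
exact: norm_sqr_le_sqnorm.
Qed.

Lemma ucont_C0 f : C0_fun f -> ucont f.
Proof.
move=> [cf f0] e e0; have e20 : 0 < e / 2 by rewrite divr_gt0.
have e30 : 0 < e / 3 by rewrite divr_gt0.
have [r fr] := f0 _ e30.
have cK := @compact_rV_ball R N (`|r| + 1).
have /compact_near_coveringP := cK.
move=> /(_ _ (0 : R)^'+ (fun d x => forall y, (forall j, `|x ord0 j - y ord0 j| < d) -> `|f x - f y| < e)).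
case=> [x Kx|d0 /= d00 hd0].
  have /cvgrPdist_lt/(_ _ e20)/nbhs_rV[d d0 hd] := cf x.
  have d20 : 0 < d / 2 by rewrite divr_gt0.
  exists ([set y : 'rV[R]_N | forall j, `|x ord0 j - y ord0 j| < d / 2], [set s : R | s < d / 2]).
    split; first by apply/nbhs_rV; exists (d / 2).
    by rewrite /=; apply: nbhs_right_lt.
  move=> [z s] /= [xz sd] y zy.
  have h1 : `|f x - f z| < e / 2 by apply: hd => j; apply: lt_trans (xz j) _; lra.
  have h2 : `|f x - f y| < e / 2.
    apply: hd => j; rewrite (_ : x ord0 j - y ord0 j = (x ord0 j - z ord0 j) + (z ord0 j - y ord0 j)); last by ring.
    by apply: le_lt_trans (ler_normD _ _) _; have := xz j; have := zy j; lra.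
  rewrite (_ : f z - f y = (f x - f y) - (f x - f z)); last by ring.
  by apply: le_lt_trans (ler_normB _ _) _; lra.
pose d := Num.min 1 (d0 / 2).
have d1 : d <= 1 by rewrite ge_min lexx.
have dd0 : d <= d0 / 2 by rewrite ge_min lexx orbT.
have dp : 0 < d by rewrite lt_min ltr01 divr_gt0.
exists d => // x y xy.
have [xr|xr] := leP `|x| (`|r| + 1).
  by apply: (hd0 d) => //=; rewrite sub0r normrN gtr0_norm//; lra.
have far z : `|r| <= `|z| -> `|f z| <= e / 3.
  by move=> rz; apply: fr; apply: le_trans (ler_norm r) (le_trans rz (norm_le_enorm z)).
have h1 : `|f x| <= e / 3 by apply: far; lra.
have h2 : `|f y| <= e / 3.
  apply: far; have := ler_normD (x - y) y; rewrite subrK => h.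
  have : `|x - y| <= 1.
    by apply/norm_rV_le => // j; rewrite !mxE; apply: ltW; apply: lt_le_trans (xy j) d1.
  lra.
by apply: le_lt_trans (ler_normB _ _) _; lra.
Qed.

Lemma C0_bounded f : C0_fun f -> exists M, forall x, `|f x| <= M.
Proof.
move=> [cf f0]; have [r fr] := f0 1 ltr01.
have [|M [_ HM]] := @compact_bounded _ _ (f @` [set x : 'rV[R]_N | `|x| <= `|r|]).
  apply: continuous_compact; last exact: compact_rV_ball.
  exact: continuous_subspaceT.
exists (Num.max 1 (`|M| + 1)) => x; rewrite le_max.
have [xr|xr] := leP `|x| `|r|.
  apply/orP; right; apply: (HM (`|M| + 1)); last by exists x.
  by apply: le_lt_trans (ler_norm M) _; rewrite ltrDl.
apply/orP; left; apply: fr.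
by apply: le_trans (ler_norm r) (le_trans (ltW xr) (norm_le_enorm x)).
Qed.

Lemma bounded_on_segment u a b :
  (forall t, a <= t <= b -> exists M, forall x, `|u t x| <= M) ->
  (forall t, a <= t <= b -> \forall s \near t, forall x, `|u t x - u s x| < 1) ->
  exists M, forall t x, a <= t <= b -> `|u t x| <= M.
Proof.
move=> bu cu.
have /compact_near_coveringP := @segment_compact R a b.
move=> /(_ _ (+oo : set_system R) (fun M t => forall x, `|u t x| <= M)).
case=> [t tab|M [_ HM]].
  rewrite /= in_itv/= in tab; have [M HM] := bu t tab.
  exists ([set s : R | forall x, `|u t x - u s x| < 1], [set M' : R | M + 1 < M']).
    by split; [exact: cu|rewrite /=; exact: nbhs_pinfty_gt (num_real _)].
  move=> [s M'] /= [us MM'] x; have := us x; have := HM x.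
  have := ler_normB (u t x) (u t x - u s x); rewrite opprB addrCA subrr addr0.
  lra.
exists (M + 1) => t x tab; apply: (HM (M + 1)); first by rewrite ltrDl.
by rewrite /= in_itv.
Qed.

End uniform.

Section absorption.
Context {R : realType}.
Implicit Types (a b alpha : R).

(** The only property of the nonlinearity used in comparisons: where u1 >= u2, the absorption pushes
    u1 - u2 down. *)
Lemma absorption_mono alpha a b : 0 < alpha -> b <= a ->
  `|b| `^ alpha * b <= `|a| `^ alpha * a.
Proof.
move=> al0 ba; have [b0|b0] := leP 0 b.
  have a0 : 0 <= a by exact: le_trans ba.
  rewrite !ger0_norm//; apply: ler_pM => //; first exact: powR_ge0.
  by apply: ge0_ler_powR => //; [exact: ltW|rewrite nnegrE..].
have [a0|a0] := leP 0 a.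
  apply: (@le_trans _ _ 0); first by rewrite mulr_ge0_le0 ?powR_ge0// ltW.
  by rewrite mulr_ge0// powR_ge0.
rewrite -lerN2 -!mulrN !ltr0_norm//; apply: ler_pM => //.
- exact: powR_ge0.
- by rewrite oppr_ge0 ltW.
- by apply: ge0_ler_powR => //; [exact: ltW|rewrite nnegrE oppr_ge0 ltW..|rewrite lerN2].
- by rewrite lerN2.
Qed.

End absorption.

Section comparison.
Context {R : realType} {N : nat}.
Variables (m : nat) (alpha : R).
Hypothesis alpha0 : 0 < alpha.
Implicit Types (x y : 'rV[R]_N) (u : R -> 'rV[R]_N -> R) (t tau : R).

(** What the comparison arguments require of v and w alike, without any initial value. It is
    preserved by negation, time shift and dilation, and for m = 0 by mirror reflection. For m = 0
    the antisymmetry clause is void and the sector is R^N. *)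
Definition regular_solution u :=
  [/\ forall t x, 0 < t -> parab u t x (- absorption alpha (u t) x) /\
        {for (t, x), continuous (fun p : R * 'rV[R]_N => u p.1 p.2)},
      forall t, 0 < t -> (exists M, forall x, `|u t x| <= M) /\ ucont (u t),
      forall t e, 0 < t -> 0 < e ->
        \forall s \near t, forall x, `|u t x - u s x| < e &
      forall t, 0 < t -> antisymmetric_fun m (u t)].

Definition sector : set 'rV[R]_N := [set x | forall i : 'I_N, (i < m)%N -> 0 <= x ord0 i].

Lemma closed_sector : closed sector.
Proof.
rewrite (_ : sector = \bigcap_(i in [set i : 'I_N | (i < m)%N])
    ((fun x : 'rV[R]_N => x ord0 i) @^-1` [set r | 0 <= r])); last first.
  by apply/seteqP; split => x h i im; exact: h.
apply: closed_bigI => i _; apply: closed_comp; last exact: closed_ge.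
by move=> x _; exact: coord_continuous.
Qed.

Lemma antisym_face f x (i : 'I_N) : antisymmetric_fun m f -> (i < m)%N ->
  x ord0 i = 0 -> f x = 0.
Proof.
move=> af im xi; have := af i x im.
rewrite (_ : reflection i x = x); first lra.
by apply/rowP => j; rewrite mxE; case: eqP => // ->; rewrite xi oppr0.
Qed.

(** This is how the boundary condition enters [parabolic_max_principle]: an antisymmetric function
    vanishes on the faces, so a point of the sector where it is positive is interior. *)
Lemma sector_interior f x : antisymmetric_fun m f -> sector x -> f x != 0 ->
  nbhs x sector.
Proof.
move=> af sx fx.
have xp (i : 'I_N) : (i < m)%N -> 0 < x ord0 i.
  move=> im; rewrite lt_neqAle sx// andbT eq_sym.
  by apply: contraNneq fx => xi; rewrite (antisym_face af im xi).
pose r := \big[Num.min/1]_(i < N | (i < m)%N) x ord0 i.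
have r0 : 0 < r by exact: lt_bigmin.
have ri (i : 'I_N) : (i < m)%N -> r <= x ord0 i.
  by move=> im; rewrite /r; exact: bigmin_le_cond.
apply/nbhs_rV; exists r => // y xy i im.
by have := xy i; have := ri i im; rewrite ltr_norml; lra.
Qed.

Lemma antisymB f g : antisymmetric_fun m f -> antisymmetric_fun m g ->
  antisymmetric_fun m (fun x => f x - g x).
Proof. by move=> af ag i x im; rewrite af// ag//; lra. Qed.

Lemma regular_bounded u t0 T : regular_solution u -> 0 < t0 ->
  exists M, forall t x, t0 <= t <= T -> `|u t x| <= M.
Proof.
move=> [_ u2 u3 _] t00; apply: bounded_on_segment => t /andP[tt _].
  by have [] := u2 t (lt_le_trans t00 tt).
exact: u3 (lt_le_trans t00 tt) ltr01.
Qed.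

(** The ordering at t0 will be known only up to an error e; since e >= 0, u1 > u2 + e still puts the
    absorption terms in the right order. *)
Lemma comparison u1 u2 t0 e : regular_solution u1 -> regular_solution u2 ->
  0 < t0 -> 0 <= e -> (forall x, sector x -> u1 t0 x <= u2 t0 x + e) ->
  forall t x, t0 <= t -> sector x -> u1 t x <= u2 t x + e.
Proof.
move=> r1 r2 t00 e0 h0 T x t0T sx.
have [M1 HM1] := regular_bounded T r1 t00; have [M2 HM2] := regular_bounded T r2 t00.
have [r11 _ _ r14] := r1; have [r21 _ _ r24] := r2.
rewrite -subr_le0 opprD addrA.
have key := @parabolic_max_principle R N sector (fun t x => u1 t x - u2 t x - e) t0 T
  (M1 + M2) closed_sector.
apply: key => //; last by rewrite t0T lexx.
- move=> t y /andP[tt _]; have tp : 0 < t by exact: lt_le_trans tt.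
  apply: (@cvgB _ _ _ (nbhs (t, y))); last exact: cvg_cst.
  by apply: cvgB; [exact: (r11 t y tp).2|exact: (r21 t y tp).2].
- move=> t y tT _; have := HM1 t y tT; have := HM2 t y tT.
  by rewrite !ler_norml; lra.
- by move=> y sy; have := h0 y sy; lra.
- move=> t y /andP[tt _] sy D0; have tp : 0 < t by exact: lt_trans tt.
  split.
    apply: (sector_interior (antisymB (r14 t tp) (r24 t tp)) sy).
    by rewrite gt_eqF//; lra.
  exists (- absorption alpha (u1 t) y - - absorption alpha (u2 t) y - 0).
    rewrite subr0 opprK addrC subr_le0; apply: absorption_mono => //; lra.
  apply: parabB; last exact: parab_cst.
  by apply: parabB; [exact: (r11 t y tp).1|exact: (r21 t y tp).1].
Qed.

Lemma tail_small (r e : R) : 0 < r -> 0 < e -> exists2 s0, 0 < s0 &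
  forall s, 0 < s <= s0 -> tail s r <= e.
Proof.
(* From sqrt 2 <= 2 and exp(-z) <= 1/z with z = r^2/(8s), tail s r <= 16 s / r^2. *)
move=> r0 e0; exists (e * r ^+ 2 / 16); first by rewrite divr_gt0// mulr_gt0// exprn_gt0.
move=> s /andP[sp ss]; rewrite /tail.
have r20 : 0 < r ^+ 2 by rewrite exprn_gt0.
pose z := r ^+ 2 / (8 * s).
have z0 : 0 < z by rewrite divr_gt0// mulr_gt0.
have h1 : expR (- z) <= z^-1.
  rewrite expRN lef_pV2 ?posrE ?expR_gt0//.
  by apply: le_trans (expR_ge1Dx z); rewrite lerDr.
have h2 : Num.sqrt 2 <= 2 :> R.
  rewrite -[leRHS]ger0_norm// -sqrtr_sqr ler_wsqrtr//.
  by rewrite expr2; lra.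
apply: (@le_trans _ _ (2 * z^-1)); first by rewrite ler_pM ?sqrtr_ge0 ?expR_ge0.
rewrite /z invf_div mulrA ler_pdivrMr//; lra.
Qed.

Lemma pow_ge1B (N' : nat) (a : R) : 0 <= a <= 1 -> 1 - N'%:R * a <= (1 - a) ^+ N'.
Proof.
move=> /andP[a0 a1]; elim: N' => [|k IH]; first by rewrite mul0r subr0 expr0.
rewrite exprS; apply: (@le_trans _ _ ((1 - a) * (1 - k%:R * a))).
  have : 0 <= k%:R * a * a by rewrite !mulr_ge0.
  rewrite -natr1; set K := k%:R; lra.
by rewrite ler_wpM2l// subr_ge0.
Qed.

Definition pos_diff u1 u2 tau : 'rV[R]_N -> R :=
  (fun x => Num.max 0 (u1 tau x - u2 tau x)) \_ sector.

Lemma ucont_continuous (f : 'rV[R]_N -> R) : ucont f -> continuous f.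
Proof.
move=> uf x; apply/(@cvgrPdist_lt _ _ _ (nbhs (x : 'rV[R]_N)) _ f (f x)) => e e0; have [d d0 hd] := uf e e0.
by apply/nbhs_rV; exists d => // y xy; exact: hd.
Qed.

Lemma measurable_sector : measurable sector.
Proof.
rewrite -[sector]setCK; apply: measurableC; apply: measurable_open_rV.
by rewrite openC; exact: closed_sector.
Qed.

Lemma measurable_pos_diff u1 u2 tau : ucont (u1 tau) -> ucont (u2 tau) ->
  measurable_fun setT (pos_diff u1 u2 tau).
Proof.
move=> c1 c2; apply: (proj1 (measurable_restrictT _ measurable_sector)).
apply: measurable_funS measurableT _ _ => //.
apply: measurable_maxr; first exact: measurable_cst.
apply: measurable_funB; apply: measurable_continuous_rV; exact: ucont_continuous.
Qed.

Lemma continuous_affine (F : R * 'rV[R]_N -> R) k d (phi : 'rV[R]_N -> 'rV[R]_N) t x :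
  {for x, continuous phi} -> {for (k * t + d, phi x), continuous F} ->
  {for (t, x), continuous (fun p : R * 'rV[R]_N => F (k * p.1 + d, phi p.2))}.
Proof.
move=> cphi cF.
apply: (@continuous_comp _ _ _ (fun p : R * 'rV[R]_N => (k * p.1 + d, phi p.2)) F) => //.
have h1 : (fun p : R * 'rV[R]_N => k * p.1 + d) @ nbhs (t, x) --> k * t + d.
  apply: cvgD; last exact: cvg_cst.
  by apply: cvgMr; exact: cvg_fst.
have h2 : (fun p : R * 'rV[R]_N => phi p.2) @ nbhs (t, x) --> phi x.
  apply: (@cvg_comp _ _ _ (fun p : R * 'rV[R]_N => p.2) phi (nbhs (t, x)) (nbhs x)) => //.
  exact: cvg_snd.
exact: (cvg_pair h1 h2).
Qed.

(* The heat potential of the positive part dominates the difference at times close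
   to tau: in the interior by concentration of the kernel, and near the faces
   because the difference is small there. *)
Lemma comparison_heat_pot u1 u2 tau T x : regular_solution u1 -> regular_solution u2 ->
  0 < tau -> tau < T -> sector x ->
  u1 T x - u2 T x <= heat_pot m (pos_diff u1 u2 tau) (T - tau) x.
Proof.
move=> r1 r2 tau0 tauT sx.
have [r11 r12 r13 r14] := r1; have [r21 r22 r23 r24] := r2.
have [[M1 HM1] c1] := r12 tau tau0; have [[M2 HM2] c2] := r22 tau tau0.
pose D t y := u1 t y - u2 t y.
pose f := pos_diff u1 u2 tau.
pose B := M1 + M2.
have DB y : `|D tau y| <= B by apply: le_trans (ler_normB _ _) _; exact: lerD.
have B0 : 0 <= B by exact: le_trans (normr_ge0 _) (DB 0).
have fE y : sector y -> f y = Num.max 0 (D tau y) by move=> sy; rewrite /f /pos_diff patchE mem_set.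
have fN y : ~ sector y -> f y = 0 by move=> sy; rewrite /f /pos_diff patchE memNset.
have f0B y : 0 <= f y <= B.
  have [sy|sy] := pselect (sector y); last by rewrite fN// lexx.
  rewrite fE// le_max lexx/= ge_max B0/=.
  by apply: le_trans (DB y); exact: ler_norm.
have fB y : `|f y| <= B by case/andP: (f0B y) => ? ?; rewrite ger0_norm.
have mf := measurable_pos_diff c1 c2 : measurable_fun setT f.
apply/ler_addgt0Pr => e e0.
have e80 : 0 < e / 8 by rewrite divr_gt0.
have [d1 d10 hd1] := c1 _ e80; have [d2 d20 hd2] := c2 _ e80.
pose d := Num.min d1 d2.
have d0 : 0 < d by rewrite lt_min d10.
have hd (y z : 'rV[R]_N) : (forall j, `|y ord0 j - z ord0 j| < d) -> `|D tau y - D tau z| < e / 4.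
  move=> yz.
  have k1 : `|u1 tau y - u1 tau z| < e / 8.
    by apply: hd1 => j; apply: lt_le_trans (yz j) _; rewrite ge_min lexx.
  have k2 : `|u2 tau y - u2 tau z| < e / 8.
    by apply: hd2 => j; apply: lt_le_trans (yz j) _; rewrite ge_min lexx orbT.
  rewrite /D (_ : _ - _ = (u1 tau y - u1 tau z) - (u2 tau y - u2 tau z)); last by ring.
  by apply: le_lt_trans (ler_normB _ _) _; lra.
(* The entry 1/2 gives 2 tail <= 1, as [heat_pot_ge] requires; the other makes the lost mass N (2
   tail), multiplied by the bound B + 1, at most e/4. *)
pose eta := Num.min (1 / 2) (e / (8 * (B + 1) * (N%:R + 1))).
have NB0 : 0 < 8 * (B + 1) * (N%:R + 1) by rewrite !mulr_gt0// ltr_wpDl.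
have eta0 : 0 < eta by rewrite lt_min !divr_gt0.
have [s1 s10 hs1] := tail_small d0 eta0.
have near0 : \forall s \near (0 : R)^'+,
    [/\ 0 < s, s <= s1, tau + s < T, (forall y, `|u1 tau y - u1 (tau + s) y| < e / 8) &
       forall y, `|u2 tau y - u2 (tau + s) y| < e / 8].
  have shift (P : set R) : nbhs tau P -> \forall s \near (0 : R)^'+, P (tau + s).
    move=> nP; have : tau + s @[s --> (0 : R)^'+] --> tau.
      rewrite -[X in _ --> X]addr0; apply: cvgD; first exact: cvg_cst.
      exact: cvg_at_right_filter.
    by apply.
  near=> s; split.
  - by near: s; exact: nbhs_right_gt.
  - by near: s; exact: nbhs_right_le.
  - by rewrite addrC -ltrBrDr; near: s; apply: nbhs_right_lt; rewrite subr_gt0.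
  - by near: s; apply: (shift [set t | forall y, `|u1 tau y - u1 t y| < e / 8]); exact: r13.
  - by near: s; apply: (shift [set t | forall y, `|u2 tau y - u2 t y| < e / 8]); exact: r23.
have [s [sp ss1 sT hu1 hu2]] := filter_ex near0.
have t0p : 0 < tau + s by rewrite addr_gt0.
have Ds y : D (tau + s) y <= D tau y + e / 4.
  by have := hu1 y; have := hu2 y; rewrite !ltr_norml /D; lra.
have tl : tail s d <= eta by apply: hs1; rewrite sp ss1.
have H0 t y : 0 < t -> sector y -> 0 <= heat_pot m f t y.
  move=> tp sy; apply: Rintegral_ge0 => z _.
  have [sz|sz] := pselect (sector z); last by rewrite fN// mulr0.
  rewrite mulr_ge0//; first by have /andP[] := okernel_le_gaussN tp sy sz.
  by case/andP: (f0B z).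
(* The maximum principle starts at tau + s rather than tau, since the potential is controlled only
   at positive times. At a point within d of a face the difference is compared with 0, its value at
   the projection y' on that face. *)
have init y : sector y -> D (tau + s) y - heat_pot m f s y - e <= 0.
  move=> sy; have Hy := H0 s y sp sy; have Dy := Ds y.
  have [yd|] := pselect (forall i : 'I_N, (i < m)%N -> d <= y ord0 i); last first.
    move=> /existsNP[i /not_implyP[im /negP]]; rewrite -ltNge => yi.
    pose y' := \row_j (if j == i then 0 else y ord0 j).
    have Dy' : D tau y' = 0.
      apply: (antisym_face (antisymB (r14 _ tau0) (r24 _ tau0)) im).
      by rewrite mxE eqxx.
    have : `|D tau y - D tau y'| < e / 4.
      apply: hd => j; rewrite mxE; case: eqP => [->|_]; last by rewrite subrr normr0.
      by rewrite subr0 ger0_norm// sy.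
    by rewrite Dy' subr0 ltr_norml; lra.
  pose c := Num.max 0 (D tau y - e / 4).
  have c0 : 0 <= c by rewrite le_max lexx.
  have cD : D tau y - e / 4 <= c by rewrite le_max lexx orbT.
  have cB : c <= B.
    rewrite ge_max B0/=; have := DB y; rewrite ler_norml; lra.
  have tl2 : 2 * tail s d <= 1.
    have : eta <= 1 / 2 by rewrite ge_min lexx.
    lra.
  have := @heat_pot_ge R N m f B c s y d sp (ltW d0) c0 tl2 yd mf f0B.
  move=> /(_ fN) hh.
  have hc (z : 'rV[R]_N) : (forall j, `|y ord0 j - z ord0 j| < d) -> c <= f z.
    move=> yz; have sz : sector z.
      by move=> i im; have := yd i im; have := yz i; rewrite ltr_norml; lra.
    rewrite fE// ge_max le_max lexx/=; rewrite le_max; apply/orP; right.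
    by have := hd _ _ yz; rewrite ltr_norml; lra.
  have {hh} := hh hc.
  have t01 : 0 <= 2 * tail s d <= 1 by rewrite tl2 andbT mulr_ge0// tail_ge0.
  have := pow_ge1B N t01.
  set p := (1 - _) ^+ N => hp hH.
  have hq : N%:R * (2 * tail s d) * (B + 1) <= e / 4.
    have h : tail s d <= e / (8 * (B + 1) * (N%:R + 1)).
      by apply: le_trans tl _; rewrite ge_min lexx orbT.
    rewrite ler_pdivlMr// in h.
    have : 0 <= tail s d * (B + 1) by rewrite mulr_ge0 ?tail_ge0// addr_ge0.
    lra.
  have h1 : c * (1 - N%:R * (2 * tail s d)) <= c * p by rewrite ler_wpM2l.
  have h2 : c * (N%:R * (2 * tail s d)) <= (B + 1) * (N%:R * (2 * tail s d)).
    apply: ler_wpM2r; first by rewrite !mulr_ge0// tail_ge0.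
    lra.
  lra.
have [M1' HM1'] := regular_bounded T r1 t0p; have [M2' HM2'] := regular_bounded T r2 t0p.
suff : D T x - heat_pot m f (T - tau) x - e <= 0 by rewrite /D; lra.
have key := @parabolic_max_principle R N sector
  (fun t y => D t y - heat_pot m f (1 * t + - tau) y - e) (tau + s) T
  (M1' + M2') closed_sector.
rewrite (_ : T - tau = 1 * T + - tau); last by rewrite mul1r.
apply: key.
- move=> t y /andP[tt _]; have tp : 0 < t by exact: lt_le_trans tt.
  have tt' : 0 < 1 * t - tau by lra.
  apply: (@cvgB _ _ _ (nbhs (t, y))); last exact: cvg_cst.
  apply: cvgB; first by apply: cvgB; [exact: (r11 t y tp).2|exact: (r21 t y tp).2].
  apply: (@continuous_affine (fun p => heat_pot m f p.1 p.2) 1 (- tau) id); first exact: cvg_id.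
  exact: (@continuous_heat_pot _ _ m f _ mf fB _ y tt').
- move=> t y tT sy; have := HM1' t y tT; have := HM2' t y tT.
  have : 0 <= heat_pot m f (1 * t + - tau) y by apply: H0 => //; case/andP: tT => *; lra.
  by rewrite !ler_norml /D; lra.
- by move=> y sy; rewrite (_ : 1 * (tau + s) + - tau = s); [exact: init|ring].
- move=> t y /andP[tt _] sy E0; have tp : 0 < t by exact: lt_trans tt.
  have tt' : 0 < 1 * t - tau by lra.
  have := H0 _ y tt' sy => Hy.
  have D0 : 0 < D t y by lra.
  split.
    apply: (sector_interior (antisymB (r14 t tp) (r24 t tp)) sy).
    by rewrite gt_eqF.
  exists (- absorption alpha (u1 t) y - - absorption alpha (u2 t) y - 1 * 0 - 0).
    rewrite mulr0 !subr0 opprK addrC subr_le0; apply: absorption_mono => //.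
    by move: D0; rewrite /D; lra.
  apply: parabB; last exact: parab_cst.
  apply: parabB; first by apply: parabB; [exact: (r11 t y tp).1|exact: (r21 t y tp).1].
  apply: (@parab_affine R N 1 (- tau) (fun=> 1) id (heat_pot m f)) => //.
  - by move=> i; rewrite expr1n.
  - by move=> i z r; rewrite mul1r.
  - exact: (parab_heat_pot m mf fB).
- by rewrite (ltW sT) lexx.
- exact: sx.
Unshelve. all: by end_near. Qed.

End comparison.

(** * Bounded solutions *)

Section solutions.
Context {R : realType} {N : nat}.
Variable alpha : R.
Hypothesis alpha0 : 0 < alpha.
Implicit Types (x y : 'rV[R]_N) (u w : R -> 'rV[R]_N -> R) (t tau : R) (m : nat).
Local Notation "''e_' i" := (delta_mx (ord0 : 'I_1) (i : 'I_N) : 'rV[R]_N)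
  (at level 8, i at level 2, format "''e_' i").

Lemma uniform_cvgTP T (F : set_system T) (FF : Filter F)
    (u : T -> 'rV[R]_N -> R) (f : 'rV[R]_N -> R) :
  {uniform, u @ F --> f} ->
  forall e, 0 < e -> \forall t \near F, forall x, `|f x - u t x| < e.
Proof.
move=> /(uniform_cvgP FF setT) uf e e0.
by apply: filterS (uf e e0) => t h x; exact: h.
Qed.

Lemma regular_of_classical m u : classical_solution alpha u ->
  (forall t, 0 < t -> (exists M, forall x, `|u t x| <= M) /\ ucont (u t)) ->
  (forall t, 0 < t -> {uniform, u @ t --> u t}) ->
  (forall t, 0 < t -> antisymmetric_fun m (u t)) ->
  regular_solution m alpha u.
Proof.
move=> cu bu uu au; split => //.
  move=> t x t0; split; first exact: parab_classical.
  by have [[_ [+ _ _ _]] _] := (cu.1 t x t0, I).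
by move=> t e t0 e0; exact: uniform_cvgTP (uu t t0) e e0.
Qed.

Lemma regular_flow m gamma C (v0 : 'rV[R]_N -> R) v : is_flow m gamma alpha C v0 v ->
  regular_solution m alpha v.
Proof.
move=> [vt cv _ _]; apply: regular_of_classical => // t t0; have [c0 av uv] := vt t t0 => //.
by split; [exact: C0_bounded|exact: ucont_C0].
Qed.

(** Antisymmetry of w is not part of its definition, hence m = 0 here; it is recovered in
    [regular_sign_solution]. *)
Lemma regular_bounded_solution (w0 : 'rV[R]_N -> R) w : is_bounded_solution alpha w0 w ->
  regular_solution 0 alpha w.
Proof.
move=> [wt _ cw _]; apply: regular_of_classical => // t t0; have [[wb wu] uw] := wt t t0 => //.
by split=> //; apply/unif_continuous_ucont.
Qed.

Lemma regularN m u : regular_solution m alpha u ->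
  regular_solution m alpha (fun t x => - u t x).
Proof.
move=> [u1 u2 u3 u4]; split.
- move=> t x t0; split; last by apply: cvgN; exact: (u1 t x t0).2.
  have := parabZ (-1) (u1 t x t0).1.
  rewrite (_ : -1 * - absorption alpha (u t) x = - absorption alpha (fun x => - u t x) x).
    by under eq_fun do under eq_fun do rewrite mulN1r.
  by rewrite /absorption normrN mulN1r mulrN.
- move=> t t0; have [[M HM] c] := u2 t t0; split.
    by exists M => x; rewrite normrN.
  move=> e e0; have [d d0 hd] := c e e0; exists d => // x y xy.
  by rewrite -opprD normrN; exact: hd.
- move=> t e t0 e0; apply: filterS (u3 t e t0 e0) => s h x.
  by rewrite -opprD normrN; exact: h.
- by move=> t t0 i x im; rewrite (u4 t t0 i x im).
Qed.

Lemma regular_shift m u tau : 0 <= tau -> regular_solution m alpha u ->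
  regular_solution m alpha (fun t => u (tau + t)).
Proof.
move=> tau0 [u1 u2 u3 u4].
have E : (fun t => u (tau + t)) = (fun t => u (1 * t + tau)).
  by apply/funext => t; rewrite mul1r addrC.
rewrite E; split.
- move=> t x t0; have tt : 0 < 1 * t + tau by rewrite mul1r ltr_wpDr.
  split.
    rewrite -[X in parab _ _ _ X]mul1r.
    apply: (@parab_affine R N 1 tau (fun=> 1) id u) => //.
    - by move=> i; rewrite expr1n.
    - by move=> i z r; rewrite mul1r.
    - exact: (u1 _ x tt).1.
  apply: (@continuous_affine _ _ (fun p => u p.1 p.2) 1 tau id); first exact: cvg_id.
  exact: (u1 _ x tt).2.
- by move=> t t0; apply: u2; rewrite mul1r ltr_wpDr.
- move=> t e t0 e0; have tt : 0 < 1 * t + tau by rewrite mul1r ltr_wpDr.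
  have c : (fun s : R => 1 * s + tau) @ t --> 1 * t + tau.
    by apply: cvgD; [apply: cvgMr; exact: cvg_id|exact: cvg_cst].
  exact: (c _ (u3 _ e tt e0)).
- by move=> t t0; apply: u4; rewrite mul1r ltr_wpDr.
Qed.

(** The reason for the exponent 2/alpha: absorption then scales by the same l^2 as the heat
    operator. *)
Lemma powR_inv_cancel (l : R) : 0 < l -> (l `^ (2 / alpha)) `^ alpha = l ^+ 2.
Proof.
by move=> l0; rewrite -powRrM divfK ?gt_eqF// powR_mulrn// ltW.
Qed.

Lemma regular_dilation m l u : 0 < l -> regular_solution m alpha u ->
  regular_solution m alpha (dilation alpha l u).
Proof.
move=> l0 [u1 u2 u3 u4]; have l20 : 0 < l ^+ 2 by rewrite exprn_gt0.
have L0 : 0 < l `^ (2 / alpha) by exact: powR_gt0.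
have E : dilation alpha l u = (fun t x => l `^ (2 / alpha) * u (l ^+ 2 * t + 0) (l *: x)).
  by apply/funext => t; apply/funext => x; rewrite addr0.
have lt t : 0 < t -> 0 < l ^+ 2 * t + 0 by move=> t0; rewrite addr0 mulr_gt0.
rewrite E; split.
- move=> t x t0; split.
    rewrite (_ : - absorption _ _ _ =
        l `^ (2 / alpha) * (l ^+ 2 * - absorption alpha (u (l ^+ 2 * t + 0)) (l *: x))).
      apply: parabZ.
      apply: (@parab_affine R N (l ^+ 2) 0 (fun=> l) (fun x => l *: x) u) => //.
      - by move=> i z r; rewrite scalerDr scalerA.
      - exact: (u1 _ (l *: x) (lt t t0)).1.
    rewrite /absorption normrM (gtr0_norm L0) powRM ?(ltW L0)// powR_inv_cancel//.
    by ring.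
  apply: cvgMr.
  apply: (@continuous_affine _ _ (fun p => u p.1 p.2) (l ^+ 2) 0 (fun x => l *: x)).
    exact: scaler_continuous.
  exact: (u1 _ (l *: x) (lt t t0)).2.
- move=> t t0; have [[M HM] c] := u2 _ (lt t t0); split.
    exists (l `^ (2 / alpha) * M) => x.
    by rewrite normrM gtr0_norm// ler_pM2l.
  move=> e e0; have [d d0 hd] := c _ (divr_gt0 e0 L0).
  exists (d / l); first exact: divr_gt0.
  move=> x y xy; rewrite -mulrBr normrM gtr0_norm// mulrC -ltr_pdivlMr//.
  apply: hd => j; rewrite !mxE -mulrBr normrM gtr0_norm// mulrC -ltr_pdivlMr//.
- move=> t e t0 e0.
  have c : (fun s : R => l ^+ 2 * s + 0) @ t --> l ^+ 2 * t + 0.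
    by apply: cvgD; [apply: cvgMr; exact: cvg_id|exact: cvg_cst].
  have := c _ (u3 _ _ (lt t t0) (divr_gt0 e0 L0)).
  rewrite nbhs_filterE /=; apply: filterS => s h x.
  by rewrite -mulrBr normrM gtr0_norm// mulrC -ltr_pdivlMr//; exact: h.
- move=> t t0 i x im.
  rewrite (_ : l *: reflection i x = reflection i (l *: x)).
    by rewrite (u4 _ (lt t t0) i _ im) mulrN.
  by apply/rowP => j; rewrite !mxE; case: eqP => // _; rewrite mulrN.
Qed.

Definition reflect_at (i : 'I_N) (a : R) x : 'rV[R]_N :=
  \row_j (if j == i then 2 * a - x ord0 j else x ord0 j).

Lemma reflect_at_line i a j y s : reflect_at i a (y + s *: 'e_j) =
  reflect_at i a y + ((if j == i then -1 else 1) * s) *: 'e_j.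
Proof.
apply/rowP => k; rewrite !mxE eqxx /=.
have [->|kj] := eqVneq k j; first by rewrite /=; case: ifP => _; ring.
by rewrite /= !mulr0 !addr0.
Qed.

Lemma continuous_reflect_at i a : continuous (reflect_at i a).
Proof.
move=> x P /nbhs_rV[d d0 hd]; apply/nbhs_rV; exists d => // y xy; apply: hd => j.
rewrite !mxE; case: eqP => // _.
by rewrite opprB addrC subrKA distrC.
Qed.

Lemma regular_reflect u i a : regular_solution 0 alpha u ->
  regular_solution 0 alpha (fun t x => u t (reflect_at i a x)).
Proof.
move=> [u1 u2 u3 u4].
have E : (fun t x => u t (reflect_at i a x)) = (fun t x => u (1 * t + 0) (reflect_at i a x)).
  by apply/funext => t; rewrite mul1r addr0.
rewrite E; split=> //.
- move=> t x t0; have tt : 0 < 1 * t + 0 by rewrite mul1r addr0.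
  split.
    rewrite -[X in parab _ _ _ X]mul1r.
    apply: (@parab_affine R N 1 0 (fun j => if j == i then -1 else 1) (reflect_at i a) u).
    - by move=> j; case: ifP => _; rewrite ?sqrrN expr1n.
    - by move=> j z r; exact: reflect_at_line.
    - exact: (u1 _ _ tt).1.
  apply: (@continuous_affine _ _ (fun p => u p.1 p.2) 1 0 (reflect_at i a)).
    exact: continuous_reflect_at.
  exact: (u1 _ _ tt).2.
- move=> t t0; rewrite mul1r addr0; have [[M HM] c] := u2 t t0; split.
    by exists M => x; exact: HM.
  move=> e e0; have [d d0 hd] := c e e0; exists d => // x y xy; apply: hd => j.
  rewrite !mxE; case: eqP => // _.
  by rewrite opprB addrC subrKA distrC.
- move=> t e t0 e0; rewrite mul1r addr0; apply: filterS (u3 t e t0 e0) => s h x.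
  by rewrite mul1r addr0; exact: h.
Qed.

(* The right-hand side is the solution independent of x which blows up at t = 0. *)
Lemma regular_ode_bound u : regular_solution 0 alpha u ->
  (\forall t \near (0 : R)^'+, forall x, u t x <= 2) ->
  forall t x, 0 < t -> u t x <= (alpha * t) `^ (- alpha^-1).
Proof.
move=> ru u0 T x T0; have [u1 _ _ _] := ru.
pose Y t := (alpha * t) `^ (- alpha^-1).
have ap t : 0 < t -> 0 < alpha * t by move=> t0; rewrite mulr_gt0.
have dY t : 0 < t -> is_derive t 1 Y (- (`|Y t| `^ alpha * Y t)).
  move=> t0; have d0 : is_derive t 1 (fun s : R => alpha * s) alpha.
    by apply: is_derive_eq; rewrite /GRing.scale/=; ring.
  have := @is_derive1_comp _ (fun s => s `^ (- alpha^-1)) _ t _ _ (is_derive1_powR _ (ap t t0)) d0.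
  have YE : `|Y t| `^ alpha = (alpha * t) `^ (-1).
    by rewrite ger0_norm ?powR_ge0// /Y -powRrM mulNr mulVf ?gt_eqF.
  move=> h; apply: (is_derive_eq h); rewrite YE /Y.
  rewrite powRD; last by rewrite (gt_eqF (ap t t0)) implybT.
  by field; rewrite gt_eqF.
(* The third condition amounts to Y s >= 2, so that u lies below Y at the starting time s. *)
have near0 : \forall s \near (0 : R)^'+, [/\ 0 < s, s < T, alpha * s <= 2 `^ (- alpha) & forall x, u s x <= 2].
  near=> s; split.
  - by near: s; exact: nbhs_right_gt.
  - by near: s; exact: nbhs_right_lt.
  - rewrite mulrC -ler_pdivlMr//; near: s; apply: nbhs_right_le.
    by rewrite divr_gt0// powR_gt0.
  - by near: s.
have [s [s0 sT s2 us]] := filter_ex near0.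
have Ys : 2 <= Y s.
  rewrite /Y powRN -[leLHS]invrK lef_pV2 ?posrE ?invr_gt0 ?powR_gt0 ?ap//.
  apply: (@le_trans _ _ ((2 `^ (- alpha)) `^ alpha^-1)).
    by apply: ge0_ler_powR => //; rewrite ?nnegrE ?invr_ge0 ?powR_ge0 ?ltW// ap.
  by rewrite -powRrM mulNr divff ?gt_eqF// powR_inv1.
have [M HM] := regular_bounded T ru s0.
rewrite -subr_le0.
have key := @parabolic_max_principle R N setT (fun t x => u t x - Y t) s T M closedT.
apply: key.
- move=> t y /andP[st _]; have t0 : 0 < t by exact: lt_le_trans st.
  apply: cvgB; first exact: (u1 t y t0).2.
  apply: (@cvg_comp _ _ _ fst Y); first exact: cvg_fst.
  by apply/differentiable_continuous/derivable1_diffP; case: (dY t t0).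
- move=> t y tT _; have := HM t y tT; rewrite ler_norml => /andP[_ h].
  by apply: le_trans _ h; rewrite lerBlDr lerDl powR_ge0.
- by move=> y _; have := us y; lra.
- move=> t y /andP[st _] _ uY; have t0 : 0 < t by exact: lt_trans st.
  split; first exact: filterT.
  exists (- absorption alpha (u t) y - - (`|Y t| `^ alpha * Y t)).
    by rewrite opprK addrC subr_le0; apply: absorption_mono => //; lra.
  by apply: parabB; [exact: (u1 t y t0).1|apply: parab_time; exact: dY].
- by rewrite (ltW sT) lexx.
- by [].
Unshelve. all: by end_near. Qed.

(* Comparison of u with its mirror image in the strip of width 1 along the mirror. *)
Lemma regular_lipschitz_line u M : regular_solution 0 alpha u ->
  (forall t x, 1 / 2 <= t <= 1 -> `|u t x| <= M) ->
  forall i x s, 0 <= s <= 2 -> u 1 (x + s *: 'e_i) - u 1 x <= 2 * M * s.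
Proof.
move=> ru uM i x s /andP[s0 s2]; have [u1 _ _ _] := ru.
(* The mirror lies halfway between x and x + s e_i, which it exchanges; s <= 2 keeps x + s e_i in
   the strip F. *)
pose a := x ord0 i + s / 2.
have [ur1 _ _ _] := regular_reflect i a ru.
pose sg := reflect_at i a.
pose F : set 'rV[R]_N := [set y | 0 <= y ord0 i - a <= 1].
have M0 : 0 <= M by apply: le_trans (normr_ge0 (u 1 0)) (uM _ _ _); apply/andP; split; lra.
pose D t y := u t y - u t (sg y).
(* In terms of the distance z to the mirror this barrier is M (2z - z^2): 0 at z = 0, and M at z =
   1, where (t - 1/2) D <= M. The factor t - 1/2 removes the data at time 1/2 at the price of a term
   D <= 2M, which the Laplacian -2M of the barrier absorbs. At t = 1 and z = s/2 this reads D/2 <= M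
   (s - s^2/4). *)
pose B y := M * (1 - (y ord0 i - a - 1) ^+ 2).
pose E t y := (t - 1 / 2) * D t y - B y.
have DM t y : 1 / 2 <= t <= 1 -> `|D t y| <= 2 * M.
  move=> tt; apply: le_trans (ler_normB _ _) _.
  by have := uM t y tt; have := uM t (sg y) tt; lra.
have sgE y : y ord0 i = a -> sg y = y.
  by move=> yi; apply/rowP => j; rewrite mxE; case: eqP => // ->; rewrite yi; ring.
have B0 y : F y -> 0 <= B y.
  move=> /andP[z0 z1]; rewrite mulr_ge0//.
  by move: z0 z1; set z := y ord0 i - a => z0 z1; nra.
have ci : continuous (fun y : 'rV[R]_N => y ord0 i - a).
  move=> y; apply: (@cvgB _ _ _ (nbhs (y : 'rV[R]_N)) _ (fun y : 'rV[R]_N => y ord0 i)).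
    exact: coord_continuous.
  exact: cvg_cst.
have cF : closed F.
  rewrite (_ : F = (fun y : 'rV[R]_N => y ord0 i - a) @^-1` `[0, 1]).
    by apply: closed_comp; [move=> y _; exact: ci|exact: interval_closed].
  by apply/seteqP; split => y /=; rewrite in_itv.
have key := @parabolic_max_principle R N F E (1 / 2) 1 M cF.
have E1 : E 1 (x + s *: 'e_i) <= 0.
  apply: key.
  - move=> t y /andP[tt _]; have t0 : 0 < t by lra.
    apply: cvgB.
      apply: cvgM.
        by apply: cvgB; [exact: cvg_fst|exact: cvg_cst].
      apply: cvgB; first exact: (u1 t y t0).2.
      exact: (ur1 t y t0).2.
    apply: (@cvg_comp _ _ _ (fun p : R * 'rV[R]_N => p.2) B (nbhs (t, y)) (nbhs y)).
      exact: cvg_snd.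
    apply: cvgMr; apply: cvgB; first exact: cvg_cst.
    rewrite expr2; under eq_fun do rewrite expr2.
    by apply: cvgM; (apply: cvgB; [exact: ci|exact: cvg_cst]).
  - move=> t y tT Fy; have := DM t y tT; have := B0 y Fy; rewrite ler_norml /E => B0' /andP[_ h].
    by case/andP: tT => t1 t2; nra.
  - by move=> y Fy; rewrite /E subrr mul0r sub0r oppr_le0 B0.
  - move=> t y /andP[tt t1] Fy Ep; have t0 : 0 < t by lra.
    have tT : 1 / 2 <= t <= 1 by rewrite (ltW tt).
    have Dp : 0 < D t y.
      rewrite -(pmulr_rgt0 (x := t - 1 / 2)); last by rewrite subr_gt0.
      by have := B0 y Fy; rewrite /E in Ep; lra.
    have D2 : D t y <= 2 * M by apply: le_trans (DM t y tT); exact: ler_norm.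
    case/andP: (Fy) => z0 z1.
    have z0' : 0 < y ord0 i - a.
      rewrite lt_neqAle z0 andbT eq_sym; apply: contraTneq Dp => /eqP; rewrite subr_eq0 => /eqP yi.
      by rewrite /D sgE// subrr ltxx.
    have z1' : y ord0 i - a < 1.
      rewrite lt_neqAle z1 andbT; apply: contraTneq Ep => z1E.
      by rewrite -leNgt /E /B z1E subrr expr0n/= subr0 mulr1; nra.
    split.
      have nz : \forall z \near (y ord0 i - a), 0 <= z <= 1.
        by near=> z; apply/andP; split; apply: ltW; near: z; [exact: lt_nbhsr|exact: lt_nbhsl].
      exact: (ci y _ nz).
    have c0 : - absorption alpha (u t) y - - absorption alpha (u t) (sg y) <= 0.
      by rewrite opprK addrC subr_le0; apply: absorption_mono => //; move: Dp; rewrite /D; lra.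
    set c := (X in X <= 0) in c0.
    exists (1 * D t y + (t - 1 / 2) * c - 2 * M).
      by nra.
    apply: parabB.
      apply: (@parab_mul_time R N (fun t => t - 1 / 2) 1 D).
        by apply: is_derive_eq; rewrite subr0.
      apply: parabB; first exact: (u1 t y t0).1.
      exact: (ur1 t y t0).1.
    exists 0, (fun j => if j == i then - (2 * M) else 0); split.
    - exact: is_derive_cst.
    - move=> j; have [->|ji] := eqVneq j i.
        rewrite (_ : (fun s => B _) = (fun r => M * (1 - (y ord0 i - a - 1 + r) ^+ 2))).
          rewrite (_ : - (2 * M) = M * (0 - 2)); last by ring.
          apply: has_derive2Z; apply: has_derive2B; [exact: has_derive2_cst|exact: has_derive2_sqr].
        apply/funext => r; rewrite /B !mxE !eqxx /= mulr1; congr (M * (1 - _ ^+ 2)); ring.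
      rewrite (_ : (fun s => B _) = (fun=> B y)); first exact: has_derive2_cst.
      by apply/funext => r; rewrite /B !mxE eqxx /= eq_sym (negPf ji) mulr0 addr0.
    - rewrite (bigD1 i)//= eqxx big1 ?addr0; first by ring.
      by move=> j /negPf ->.
  - by rewrite lexx; lra.
  - rewrite /F /= !mxE !eqxx /= mulr1 /a; apply/andP; split; lra.
move: E1; rewrite /E /D /B.
have -> : sg (x + s *: 'e_i) = x.
  apply/rowP => j; rewrite !mxE eqxx/=; case: eqP => [->|_]; last by rewrite mulr0 addr0.
  by rewrite /a mulr1; field.
rewrite !mxE !eqxx /= mulr1 /a.
have -> : x ord0 i + s - (x ord0 i + s / 2) - 1 = s / 2 - 1 by field.
by nra.
Unshelve. all: by end_near. Qed.

Lemma regular_lipschitz u M : regular_solution 0 alpha u ->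
  (forall t x, 1 / 2 <= t <= 1 -> `|u t x| <= M) ->
  forall i x s, `|s| <= 2 -> `|u 1 (x + s *: 'e_i) - u 1 x| <= 2 * M * `|s|.
Proof.
move=> ru uM.
have key i x s : 0 <= s <= 2 -> `|u 1 (x + s *: 'e_i) - u 1 x| <= 2 * M * s.
  move=> s02; rewrite ler_norml; apply/andP; split; last exact: regular_lipschitz_line.
  have := @regular_lipschitz_line _ M (regularN ru) _ i x s s02.
  have uN t y : 1 / 2 <= t <= 1 -> `|- u t y| <= M by rewrite normrN; exact: uM.
  by move=> /(_ uN); lra.
move=> i x s; have [s0|s0] := leP 0 s.
  by rewrite (ger0_norm s0) => s2; apply: key; rewrite s0.
rewrite (ltr0_norm s0) => s2; rewrite distrC.
have := key i (x + s *: 'e_i) (- s).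
by rewrite scaleNr addrK; apply; rewrite s2 andbT oppr_ge0 ltW.
Qed.

Lemma lipschitz_ucont (f : 'rV[R]_N -> R) K :
  (forall i x s, `|s| <= 2 -> `|f (x + s *: 'e_i) - f x| <= K * `|s|) -> ucont f.
Proof.
move=> fK e e0; have K0 : 0 < `|K| + 1 by rewrite ltr_wpDl.
have N0 : 0 < N%:R + 1 :> R by rewrite ltr_wpDl.
pose d := Num.min 1 (e / ((`|K| + 1) * (N%:R + 1))).
have d0 : 0 < d by rewrite lt_min ltr01/= divr_gt0// mulr_gt0.
have d1 : d <= 1 by rewrite ge_min lexx.
have de : d * ((`|K| + 1) * (N%:R + 1)) <= e.
  by rewrite -ler_pdivlMr ?mulr_gt0// ge_min lexx orbT.
exists d => // x y xy.
(* A path from x to y that changes one coordinate at a time. *)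
pose h k : 'rV[R]_N := \row_(j < N) (if (j < k)%N then y ord0 j else x ord0 j).
have hk k : (k <= N)%N -> `|f (h k) - f x| <= k%:R * ((`|K| + 1) * d).
  elim: k => [_|k IH kN].
    rewrite (_ : h 0%N = x) ?subrr ?normr0 ?mul0r//.
    by apply/rowP => j; rewrite mxE.
  pose i := Ordinal kN.
  have -> : h k.+1 = h k + (y ord0 i - x ord0 i) *: 'e_i.
    apply/rowP => j; rewrite !mxE eqxx /= ltnS leq_eqVlt.
    have [->|ji] := eqVneq j i; first by rewrite eqxx ltnn mulr1 addrC subrK.
    have -> : ((j : nat) == k) = false.
      by apply: contra_neqF ji => /eqP jk; exact: val_inj.
    by rewrite mulr0 addr0.
  have xyi := xy i; rewrite distrC in xyi.
  have := fK i (h k) (y ord0 i - x ord0 i).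
  have x2 : `|y ord0 i - x ord0 i| <= 2 by lra.
  move=> /(_ x2) h1.
  have := IH (ltnW kN) => h2.
  have h3 : K * `|y ord0 i - x ord0 i| <= (`|K| + 1) * d.
    apply: (@le_trans _ _ ((`|K| + 1) * `|y ord0 i - x ord0 i|)).
      by apply: ler_wpM2r => //; apply: le_trans (ler_norm K) _; rewrite lerDl.
    by apply: ler_wpM2l; exact: ltW.
  rewrite -(subrKA (f (h k))); apply: le_trans (ler_normD _ _) _.
  by rewrite -natr1 mulrDl mul1r addrC lerD// (le_trans h1).
have := hk N (leqnn N).
rewrite (_ : h N = y); last by apply/rowP => j; rewrite mxE ltn_ord.
rewrite distrC => /le_lt_trans; apply; apply: lt_le_trans de.
rewrite [ltRHS](_ : _ = N%:R * ((`|K| + 1) * d) + d * (`|K| + 1)); last by ring.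
by rewrite ltrDl mulr_gt0.
Qed.

(** Since absorption is odd, minus the mirror image of u is again a solution, and u is compared with
    it. Closeness to an antisymmetric H at small times replaces the initial value, which may be
    discontinuous. *)
Lemma regular_antisym_le m u (H : R -> 'rV[R]_N -> R) : regular_solution 0 alpha u ->
  (forall e, 0 < e -> \forall t \near (0 : R)^'+, forall x, `|u t x - H t x| < e) ->
  (forall t, 0 < t -> antisymmetric_fun m (H t)) ->
  forall t (i : 'I_N) x, 0 < t -> (i < m)%N -> u t x + u t (reflection i x) <= 0.
Proof.
move=> ru uH aH T i x T0 im.
have rE y : reflection i y = reflect_at i 0 y.
  by apply/rowP => j; rewrite !mxE; case: eqP => // ->; rewrite mulr0 sub0r.
apply/ler_addgt0Pl => e e0; rewrite addr0.
have e20 : 0 < e / 2 by rewrite divr_gt0.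
have near0 : \forall s \near (0 : R)^'+, [/\ 0 < s, s <= T & forall x, `|u s x - H s x| < e / 2].
  near=> s; split.
  - by near: s; exact: nbhs_right_gt.
  - by near: s; exact: nbhs_right_le.
  - by near: s; exact: uH.
have [s [s0 sT us]] := filter_ex near0.
have h := @comparison R N 0 alpha alpha0 u _ s e ru
  (regularN (regular_reflect i 0 ru)) s0 (ltW e0).
have : u T x <= - u T (reflect_at i 0 x) + e.
  apply: h => // y _; rewrite -rE.
  have := us y; have := us (reflection i y).
  by rewrite (aH s s0 i y im) !ltr_norml; lra.
by rewrite -rE; lra.
Unshelve. all: by end_near. Qed.

Section sign_data.
Variable m : nat.
Let h : 'rV[R]_N -> R := antisym_ext m (cst 1).

Lemma heat_sign_le1 t x : 0 < t -> `|heat t h x| <= 1.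
Proof.
move=> t0; rewrite heat_antisym_sign// normr_prod; apply: prodr_ile1 => j _.
by rewrite normr_ge0/=; case: ifP => _; rewrite ?normr1//; exact: gauss_sg_le.
Qed.

Lemma heat_sign_antisym t : 0 < t -> antisymmetric_fun m (heat t h).
Proof.
move=> t0 i x im; rewrite !heat_antisym_sign// (bigD1 i)//= im mxE eqxx gauss_sgN//.
rewrite [in RHS](bigD1 i)//= im mulNr; congr (- (_ * _)).
by apply: eq_bigr => j ji; rewrite mxE (negPf ji).
Qed.

Lemma heat_sign_ge0 t x : 0 < t -> sector m x -> 0 <= heat t h x.
Proof.
move=> t0 sx; rewrite heat_antisym_sign//; apply: prodr_ge0 => j _.
by case: ifP => // jm; apply: gauss_sg_ge0 => //; exact: sx.
Qed.

Lemma heat_sign_ge t x r : 0 < t -> 0 <= r -> 2 * tail t r <= 1 ->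
  (forall i : 'I_N, (i < m)%N -> r <= x ord0 i) ->
  1 - N%:R * (2 * tail t r) <= heat t h x.
Proof.
move=> t0 r0 tl xr; have t01 : 0 <= 2 * tail t r <= 1 by rewrite tl mulr_ge0// tail_ge0.
apply: le_trans (pow_ge1B N t01) _; rewrite heat_antisym_sign//.
rewrite (_ : _ ^+ N = \prod_(j < N) (1 - 2 * tail t r)); last first.
  by rewrite prodr_const card_ord.
apply: ler_prod => j _; rewrite subr_ge0 tl/=; case: ifP => jm; last by case/andP: t01; lra.
by apply: gauss_sg_ge => //; exact: xr.
Qed.

Variable w : R -> 'rV[R]_N -> R.
Hypothesis hw : is_bounded_solution alpha h w.

Lemma near_initial e : 0 < e ->
  \forall t \near (0 : R)^'+, forall x, `|w t x - heat t h x| < e.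
Proof.
move=> e0; have [_ _ _ w0] := hw.
have := @uniform_cvgTP _ _ (at_right_proper_filter 0) (fun t x => w t x - heat t h x) (cst 0) w0 e e0.
by apply: filterS => t ht x; have := ht x; rewrite /cst sub0r normrN.
Qed.

(** [regular_antisym_le] for w and for -w gives the two inequalities of antisymmetry. *)
Lemma regular_sign_solution : regular_solution m alpha w.
Proof.
have rw := regular_bounded_solution hw; have [w1 w2 w3 _] := rw; split => // t t0 i x im.
apply/eqP; rewrite -addr_eq0 eq_le; apply/andP; split.
  rewrite addrC; apply: (regular_antisym_le rw near_initial heat_sign_antisym) => //.
have aN s : 0 < s -> antisymmetric_fun m (fun x => - heat s h x).
  by move=> s0 j y jm; rewrite heat_sign_antisym.
have nN e : 0 < e -> \forall t \near (0 : R)^'+, forall x, `|- w t x - - heat t h x| < e.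
  move=> e0; apply: filterS (near_initial e0) => s hs y.
  by rewrite -opprD normrN.
have := regular_antisym_le (regularN rw) nN aN x t0 im; lra.
Qed.

Lemma sign_solution_bound t x : 0 < t -> `|w t x| <= (alpha * t) `^ (- alpha^-1).
Proof.
move=> t0; have rw := regular_bounded_solution hw.
have near2 : \forall t \near (0 : R)^'+, forall x, `|w t x| <= 2.
  near=> s => y.
  have s0 : 0 < s by near: s; exact: nbhs_right_gt.
  have h1 := heat_sign_le1 y s0.
  have h2 : forall y, `|w s y - heat s h y| < 1 by near: s; exact: near_initial.
  by have := h2 y; move: h1; rewrite ltr_norml !ler_norml; lra.
rewrite ler_norml; apply/andP; split.
  rewrite -lerN2 opprK; apply: (regular_ode_bound (regularN rw)) => //.
  by apply: filterS near2 => s hs y; have := hs y; rewrite ler_norml; lra.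
apply: (regular_ode_bound rw) => //.
by apply: filterS near2 => s hs y; have := hs y; rewrite ler_norml; lra.
Unshelve. all: by end_near. Qed.

(** The right-hand side is itself invariant under dilations, so the bound is uniform in l and
    survives in the limit. *)
Lemma dilation_bound l t x : 0 < l -> 0 < t ->
  `|dilation alpha l w t x| <= (alpha * t) `^ (- alpha^-1).
Proof.
move=> l0 t0; have L0 : 0 < l `^ (2 / alpha) by exact: powR_gt0.
have l2t : 0 < l ^+ 2 * t by rewrite mulr_gt0// exprn_gt0.
rewrite /dilation normrM gtr0_norm//.
apply: (@le_trans _ _ (l `^ (2 / alpha) * (alpha * (l ^+ 2 * t)) `^ (- alpha^-1))).
  by rewrite ler_pM2l//; exact: sign_solution_bound.
have at0 : 0 <= alpha * t by rewrite mulr_ge0// ltW.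
have -> : (alpha * (l ^+ 2 * t)) `^ (- alpha^-1) =
    (l `^ 2) `^ (- alpha^-1) * (alpha * t) `^ (- alpha^-1).
  by rewrite -powRM ?powR_ge0// powR_mulrn ?(ltW l0)// mulrCA.
by rewrite mulrA -powRrM mulrN powRN mulfV ?mul1r// gt_eqF.
Qed.

End sign_data.

End solutions.

(** * The self-similar limit *)

Section profile.
Context {R : realType} {N : nat}.
Variables (alpha : R) (m : nat).
Hypothesis alpha0 : 0 < alpha.
Implicit Types (x y : 'rV[R]_N) (t tau l k s e : R).
Local Notation "''e_' i" := (delta_mx (ord0 : 'I_1) (i : 'I_N) : 'rV[R]_N)
  (at level 8, i at level 2, format "''e_' i").
Let h : 'rV[R]_N -> R := antisym_ext m (cst 1).
Variables w V : R -> 'rV[R]_N -> R.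
Hypothesis hw : is_bounded_solution alpha h w.
Hypothesis hV : dilation_limit alpha w V.

Lemma powR_pinfty (p M : R) : 0 < p -> \forall l \near +oo, M <= l `^ p.
Proof.
move=> p0; near=> l.
have Ml : `|M| `^ p^-1 <= l by near: l; apply: nbhs_pinfty_ge; rewrite num_real.
have l0 : 0 <= l by apply: le_trans Ml; exact: powR_ge0.
have e : (`|M| `^ p^-1) `^ p = `|M| by rewrite -powRrM mulVf ?gt_eqF// powRr1.
apply: le_trans (ler_norm M) _; rewrite -e.
by apply: ge0_ler_powR; rewrite ?nnegrE ?powR_ge0 ?(ltW p0).
Unshelve. all: by end_near. Qed.

Lemma near_right0_scale c (P : set R) : 0 < c ->
  (\forall t \near (0 : R)^'+, P t) -> \forall t \near (0 : R)^'+, P (c * t).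
Proof.
move=> c0 [d /= d0 hd]; exists (d / c); first by rewrite /= divr_gt0.
move=> t /=; rewrite !sub0r !normrN => td t0; apply: hd; last by rewrite mulr_gt0.
by rewrite /= sub0r normrN normrM gtr0_norm// mulrC -ltr_pdivlMr.
Qed.

Lemma dilation_limit_near (K : set (R * 'rV[R]_N)) e : compact K ->
  K `<=` [set p | 0 < p.1] -> 0 < e ->
  \forall l \near +oo, forall p, K p -> `|V p.1 p.2 - dilation alpha l w p.1 p.2| < e.
Proof.
move=> cK K0 e0; have := hV cK K0.
by move=> /(uniform_cvgP (@proper_pinfty_nbhs R) K) /(_ e e0).
Qed.

Lemma dilation_cvg t x : 0 < t -> dilation alpha l w t x @[l --> +oo] --> V t x.
Proof.
move=> t0; apply/cvgrPdist_lt => e e0.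
have tK : [set (t, x)] `<=` [set p : R * 'rV[R]_N | 0 < p.1] by move=> p ->.
have := dilation_limit_near (@compact_set1 (R * 'rV[R]_N)%type (t, x)) tK e0.
by apply: filterS => l hl; exact: (hl (t, x)).
Qed.

Lemma dilation_comp k l t x : 0 < k -> 0 < l ->
  l `^ (2 / alpha) * dilation alpha k w (l ^+ 2 * t) (l *: x) = dilation alpha (k * l) w t x.
Proof.
move=> k0 l0; rewrite /dilation powRM ?ltW// exprMn scalerA !mulrA; congr (_ * _).
by rewrite mulrC.
Qed.

(** The dilations compose, and k l tends to infinity with k, so the family of parameters k l has the
    same limit V. *)
Lemma limit_scaling l t x : 0 < l -> 0 < t ->
  V t x = l `^ (2 / alpha) * V (l ^+ 2 * t) (l *: x).
Proof.
move=> l0 t0; have l2t : 0 < l ^+ 2 * t by rewrite mulr_gt0// exprn_gt0.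
have h1 : dilation alpha (k * l) w t x @[k --> +oo] --> V t x.
  have kl : k * l @[k --> +oo] --> +oo by apply: gt0_cvgMly => //; exact: cvg_id.
  exact: (@cvg_comp _ _ _ (fun k => k * l) (fun k => dilation alpha k w t x) _ _ _ kl (@dilation_cvg _ x t0)).
have h2 : l `^ (2 / alpha) * dilation alpha k w (l ^+ 2 * t) (l *: x) @[k --> +oo] -->
    l `^ (2 / alpha) * V (l ^+ 2 * t) (l *: x).
  by apply: cvgMr; exact: dilation_cvg.
apply: (cvg_unique (@norm_hausdorff _ R) h1).
apply: cvg_trans h2; apply: near_eq_cvg; near=> k.
by rewrite dilation_comp//; near: k; exact: nbhs_pinfty_gt.
Unshelve. all: by end_near. Qed.

Lemma limit_selfsimilar t x : 0 < t ->
  V t x = t `^ (- alpha^-1) * V 1 ((Num.sqrt t)^-1 *: x).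
Proof.
move=> t0; have st0 : 0 < Num.sqrt t by rewrite sqrtr_gt0.
rewrite (@limit_scaling (Num.sqrt t)^-1) ?invr_gt0//.
rewrite exprVn sqr_sqrtr ?ltW// mulVf ?gt_eqF//; congr (_ * _).
have -> : (Num.sqrt t)^-1 = t `^ (- (1 / 2)).
  by rewrite powRN div1r powR12_sqrt ?ltW.
by rewrite -powRrM; congr (_ `^ _); field; rewrite gt_eqF.
Qed.

Lemma limit_antisym : antisymmetric_fun m (V 1).
Proof.
move=> i x im.
have h1 := @dilation_cvg _ (reflection i x) ltr01.
have h2 : - dilation alpha l w 1 x @[l --> +oo] --> - V 1 x.
  by apply: cvgN; exact: dilation_cvg.
apply: (cvg_unique (@norm_hausdorff _ R) h1).
apply: cvg_trans h2; apply: near_eq_cvg; near=> k.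
have k0 : 0 < k by near: k; exact: nbhs_pinfty_gt.
have [_ _ _ a] := regular_dilation alpha0 k0 (regular_sign_solution alpha0 hw).
by rewrite a.
Unshelve. all: by end_near. Qed.

Lemma limit_Cbu : Cbu_fun (V 1).
Proof.
split.
  exists ((alpha * 1) `^ (- alpha^-1)) => x.
  have c : `|dilation alpha l w 1 x| @[l --> +oo] --> `|V 1 x|.
    by apply: cvg_norm; exact: dilation_cvg.
  apply: (ler_cvg_to c (cvg_cst _)); near=> k.
  by apply: (dilation_bound alpha0 hw) => //; near: k; exact: nbhs_pinfty_gt.
apply/unif_continuous_ucont.
(* The bound on the dilations decreases in t, so its value at 1/2 serves on all of [1/2, 1]. *)
pose M := (alpha * (1 / 2)) `^ (- alpha^-1).
apply: (@lipschitz_ucont _ _ _ (2 * M)) => i x s s2.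
have c : `|dilation alpha l w 1 (x + s *: 'e_i) - dilation alpha l w 1 x| @[l --> +oo] -->
    `|V 1 (x + s *: 'e_i) - V 1 x|.
  by apply: cvg_norm; apply: cvgB; exact: dilation_cvg.
apply: (ler_cvg_to c (cvg_cst _)); near=> k.
have k0 : 0 < k by near: k; exact: nbhs_pinfty_gt.
have rd := regular_dilation alpha0 k0 (regular_bounded_solution hw).
apply: (regular_lipschitz alpha0 rd _ _ _ s2) => t y /andP[t1 _].
have t0 : 0 < t by lra.
apply: le_trans (dilation_bound alpha0 hw y k0 t0) _.
have a1 : 0 < alpha * (1 / 2) by rewrite mulr_gt0.
have a2 : 0 < alpha * t by rewrite mulr_gt0.
rewrite /M !powRN lef_pV2 ?posrE ?powR_gt0//.
apply: ge0_ler_powR; rewrite ?nnegrE ?invr_ge0 ?(ltW a1) ?(ltW a2) ?(ltW alpha0)//.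
by rewrite ler_pM2l.
Unshelve. all: by end_near. Qed.

(* Large dilations of w are large away from the faces near t = 0, while v(tau) is
   small near the faces. *)
Lemma flow_le_limit v t x : regular_solution m alpha v -> 0 < t -> sector m x ->
  v t x <= V t x.
Proof.
move=> rv; have [_ v2 v3 v4] := rv.
have key tau s y : 0 < tau -> 0 < s -> sector m y -> v (tau + s) y <= V s y.
  move=> tau0 s0 sy; apply/ler_addgt0Pr => e e0.
  have e40 : 0 < e / 4 by rewrite divr_gt0.
  have [[M0 HM] uv] := v2 _ tau0.
  have [d d0 hd] := uv _ e40.
  (* At small times the heat evolution of h is at least 1/2 at distance l d from the faces, by the
     choice of eta below. So l^(2/alpha) >= 2 M0 puts the dilated evolution above v(tau) at distance
     d from the faces. *)
  have near_l : \forall l \near +oo, [/\ 0 < l, 2 * M0 <= l `^ (2 / alpha) &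
      `|V s y - dilation alpha l w s y| < e / 4].
    have c := @dilation_cvg _ y s0; move/cvgrPdist_lt in c.
    near=> l; split; last by near: l; exact: c.
      by near: l; exact: nbhs_pinfty_gt.
    by near: l; apply: powR_pinfty; rewrite divr_gt0.
  have [l [l0 lM lV]] := filter_ex near_l.
  pose L := l `^ (2 / alpha); have L0 : 0 < L by exact: powR_gt0.
  have l20 : 0 < l ^+ 2 by rewrite exprn_gt0.
  pose eta : R := 1 / (4 * (N%:R + 1)).
  have N0 : 0 < N%:R + 1 :> R by rewrite ltr_wpDl.
  have eta0 : 0 < eta by rewrite divr_gt0// mulr_gt0.
  have etaE : N%:R * (2 * eta) <= 1 / 2.
    by rewrite /eta mulrA mulrA mulr1 ler_pdivrMr ?mulr_gt0//; lra.
  have eta4 : eta <= 1 / 4.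
    by rewrite ler_pdivrMr ?mulr_gt0//; have := ler0n R N; lra.
  have [S S0 hS] := tail_small (mulr_gt0 l0 d0) eta0.
  have near0 : \forall r \near (0 : R)^'+, [/\ 0 < r, r <= s, r * l ^+ 2 <= S,
      (forall z, `|v tau z - v (tau + r) z| < e / 4) &
      forall z, `|w (l ^+ 2 * r) z - heat (l ^+ 2 * r) h z| < e / (4 * L)].
    near=> r; split.
    - by near: r; exact: nbhs_right_gt.
    - by near: r; exact: nbhs_right_le.
    - by rewrite -ler_pdivlMr//; near: r; apply: nbhs_right_le; rewrite divr_gt0.
    - near: r; have c : tau + r @[r --> (0 : R)^'+] --> tau.
        rewrite -[X in _ --> X]addr0; apply: cvgD; first exact: cvg_cst.
        exact: cvg_at_right_filter.
      exact: (c [set t | forall z, `|v tau z - v t z| < e / 4] (v3 _ _ tau0 e40)).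
    - near: r; have eL0 : 0 < e / (4 * L) by rewrite divr_gt0// mulr_gt0.
      exact: (near_right0_scale l20 (near_initial hw eL0)).
  have [r [r0 rs rS hv hr]] := filter_ex near0.
  have lr0 : 0 < l ^+ 2 * r by rewrite mulr_gt0.
  have rd := regular_dilation alpha0 l0 (regular_sign_solution alpha0 hw).
  have rv' := regular_shift (ltW tau0) rv.
  have := @comparison R N m alpha alpha0 _ _ r (3 * (e / 4)) rv' rd r0 _ _ s y rs sy.
  (* The three quarters pay for the change of v from tau to tau + r, for the distance of w to the
     heat evolution of h once dilated, and for the size of v(tau) near a face. *)
  have init z : sector m z -> v (tau + r) z <= dilation alpha l w r z + 3 * (e / 4).
    move=> sz; have := hv z; have := hr (l *: z).
    have slz : sector m (l *: z) by move=> i im; rewrite mxE mulr_ge0 ?(ltW l0)// sz.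
    have := heat_sign_ge0 lr0 slz.
    have -> : e / (4 * L) = (e / 4) / L by field; rewrite gt_eqF.
    rewrite -/(dilation alpha l w r z) /dilation -/L.
    set W := w _ _; set H := heat _ _ _ => H0 WH.
    have {}WH : L * (H - W) < e / 4.
      rewrite mulrC -ltr_pdivlMr//; apply: le_lt_trans WH.
      by rewrite distrC ler_norm.
    have LH : 0 <= L * H by rewrite mulr_ge0// ltW.
    have [zd|] := pselect (forall i : 'I_N, (i < m)%N -> d <= z ord0 i).
      have ld (i : 'I_N) : (i < m)%N -> l * d <= (l *: z) ord0 i.
        by move=> im; rewrite mxE ler_pM2l// zd.
      have tl : tail (l ^+ 2 * r) (l * d) <= eta by apply: hS; rewrite lr0 mulrC.
      have tl2 : 2 * tail (l ^+ 2 * r) (l * d) <= 1.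
        by have := le_trans tl eta4; lra.
      have := heat_sign_ge lr0 (ltW (mulr_gt0 l0 d0)) tl2 ld; rewrite -/H => hH.
      have H2 : 1 / 2 <= H.
        apply: le_trans hH.
        have : N%:R * (2 * tail (l ^+ 2 * r) (l * d)) <= N%:R * (2 * eta).
          by rewrite ler_wpM2l// ler_pM2l.
        lra.
      have : L * (1 / 2) <= L * H by rewrite ler_pM2l.
      have := HM z; rewrite ltr_norml ler_norml; rewrite -/L in lM; lra.
    move=> /existsNP[i /not_implyP[im /negP]]; rewrite -ltNge => zi.
    pose z' := \row_j (if j == i then 0 else z ord0 j).
    have Dz' : v tau z' = 0 by apply: (antisym_face (v4 _ tau0) im); rewrite mxE eqxx.
    have : `|v tau z - v tau z'| < e / 4.
      apply: hd => j; rewrite mxE; case: eqP => [->|_]; last by rewrite subrr normr0.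
      by rewrite subr0 ger0_norm// sz.
    by rewrite Dz' subr0 !ltr_norml; lra.
  have e3 : 0 <= 3 * (e / 4) by lra.
  by move=> /(_ e3 init); move: lV; rewrite ltr_norml; lra.
move=> t0 sx; apply/ler_addgt0Pr => e e0.
have near0 : \forall r \near (0 : R)^'+, 0 < r /\ forall z, `|v t z - v (t + r) z| < e.
  near=> r; split; first by near: r; exact: nbhs_right_gt.
  near: r; have c : t + r @[r --> (0 : R)^'+] --> t.
    rewrite -[X in _ --> X]addr0; apply: cvgD; first exact: cvg_cst.
    exact: cvg_at_right_filter.
  exact: (c [set s | forall z, `|v t z - v s z| < e] (v3 _ _ t0 e0)).
have [r [r0 hr]] := filter_ex near0.
have := key r t x r0 t0 sx; have := hr x; rewrite (addrC r t) ltr_norml; lra.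
Unshelve. all: by end_near. Qed.

End profile.

(** * Weighted bounds of the initial data *)

Section weighted_bounds.
Context {R : realType} {N : nat}.
Variables (m : nat) (gamma : R).
Hypotheses (m1 : (1 <= m <= N)%N) (gamma0 : 0 < gamma) (gammaN : gamma < N%:R).
Implicit Types (x y : 'rV[R]_N) (psi : 'rV[R]_N -> R) (M p t T tau : R).
Local Notation leb := (@lebesgue_measure R).
Local Notation mu := (lebesgue_rV N : {measure set _ -> \bar R}).

Lemma Xnorm_le_ae psi M : (Xnorm m gamma psi <= M%:E)%E ->
  {ae mu, forall x, Omega m x -> `|rho m gamma x * psi x| <= M}.
Proof.
rewrite /Xnorm unlock; case: ifPn => [_|mu0 _].
  move=> /ess_sup_inf.ess_supP; apply: filterS => x /= h Ox; move: h.
  by rewrite patchE mem_set.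
(* The other branch of [Lnorm], for a measure of total mass 0: every property then holds almost
   everywhere. *)
exists setT; split=> //; apply/eqP; rewrite eq_le measure_ge0 andbT leNgt.
exact: mu0.
Qed.

Lemma prod_coord_le y (E : R) : (forall i : 'I_N, (i < m)%N -> 0 <= y ord0 i <= E) ->
  \prod_(i < N | (i < m)%N) y ord0 i <= E ^+ m.
Proof.
move=> yE; have /andP[_ mN] := m1.
apply: (@le_trans _ _ (\prod_(i < N | (i < m)%N) E)); first exact: ler_prod.
by rewrite -(big_ord_widen N (fun=> E) mN) prodr_const card_ord.
Qed.

(** With E the Euclidean norm of y and P = y_1...y_m <= E^m, the hypothesis reads |p| <= M P /
    E^(gamma + 2m). Hence |p| <= M for E >= 1, and one more factor P gives P |p| <= M E^(-gamma).
    The product of the |y_j|^(gamma/N) is at most E^gamma and can be integrated one coordinate at a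
    time. *)
Lemma Omega_weight_bound y p M : Omega m y -> `|rho m gamma y * p| <= M ->
  (1 <= `|y| -> `|p| <= M) /\
  \prod_(i < N | (i < m)%N) y ord0 i * `|p| *
    \prod_(j < N) (`|y ord0 j| `^ (gamma / N%:R)) <= M.
Proof.
move=> Oy; have /andP[m0 mN] := m1.
pose E := enorm y; pose P := \prod_(i < N | (i < m)%N) y ord0 i.
have yE j : `|y ord0 j| <= E by apply: le_trans (coord_le_norm y j) _; exact: norm_le_enorm.
have P0 : 0 < P by apply: prodr_gt0 => i im; exact: Oy.
have E0 : 0 < E.
  have iN : (0 < N)%N by exact: leq_trans mN.
  by apply: lt_le_trans (yE (Ordinal iN)); rewrite normr_gt0 gt_eqF// Oy.
have PE : P <= E ^+ m.
  by apply: prod_coord_le => i im; rewrite ltW ?Oy//=; apply: le_trans (yE i); exact: ler_norm.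
have rE : rho m gamma y = E `^ gamma * E ^+ m * E ^+ m / P.
  rewrite /rho powRD; last by rewrite (gt_eqF E0) implybT.
  by rewrite powR_mulrn ?ltW// mul2n -addnn exprD mulrA.
have Eg : 0 < E `^ gamma by exact: powR_gt0.
have Em : 0 < E ^+ m by rewrite exprn_gt0.
rewrite rE normrM ger0_norm; last by rewrite !mulr_ge0 ?invr_ge0// ltW.
rewrite mulrAC ler_pdivrMr// => h.
have M0 : 0 <= M.
  rewrite -(pmulr_lge0 M P0); apply: (le_trans _ h).
  by rewrite !mulr_ge0// ltW.
split=> [y1|].
  have E1 : 1 <= E by apply: le_trans y1 (norm_le_enorm y).
  have Eg1 : 1 <= E `^ gamma.
    rewrite [leLHS](_ : _ = 1 `^ gamma); last by rewrite powR1.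
    by apply: ge0_ler_powR; rewrite ?nnegrE ?ler01 ?(ltW gamma0) ?(ltW E0).
  have Em1 : 1 <= E ^+ m by rewrite exprn_ege1.
  rewrite -(ler_pM2l Em); apply: (@le_trans _ _ (M * P)); last first.
    by rewrite mulrC ler_wpM2r.
  apply: (le_trans _ h); rewrite [leRHS](_ : _ = (E `^ gamma * E ^+ m) * (E ^+ m * `|p|)).
    have e1 : 1 <= E `^ gamma * E ^+ m by rewrite -[1]mulr1; apply: ler_pM.
    by apply: ler_peMl => //; rewrite mulr_ge0// ltW.
  by ring.
have gN : 0 <= gamma / N%:R by rewrite divr_ge0// ltW.
have Q1 : \prod_(j < N) (`|y ord0 j| `^ (gamma / N%:R)) <= E `^ gamma.
  have -> : E `^ gamma = \prod_(j < N) (E `^ (gamma / N%:R)).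
    rewrite prodr_const card_ord -powR_mulrn ?powR_ge0// -powRrM divfK//.
    by rewrite pnatr_eq0 -lt0n (leq_trans m0 mN).
  apply: ler_prod => j _; rewrite powR_ge0/=.
  by apply: ge0_ler_powR => //; rewrite nnegrE// ltW.
rewrite -(ler_pM2l (exprn_gt0 2 Em)).
apply: (@le_trans _ _ (P * (E `^ gamma * E ^+ m * E ^+ m * `|p|))).
  rewrite [leRHS](_ : _ = (E ^+ m) ^+ 2 * (P * `|p| * E `^ gamma)); last by ring.
  by rewrite ler_pM2l ?exprn_gt0// ler_wpM2l// mulr_ge0// ltW.
apply: (@le_trans _ _ (P * (M * P))); first by rewrite ler_pM2l.
rewrite mulrCA [leRHS]mulrC; apply: ler_wpM2l => //.
by rewrite expr2; apply: ler_pM => //; exact: ltW.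
Qed.

(* |y|^{-gamma} is at most the product of the |y_j|^{-gamma/N}, which are integrable
   near 0 because gamma < N. *)
Let singular (b : R) : R :=
  ((fun c => c `^ (- (gamma / N%:R))) \_ `]0, 1]) b +
  ((fun c => c `^ (- (gamma / N%:R))) \_ `]0, 1]) (- b).

Let N0 : 0 < N%:R :> R.
Proof. exact: lt_trans gammaN. Qed.

Let integrable_singular : leb.-integrable setT (EFin \o singular).
Proof.
have p1 : gamma / N%:R < 1 by rewrite ltr_pdivrMr// mul1r.
have h := integrable_powR01 p1.
rewrite (_ : _ \o _ = (fun b => (((fun c => c `^ (- (gamma / N%:R))) \_ `]0, 1]) b)%:E +
  (((fun c => c `^ (- (gamma / N%:R))) \_ `]0, 1]) (- b))%:E)%E)//.
by apply: integrableD => //; exact: integrable_oppr h.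
Qed.

Let singular_ge0 b : 0 <= singular b.
Proof. by rewrite addr_ge0// /patch; case: ifP => // _; rewrite powR_ge0. Qed.

Let singular_ge b : b != 0 -> `|b| <= 1 -> `|b| `^ (- (gamma / N%:R)) <= singular b.
Proof.
move=> b0 b1; rewrite /singular; have [bp|bn] := leP 0 b.
  rewrite (ger0_norm bp) in b1 *.
  rewrite patchE mem_set/=; last by rewrite in_itv/= b1 andbT lt_neqAle eq_sym b0.
  rewrite lerDl /patch; case: ifP => // _; exact: powR_ge0.
rewrite (ltr0_norm bn) in b1 *.
rewrite [X in _ + X]patchE mem_set/=; last by rewrite in_itv/= b1 andbT oppr_gt0.
rewrite lerDr /patch; case: ifP => // _; exact: powR_ge0.
Qed.

(** One majorant for all times in [T/2, T] and all values p obeying the weighted bound. For |y| >= 1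
    the Gaussian majorant suffices; near the origin [okernel_le_coord] supplies the factor y_1...y_m
    needed by [Omega_weight_bound]. Zero coordinates are excluded because [singular] is 0 at 0. *)
Lemma okernel_weight_dominated T x : 0 < T -> sector m x ->
  exists2 G : 'rV[R]_N -> R, mu.-integrable setT (EFin \o G) &
  (forall y, 0 <= G y) /\
  forall t y p M, T / 2 <= t <= T -> Omega m y -> (forall j, y ord0 j != 0) ->
    `|rho m gamma y * p| <= M -> okernel m t x y * `|p| <= M * G y.
Proof.
move=> T0 sx; have T2 : 0 < T / 2 by rewrite divr_gt0.
have T2T : T / 2 <= T by lra.
have [G1 [iG1 HG1]] := @kernel_dominated R N m _ _ _ T2 T2T (normr_ge0 x).
have [C2 C20 HC2] := @okernel_le_coord R N m (T / 2) x T2 sx.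
have [ipsi _] := @integrable_integral_prod_rV R N (fun _ => singular) (fun=> integrable_singular).
pose psi y := \prod_(j < N) singular (y ord0 j).
have psi0 y : 0 <= psi y by apply: prodr_ge0.
exists (fun y => `|G1 y| + C2 * psi y).
  rewrite (_ : _ \o _ = (fun y => `|(G1 y)%:E| + C2%:E * (psi y)%:E)%E)//.
  apply: integrableD => //; last exact: integrableZl.
  exact: integrable_abse.
split=> [y|t y p M /andP[t1 t2] Oy y0 h]; first by rewrite addr_ge0// mulr_ge0.
have [h1 h2] := Omega_weight_bound Oy h.
have M0 : 0 <= M by exact: le_trans h.
have sy : sector m y by move=> i im; exact: ltW (Oy i im).
have t0 : 0 < t by exact: lt_le_trans t1.
have /andP[k0 _] := okernel_le_gaussN t0 sx sy.
have [y1|y1] := leP 1 `|y|.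
  apply: (@le_trans _ _ (`|G1 y| * M)).
    apply: ler_pM => //; last exact: h1.
    have [h3 _] := HG1 t x y (introT andP (conj t1 t2)) (lexx _).
    by apply: le_trans (ler_norm _) _; apply: le_trans h3 (ler_norm _).
  by rewrite mulrC ler_wpM2l// lerDl mulr_ge0.
pose q := \prod_(j < N) (`|y ord0 j| `^ (gamma / N%:R)).
have q0 : 0 < q by apply: prodr_gt0 => j _; rewrite powR_gt0 ?normr_gt0.
have qpsi : q^-1 <= psi y.
  rewrite /q -prodfV; apply: ler_prod => j _; rewrite invr_ge0 powR_ge0/= -powRN.
  by apply: singular_ge => //; apply: le_trans (coord_le_norm y j) (ltW y1).
apply: (@le_trans _ _ (C2 * (\prod_(i < N | (i < m)%N) y ord0 i * `|p|))).
  by rewrite mulrA ler_wpM2r// HC2.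
apply: (@le_trans _ _ (C2 * (M * q^-1))).
  by apply: ler_wpM2l => //; rewrite ler_pdivlMr.
rewrite mulrCA; apply: ler_wpM2l => //.
apply: (@le_trans _ _ (C2 * psi y)); first exact: ler_wpM2l.
by rewrite lerDr.
Qed.

(** The hyperplane y_j = 0 is a box with one side reduced to a point; its measure is 0 since 0 times
    +oo is 0 in [\bar R]. *)
Lemma ae_coord_neq0 : {ae mu, forall y : 'rV[R]_N, forall j, y ord0 j != 0}.
Proof.
apply: filter_forall => j.
pose A (i : 'I_N) : set R := if i == j then [set 0] else setT.
exists [set y : 'rV[R]_N | forall i, A i (y ord0 i)]; split.
- rewrite (_ : [set _ | _] = (fun y : 'rV[R]_N => y ord0 j) @^-1` [set 0]).
    rewrite -[X in measurable X]setTI.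
    exact: (measurable_rV_coord j measurableT (measurable_set1 _)).
  apply/seteqP; split => y /=.
    by move=> /(_ j); rewrite /A eqxx.
  by move=> yj i; rewrite /A; case: eqP => // ->.
- rewrite [LHS]lebesgue_rV_box; last first.
    by move=> i; rewrite /A; case: ifP => _.
  rewrite (bigD1 j)//= {1}/A eqxx lebesgue_measure_set1 mul0e//.
- move=> y /= /negP; rewrite negbK => /eqP yj i.
  by rewrite /A; case: eqP => // ->.
Qed.

End weighted_bounds.

(** * The lower bound *)

Section initial_data.
Context {R : realType} {N : nat}.
Variables (m : nat) (gamma alpha C : R).
Hypotheses (m1 : (1 <= m <= N)%N) (gamma0 : 0 < gamma) (gammaN : gamma < N%:R).
Implicit Types (x y : 'rV[R]_N) (M p t T tau : R).
Local Notation mu := (lebesgue_rV N : {measure set _ -> \bar R}).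
Variables (v0 : 'rV[R]_N -> R) (v : R -> 'rV[R]_N -> R).
Hypotheses (hv0 : antisym_Xspace m gamma v0) (hv : is_flow m gamma alpha C v0 v).

Lemma Omega_sector x : Omega m x -> sector m x.
Proof. by move=> Ox i im; exact: ltW (Ox i im). Qed.

Lemma measurable_Omega : measurable (Omega m : set 'rV[R]_N).
Proof.
rewrite (_ : Omega m = \bigcap_(i in [set i : 'I_N | (i < m)%N])
    ((fun x : 'rV[R]_N => x ord0 i) @^-1` [set r | 0 < r])); last first.
  by apply/seteqP; split => x h i im; exact: h.
apply: fin_bigcap_measurable => // i _.
rewrite -[X in measurable X]setTI; apply: (measurable_rV_coord i measurableT).
rewrite (_ : [set r | 0 < r] = `]0, +oo[%classic); first exact: measurable_itv.
by apply/seteqP; split => r /=; rewrite in_itv/= andbT.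
Qed.

(** Only the restriction of psi to [Omega m] is measurable, and it is enough: the folded point
    leaves [Omega m] only if some x_i = 0, and then the product of signs vanishes. *)
Lemma measurable_antisym_ext psi : measurable_fun (Omega m) psi ->
  measurable_fun setT (antisym_ext m psi : 'rV[R]_N -> R).
Proof.
move=> mpsi; pose a x : 'rV[R]_N := \row_j (if (j < m)%N then `|x ord0 j| else x ord0 j).
have ma : measurable_fun setT a.
  apply: measurable_fun_rV => j.
  have [jm|jm] := boolP (j < m)%N.
    rewrite (_ : (fun x => _) = (fun x : 'rV[R]_N => `|x ord0 j|)).
      exact: measurableT_comp (measurable_rV_coord j).
    by apply/funext => x; rewrite mxE jm.
  rewrite (_ : (fun x => _) = (fun x : 'rV[R]_N => x ord0 j)).
    exact: measurable_rV_coord.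
  by apply/funext => x; rewrite mxE (negPf jm).
have msg : measurable_fun setT
    (fun x : 'rV[R]_N => \prod_(i < N | (i < m)%N) Num.sg (x ord0 i)).
  rewrite (_ : (fun x => _) = (fun x : 'rV[R]_N =>
      \prod_(i < N) (if (i < m)%N then Num.sg (x ord0 i) else 1))).
    apply: (measurable_fun_prod_rV (f := fun (i : 'I_N) b => if (i < m)%N then Num.sg b else 1)).
    by move=> i; case: (i < m)%N; [exact: measurable_sgr|exact: measurable_cst].
  by apply/funext => x; rewrite big_mkcond.
have mp : measurable_fun setT (psi \_ (Omega m) : 'rV[R]_N -> R).
  exact: (proj1 (measurable_restrictT _ measurable_Omega)).
rewrite (_ : antisym_ext m psi = (fun x : 'rV[R]_N =>
    \prod_(i < N | (i < m)%N) Num.sg (x ord0 i) * (psi \_ (Omega m)) (a x))).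
  exact: measurable_funM msg (measurableT_comp mp ma).
apply/funext => x; rewrite /antisym_ext -/(a x).
have [Oa|Oa] := pselect (Omega m (a x)); first by rewrite patchE mem_set.
rewrite patchE memNset// mulr0.
move: Oa => /existsNP[i /not_implyP[im /negP]]; rewrite mxE im -leNgt normr_le0 => /eqP xi.
by rewrite (bigD1 i)//= xi sgr0 !mul0r.
Qed.

Lemma antisym_ext_Omega psi x : Omega m x -> antisym_ext m psi x = psi x.
Proof.
move=> Ox; rewrite /antisym_ext big1 ?mul1r => [|i im]; last by rewrite gtr0_sg// Ox.
by congr psi; apply/rowP => j; rewrite mxE; case: ifP => // jm; rewrite gtr0_norm// Ox.
Qed.

Lemma measurable_initial : measurable_fun setT v0.
Proof. by case: hv0 => psi [mpsi _] <-; exact: measurable_antisym_ext. Qed.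

Lemma weight_finite : exists M, (Xnorm m gamma v0 <= M%:E)%E /\
  forall t, 0 < t -> (Xnorm m gamma (v t) <= M%:E)%E.
Proof.
have X0 psi : (0 <= Xnorm m gamma (psi : 'rV[R]_N -> R))%E by exact: Lnorm_ge0.
have Xfin : Xnorm m gamma v0 \is a fin_num.
  rewrite ge0_fin_numE//; case: hv0 => psi [_ psioo] <-.
  suff -> : Xnorm m gamma (antisym_ext m psi) = Xnorm m gamma psi by [].
  rewrite /Xnorm; congr (Lnorm _ _ _); apply/funext => x /=; congr EFin.
  by rewrite /patch; case: ifPn => // /set_mem Ox; rewrite /= antisym_ext_Omega.
have [_ _ _ vX] := hv.
exists (Num.max (fine (Xnorm m gamma v0)) (C * fine (Xnorm m gamma v0))); split.
  by rewrite -[leLHS]fineK// lee_fin le_max lexx.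
move=> t t0; apply: le_trans (vX t t0) _.
by rewrite -[X in (_ * X <= _)%E]fineK// -EFinM lee_fin le_max lexx orbT.
Qed.

Definition initial_gap tau : 'rV[R]_N -> R := (fun y => `|v tau y - v0 y|) \_ (Omega m).

Lemma initial_gap_ge0 tau y : 0 <= initial_gap tau y.
Proof. by rewrite /initial_gap /patch; case: ifP. Qed.

Lemma measurable_initial_gap tau : 0 < tau -> measurable_fun setT (initial_gap tau).
Proof.
move=> tau0; have [vt _ _ _] := hv; have [[cv _] _ _] := vt _ tau0.
apply: (proj1 (measurable_restrictT _ measurable_Omega)).
apply: measurable_funS measurableT _ _ => //.
apply: measurableT_comp => //; apply: measurable_funB; last exact: measurable_initial.
exact: measurable_continuous_rV.
Qed.

(* On an annulus the L^1_loc convergence applies; the weighted bounds give an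
   integrable majorant independent of tau, so the complement contributes little. *)
Lemma initial_gap_integral T x e : 0 < T -> sector m x -> 0 < e ->
  \forall tau \near (0 : R)^'+,
    (\int[mu]_y (okernel m (T - tau) x y * initial_gap tau y)%:E <= e%:E)%E.
Proof.
move=> T0 sx e0; have [vt _ vL _] := hv; have [M [M1 M2]] := weight_finite.
have [G iG [G0 HG]] := okernel_weight_dominated m1 gamma0 gammaN T0 sx.
have T2 : 0 < T / 2 by rewrite divr_gt0.
have e20 : 0 < e / 2 by rewrite divr_gt0.
have Npos : (0 < N)%N by case/andP: m1; exact: leq_trans.
pose K n : set 'rV[R]_N := [set y | n.+1%:R^-1 <= `|y| <= n.+1%:R].
have cnorm : continuous (fun y : 'rV[R]_N => `|y|) by move=> y; exact: norm_continuous.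
have KE n : K n = [set y | `|y| <= n.+1%:R] `&` [set y | n.+1%:R^-1 <= `|y|].
  by apply/seteqP; split => y /=; rewrite /K /= ; [case/andP|move=> [-> ->]].
have cK n : compact (K n).
  rewrite KE; apply: compact_closedI; first exact: compact_rV_ball.
  rewrite (_ : [set y | _] = (fun y : 'rV[R]_N => `|y|) @^-1` [set r | n.+1%:R^-1 <= r])//.
  by apply: closed_comp; [move=> y _; exact: cnorm|exact: closed_ge].
have mK n : measurable (K n).
  rewrite -[K n]setCK; apply: measurableC; apply: measurable_open_rV; rewrite openC.
  by apply: compact_closed (cK n); exact: norm_hausdorff.
have K0 n : ~ K n 0.
  by rewrite /K /= normr0 => /andP[h _]; have := lt_le_trans (_ : 0 < n.+1%:R^-1 :> R) h; rewrite ltxx invr_gt0 ltr0n; move=> /(_ isT).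
(* The origin belongs to no K n; removing it makes the indicators of W n tend to 0 at every
   point. *)
pose W n : set 'rV[R]_N := ~` K n `&` [set y | y != 0].
have mW n : measurable (W n).
  apply: measurableI; first exact: measurableC.
  rewrite (_ : [set y | _] = ~` [set (0 : 'rV[R]_N)]); last first.
    by apply/seteqP; split => y /= /eqP.
  apply: measurableC; rewrite -[X in measurable X]setCK; apply: measurableC.
  by apply: measurable_open_rV; rewrite openC; exact: (accessible_closed_set1 (hausdorff_accessible (@norm_hausdorff _ _))).
have intW : (\int[mu]_y ((G \_ (W n)) y)%:E)%E @[n --> \oo] --> (\int[mu]_y (cst 0 y))%E.
  apply: (dominated_cvg measurableT (g := EFin \o G)) => //.
  - move=> n; apply/measurable_EFinP; apply: (proj1 (measurable_restrictT _ (mW n))).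
    apply: measurable_funS measurableT _ _ => //.
    by apply/measurable_EFinP; exact: measurable_int iG.
  - move=> y _; have [->|y0] := eqVneq y 0.
      rewrite (_ : (fun n => _) = cst 0%E); first exact: cvg_cst.
      by apply/funext => n; rewrite patchE memNset// => -[_]; rewrite /= eqxx.
    apply: cvg_near_cst; near=> n; rewrite patchE memNset// => -[+ _]; apply.
    have y0' : 0 < `|y| by rewrite normr_gt0.
    apply/andP; split.
      rewrite -[leRHS]invrK lef_pV2 ?posrE ?ltr0n ?invr_gt0//.
      apply: (@le_trans _ _ n%:R); last by rewrite ler_nat.
      by near: n; exact: nbhs_infty_ger.
    apply: (@le_trans _ _ n%:R); last by rewrite ler_nat.
    by near: n; exact: nbhs_infty_ger.
  - move=> n y _ /=; rewrite lee_fin ger0_norm; rewrite /patch; case: ifP => // _.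
rewrite integral0 in intW.
have M0 : 0 <= M by rewrite -lee_fin; apply: le_trans M1; exact: Lnorm_ge0.
have eM : 0 < e / 2 / (2 * M + 1) by rewrite divr_gt0// ltr_wpDl// mulr_ge0.
have eME : (0 < (e / 2 / (2 * M + 1))%:E)%E by rewrite lte_fin.
have nW : \forall n \near \oo,
    (\int[mu]_y ((G \_ (W n)) y)%:E < (e / 2 / (2 * M + 1))%:E)%E.
  exact: (intW _ (open_ereal_lt' eME)).
have [n hn] := filter_ex nW.
pose S := \prod_(j < N) (Num.sqrt (4 * pi * (T / 2)))^-1 : R.
have S0 : 0 <= S by apply: prodr_ge0 => j _; rewrite invr_ge0 sqrtr_ge0.
have kS t y : T / 2 <= t -> sector m y -> 0 <= okernel m t x y <= S.
  move=> tt sy; have t0 : 0 < t by exact: lt_le_trans tt.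
  have /andP[k0 k1] := okernel_le_gaussN t0 sx sy; rewrite k0/=.
  apply: le_trans k1 _; apply: ler_prod => j _; rewrite gauss_ge0/=.
  apply: le_trans (gauss_ub _ t0) _.
  have pp : 0 < 4 * pi :> R by rewrite mulr_gt0// pi_gt0.
  have p1 : 0 < 4 * pi * t by rewrite mulr_gt0.
  have p2 : 0 < 4 * pi * (T / 2) by rewrite mulr_gt0.
  rewrite lef_pV2 ?posrE ?sqrtr_gt0//; apply: ler_wsqrtr.
  by rewrite ler_pM2l.
have eS : 0 < e / 2 / (S + 1) by rewrite divr_gt0// ltr_wpDl.
have eSE : (0 < (e / 2 / (S + 1))%:E)%E by rewrite lte_fin.
have hL := vL _ (cK n) (K0 n) _ (open_ereal_lt' eSE).
near=> tau.
have tau0 : 0 < tau by near: tau; exact: nbhs_right_gt.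
have tauT : tau <= T / 2 by near: tau; exact: nbhs_right_le.
have hI : (\int[mu]_(y in K n) `|v tau y - v0 y|%:E < (e / 2 / (S + 1))%:E)%E.
  by near: tau; exact: hL.
have Tt : T / 2 <= T - tau <= T by apply/andP; split; lra.
have mgap := measurable_initial_gap tau0.
have cv : continuous (v tau) by have [[cv _] _ _] := vt _ tau0.
have md : measurable_fun setT (fun y => `|v tau y - v0 y|).
  apply: measurableT_comp => //; apply: measurable_funB; last exact: measurable_initial.
  exact: measurable_continuous_rV.
pose f1 y := (fun y => `|v tau y - v0 y|) \_ (K n) y.
pose f2 y := (G \_ (W n)) y.
have f10 y : 0 <= f1 y by rewrite /f1 /patch; case: ifP.
have f20 y : 0 <= f2 y by rewrite /f2 /patch; case: ifP.
have mf1 : measurable_fun setT f1.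
  apply: (proj1 (measurable_restrictT _ (mK n))).
  exact: measurable_funS measurableT _ md.
have mf2 : measurable_fun setT f2.
  apply: (proj1 (measurable_restrictT _ (mW n))).
  apply: measurable_funS measurableT _ _ => //.
  by apply/measurable_EFinP; exact: measurable_int iG.
have Tt0 : 0 < T - tau by lra.
(* On K n the kernel is at most S, as its time is at least T/2. Off K n both v(tau) and v0 satisfy
   the weighted bound M, so the integrand is at most 2 M G. *)
apply: (@le_trans _ _ (\int[mu]_y (S%:E * (f1 y)%:E + (2 * M)%:E * (f2 y)%:E))%E).
  apply: ae_ge0_le_integral => //.
  - move=> y _; rewrite lee_fin; have [Oy|Oy] := pselect (Omega m y).
      rewrite mulr_ge0 ?initial_gap_ge0//.
      by have /andP[] := okernel_le_gaussN Tt0 sx (Omega_sector Oy).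
    by rewrite /initial_gap patchE memNset// mulr0.
  - apply/measurable_EFinP; apply: measurable_funM => //.
    exact: measurable_okernel.
  - by move=> y _; rewrite adde_ge0// mule_ge0// lee_fin// mulr_ge0.
  - apply: emeasurable_funD; apply: emeasurable_funM => //; exact/measurable_EFinP.
  have := @ae_coord_neq0 R N; have := Xnorm_le_ae (M2 _ tau0); have := Xnorm_le_ae M1.
  apply: filterS3 => y h1 h2 y0 _; rewrite -!EFinM -EFinD lee_fin.
  have [Oy|Oy] := pselect (Omega m y); last first.
    by rewrite /initial_gap patchE memNset// mulr0 addr_ge0 ?mulr_ge0.
  rewrite /initial_gap patchE mem_set//.
  have [Ky|Ky] := pselect (K n y).
    rewrite /f1 patchE mem_set//; apply: (@le_trans _ _ (S * `|v tau y - v0 y|)).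
      apply: ler_wpM2r => //.
      by have /andP[] := kS (T - tau) y (proj1 (andP Tt)) (Omega_sector Oy).
    by rewrite lerDl !mulr_ge0.
  have Wy : W n y.
    split=> //=; apply: contraNneq (y0 (Ordinal Npos)) => ->; by rewrite mxE.
  rewrite /f2 patchE mem_set//; apply: (@le_trans _ _ (2 * M * G y)); last first.
    by rewrite lerDr mulr_ge0.
  have k0 : 0 <= okernel m (T - tau) x y.
    by have /andP[] := okernel_le_gaussN Tt0 sx (Omega_sector Oy).
  apply: (@le_trans _ _ (okernel m (T - tau) x y * (`|v tau y| + `|v0 y|))).
    by apply: ler_wpM2l => //; exact: ler_normB.
  have := HG _ _ _ _ Tt Oy y0 (h1 Oy); have := HG _ _ _ _ Tt Oy y0 (h2 Oy).
  by rewrite mulrDr; lra.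
rewrite ge0_integralD//=; last 4 first.
- by move=> y _; rewrite mule_ge0// lee_fin.
- by apply: emeasurable_funM => //; exact/measurable_EFinP.
- by move=> y _; rewrite mule_ge0// lee_fin// mulr_ge0.
- by apply: emeasurable_funM => //; exact/measurable_EFinP.
rewrite !ge0_integralZl//; try (by exact/measurable_EFinP); try (by move=> y _; rewrite lee_fin);
  try (by rewrite lee_fin// mulr_ge0).
have -> : (\int[mu]_y (f1 y)%:E = \int[mu]_(y in K n) `|v tau y - v0 y|%:E)%E.
  rewrite [RHS]integral_mkcond; apply: eq_integral => y _.
  by rewrite /f1 /patch; case: ifP.
rewrite (_ : e = e / 2 + e / 2); last by field.
rewrite EFinD; apply: leeD.
  apply: (@le_trans _ _ (S%:E * (e / 2 / (S + 1))%:E)%E).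
    by apply: lee_wpmul2l; [rewrite lee_fin|exact: ltW].
  rewrite -EFinM lee_fin mulrA ler_pdivrMr ?ltr_wpDl// mulrC ler_wpM2l ?ltW//.
  by rewrite ltrDl.
apply: (@le_trans _ _ ((2 * M)%:E * (e / 2 / (2 * M + 1))%:E)%E).
  apply: lee_wpmul2l; first by rewrite lee_fin mulr_ge0.
  by apply: ltW; apply: hn.
rewrite -EFinM lee_fin mulrA ler_pdivrMr ?ltr_wpDl// ?mulr_ge0//.
rewrite mulrC ler_wpM2l ?ltW//.
by rewrite ltrDl.
Unshelve. all: by end_near. Qed.

Hypotheses (alpha0 : 0 < alpha).
Hypothesis v0_ge0 : {ae mu, forall x, Omega m x -> 0 <= v0 x}.
Variable w : R -> 'rV[R]_N -> R.
Hypothesis hw : is_bounded_solution alpha (antisym_ext m (cst 1)) w.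

(** At a small tau, the positive part of the difference is bounded by e, for the distance of the
    dilated solution to its bound Q, plus Q on the bad points, plus the gap |v(tau) - v0|. Against
    the kernel these contribute at most e, Q times the bad mass, and e. The kernel runs for a time T
    - tau between T/2 and T, whence 2 pi T in place of 4 pi T and [tail] at T. *)
Lemma flow_lower_bound nu a r T x : 0 < nu -> 0 < T -> 0 <= a -> 0 <= r -> sector m x ->
  {ae mu, forall y : 'rV[R]_N, (forall i : 'I_N, (i < m)%N -> a < y ord0 i) ->
    (forall j, `|x ord0 j - y ord0 j| <= r) -> nu `^ (2 / alpha) <= v0 y} ->
  dilation alpha nu w T x - v T x <=
    nu `^ (2 / alpha) * (N%:R * (a / Num.sqrt (2 * pi * T) + tail T r)).
Proof.
move=> nu0 T0 a0 r0 sx; set Q := nu `^ (2 / alpha) => v0Q.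
have Q0 : 0 < Q by exact: powR_gt0.
have nu20 : 0 < nu ^+ 2 by rewrite exprn_gt0.
apply/ler_addgt0Pr => e' e'0; pose e := e' / 2.
have e0 : 0 < e by rewrite divr_gt0.
have eQ : 0 < e / Q by rewrite divr_gt0.
have T2 : 0 < T / 2 by rewrite divr_gt0.
have nearw := near_right0_scale nu20 (near_initial hw eQ).
have neari := initial_gap_integral T0 sx e0.
have near0 : \forall tau \near (0 : R)^'+, [/\ 0 < tau, tau <= T / 2,
    (forall y, `|w (nu ^+ 2 * tau) y - heat (nu ^+ 2 * tau) (antisym_ext m (cst 1)) y| < e / Q) &
    (\int[mu]_y (okernel m (T - tau) x y * initial_gap tau y)%:E <= e%:E)%E].
  near=> tau; split.
  - by near: tau; exact: nbhs_right_gt.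
  - by near: tau; exact: nbhs_right_le.
  - by near: tau; exact: nearw.
  - by near: tau; exact: neari.
have [tau [tau0 tauT hwt hi]] := filter_ex near0.
have Tt0 : 0 < T - tau by lra.
have rv : regular_solution m alpha v := regular_flow hv.
have rd : regular_solution m alpha (dilation alpha nu w).
  exact: (regular_dilation alpha0 nu0 (regular_sign_solution alpha0 hw)).
have [_ rv2 _ rv4] := rv; have [_ rd2 _ _] := rd.
have dQ y : dilation alpha nu w tau y <= Q + e.
  have := hwt (nu *: y); have := heat_sign_le1 m (nu *: y) (mulr_gt0 nu20 tau0).
  rewrite /dilation -/Q; set W := w _ _; set H := heat _ _ _ => H1 WH.
  have : W <= 1 + e / Q by move: H1 WH; rewrite ltr_norml ler_norml; lra.
  by rewrite -(ler_pM2l Q0) mulrDr mulr1 mulrCA divff ?gt_eqF// mulr1.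
have tauT' : tau < T by lra.
have := comparison_heat_pot alpha0 rd rv tau0 tauT' sx; set f := pos_diff _ _ _ _.
have [[M1 HM1] c1] := rd2 _ tau0; have [[M2 HM2] c2] := rv2 _ tau0.
have mf : measurable_fun setT f by exact: measurable_pos_diff.
have fE y : sector m y -> f y = Num.max 0 (dilation alpha nu w tau y - v tau y).
  by move=> sy; rewrite /f /pos_diff patchE mem_set.
have fN y : ~ sector m y -> f y = 0 by move=> sy; rewrite /f /pos_diff patchE memNset.
have f0 y : 0 <= f y.
  by have [sy|sy] := pselect (sector m y); [rewrite fE// le_max lexx|rewrite fN].
have fM y : `|f y| <= M1 + M2.
  have [sy|sy] := pselect (sector m y); last first.
    by rewrite fN// normr0 addr_ge0//; [exact: le_trans (HM1 0)|exact: le_trans (HM2 0)].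
  rewrite ger0_norm// fE// ge_max; have := HM1 y; have := HM2 y.
  by rewrite !ler_norml => /andP[h1 h2] /andP[h3 h4]; apply/andP; split; lra.
have [ig g1] := @integrable_gaussN R N _ x Tt0.
have [iB B0 BI] := @integral_bad_mass R N _ x a r Tt0 a0 r0.
set B := (fun y => \sum_(i < N) _) in iB B0 BI.
have bw i y : 0 <= bad_weight a r (x ord0 i) (y ord0 i) by rewrite /bad_weight !indicE addr_ge0.
have Bge y i : 1 <= bad_weight a r (x ord0 i) (y ord0 i) -> gaussN (T - tau) x y <= B y.
  move=> h; rewrite /B (bigD1 i)//=; apply: (@le_trans _ _
    (gaussN (T - tau) x y * bad_weight a r (x ord0 i) (y ord0 i))).
    by apply: ler_peMr => //; exact: gaussN_ge0.
  by rewrite lerDl; apply: sumr_ge0 => j _; rewrite mulr_ge0 ?gaussN_ge0.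
have kf0 y : 0 <= okernel m (T - tau) x y * f y.
  have [sy|sy] := pselect (sector m y); last by rewrite fN// mulr0.
  by rewrite mulr_ge0//; have /andP[] := okernel_le_gaussN Tt0 sx sy.
have kg0 y : 0 <= okernel m (T - tau) x y * initial_gap tau y.
  have [Oy|Oy] := pselect (Omega m y).
    rewrite mulr_ge0 ?initial_gap_ge0//.
    by have /andP[] := okernel_le_gaussN Tt0 sx (Omega_sector Oy).
  by rewrite /initial_gap patchE memNset// mulr0.
have mk := measurable_okernel m x Tt0.
have mB : measurable_fun setT (EFin \o B) by exact: measurable_int iB.
have mg : measurable_fun setT (EFin \o gaussN (T - tau) x) by exact: measurable_int ig.
have mkg : measurable_fun setT
    (EFin \o (fun y => okernel m (T - tau) x y * initial_gap tau y)).
  apply/measurable_EFinP; apply: measurable_funM => //.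
  exact: measurable_initial_gap.
have E1 y : (0 <= e%:E * (gaussN (T - tau) x y)%:E)%E.
  by rewrite -EFinM lee_fin mulr_ge0 ?gaussN_ge0// ltW.
have QB0 y : 0 <= Q * B y := mulr_ge0 (ltW Q0) (B0 y).
have E2 y : (0 <= Q%:E * (B y)%:E)%E by rewrite -EFinM lee_fin; exact: QB0.
have E3 y : (0 <= (okernel m (T - tau) x y * initial_gap tau y)%:E)%E by rewrite lee_fin.
have key : (\int[mu]_y (okernel m (T - tau) x y * f y)%:E <=
    (e + Q * (N%:R * (a / Num.sqrt (2 * pi * T) + tail T r)) + e)%:E)%E.
  apply: (@le_trans _ _ (\int[mu]_y ((e%:E * (gaussN (T - tau) x y)%:E + Q%:E * (B y)%:E) +
      (okernel m (T - tau) x y * initial_gap tau y)%:E))%E).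
    apply: ae_ge0_le_integral => //.
    - by move=> y _; rewrite lee_fin.
    - by apply/measurable_EFinP; exact: measurable_funM.
    - by move=> y _; rewrite !adde_ge0.
    - by apply: emeasurable_funD => //; apply: emeasurable_funD; exact: emeasurable_funM.
    move: v0Q; apply: filterS2 v0_ge0 => y v0y v0Qy _.
    rewrite -!EFinM -!EFinD lee_fin.
    have [sy|sy] := pselect (sector m y); last first.
      by rewrite fN// mulr0 !addr_ge0// mulr_ge0 ?gaussN_ge0// ltW.
    have /andP[k0 kG] := okernel_le_gaussN Tt0 sx sy.
    set k := okernel _ _ _ _ in k0 kG *; set G := gaussN _ _ _ in kG *.
    have fQ : f y <= Q + e - v tau y \/ f y = 0.
      rewrite fE//; have := dQ y; case: (leP 0 (dilation alpha nu w tau y - v tau y)) => h.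
        by left; lra.
      by right.
    have G0 : 0 <= G by exact: gaussN_ge0.
    have ekG : k * e <= e * G by rewrite mulrC ler_pM2l.
    have QB := QB0 y.
    have gap0 := initial_gap_ge0 tau y.
    have kgap0 : 0 <= k * initial_gap tau y by rewrite mulr_ge0.
    have eG0 : 0 <= e * G by rewrite mulr_ge0// ltW.
    case: fQ => [fQ|->]; last by rewrite mulr0 !addr_ge0.
    have kfQ : k * f y <= k * (Q + e - v tau y) by rewrite ler_wpM2l.
    (* Nothing is known of v0 on a face; there v(tau) = 0, and the coordinate 0 lies in [0, a], so
       the point counts as bad. *)
    have [Oy|Oy] := pselect (Omega m y); last first.
      move: Oy => /existsNP[i /not_implyP[im /negP]]; rewrite -leNgt => yi.
      have yi0 : y ord0 i = 0 by apply/eqP; rewrite eq_le yi sy.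
      have vt0 := antisym_face (rv4 _ tau0) im yi0.
      have hB : Q * G <= Q * B y.
        rewrite ler_pM2l//; apply: (Bge y i); rewrite yi0 /bad_weight !indicE mem_set ?lerDl//=.
        by rewrite in_itv/= lexx.
      have : k * Q <= Q * G by rewrite mulrC ler_pM2l.
      move: kfQ; rewrite vt0 subr0 mulrDr; lra.
    have hgap : k * (v0 y - v tau y) <= k * initial_gap tau y.
      apply: ler_wpM2l => //; rewrite /initial_gap patchE mem_set// distrC.
      exact: ler_norm.
    have [[i bi]|nb] := pselect (exists i, 1 <= bad_weight a r (x ord0 i) (y ord0 i)).
      have hB : Q * G <= Q * B y by rewrite ler_pM2l//; exact: Bge bi.
      have : k * Q <= Q * G by rewrite mulrC ler_pM2l.
      have : 0 <= k * v0 y by rewrite mulr_ge0// v0y.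
      by lra.
    have nbj j : ~~ (0 <= y ord0 j <= a) /\ x ord0 j - r < y ord0 j < x ord0 j + r.
      have := nb; rewrite -forallNP => /(_ j); rewrite /bad_weight !indicE.
      rewrite !mem_setE /= in_setC !mem_setE !in_itv/=.
      by do 2!case: (_ && _); rewrite ?addr0 ?add0r ?lerDl ?lexx// => nb'; split=> //; exfalso; exact: nb'.
    have : Q <= v0 y.
      apply: v0Qy => [i im|j].
        by have [] := nbj i; rewrite sy//= -ltNge.
      by have [_ /andP[h1 h2]] := nbj j; rewrite ler_norml; apply/andP; split; lra.
    by move=> hQ; have := ler_wpM2l k0 hQ; lra.
  rewrite ge0_integralD//=; last 2 first.
  - by move=> y _; rewrite adde_ge0.
  - by apply: emeasurable_funD; exact: emeasurable_funM.
  rewrite ge0_integralD//=; last 2 first.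
  - exact: emeasurable_funM.
  - exact: emeasurable_funM.
  rewrite !ge0_integralZl//; try (by rewrite lee_fin ltW);
    try (by move=> y _; rewrite lee_fin// gaussN_ge0);
    try (by move=> y _; rewrite lee_fin; exact: B0).
  have -> : (\int[mu]_y (gaussN (T - tau) x y)%:E = 1%:E)%E.
    by rewrite -g1 /Rintegral fineK//; exact: integrable_fin_num.
  have -> : (\int[mu]_y (B y)%:E = (\int[mu]_y B y)%:E)%E.
    by rewrite /Rintegral fineK//; exact: integrable_fin_num.
  rewrite -!EFinM !EFinD mulr1; apply: leeD => //; rewrite leeD2l// lee_fin ler_pM2l//.
  apply: le_trans BI _; apply: ler_wpM2l => //.
  have pp : 0 < pi :> R by exact: pi_gt0.
  apply: lerD.
    apply: ler_wpM2l => //; rewrite lef_pV2 ?posrE ?sqrtr_gt0 ?mulr_gt0//.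
    apply: ler_wsqrtr; rewrite [leRHS](_ : _ = 2 * pi * (2 * (T - tau))); last by ring.
    by rewrite ler_pM2l ?mulr_gt0//; lra.
  rewrite /tail ler_wpM2l ?sqrtr_ge0// ler_expR lerN2; apply: ler_wpM2l; first exact: sqr_ge0.
  by rewrite lef_pV2 ?posrE ?mulr_gt0// ler_pM2l//; lra.
have intk : mu.-integrable setT (EFin \o (fun y => okernel m (T - tau) x y * f y)).
  exact: (integrable_heat_pot m mf fM).
move/le_trans; apply; rewrite -lee_fin /heat_pot /Rintegral fineK; last exact: integrable_fin_num.
apply: le_trans key _; rewrite lee_fin /e; lra.
Unshelve. all: by end_near. Qed.

End initial_data.

(** * Convergence *)

Section convergence.
Context {R : realType} {N : nat}.
Variables (m : nat) (gamma alpha C R0 c0 : R).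
Hypotheses (m1 : (1 <= m <= N)%N) (gamma0 : 0 < gamma) (gammaN : gamma < N%:R).
Hypotheses (alpha0 : 0 < alpha) (alpha1 : alpha < 2 / (gamma + m%:R)).
Implicit Types (x y : 'rV[R]_N) (t l mu : R).
Local Notation leb := (lebesgue_rV N : {measure set _ -> \bar R}).
Variables (v0 : 'rV[R]_N -> R) (v w V : R -> 'rV[R]_N -> R).
Hypotheses (hv0 : antisym_Xspace m gamma v0).
Hypothesis v0_ge0 : {ae leb, forall x, Omega m x -> 0 <= v0 x}.
Hypothesis hv : is_flow m gamma alpha C v0 v.
Hypothesis c00 : 0 < c0.
Hypothesis v0_ge : {ae leb, forall x, Omega m x -> R0 <= enorm x -> c0 * psi0 m gamma x <= v0 x}.
Hypothesis hw : is_bounded_solution alpha (antisym_ext m (cst 1)) w.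
Hypothesis hV : dilation_limit alpha w V.

Let cpsi : R := \prod_(k < m) (gamma + (2 * k)%:R).

Let cpsi0 : 0 < cpsi.
Proof. by apply: prodr_gt0 => k _; rewrite ltr_wpDr. Qed.

Lemma enorm_le y (M : R) : (forall j, `|y ord0 j| <= M) -> enorm y <= N%:R * M.
Proof.
move=> yM; have /andP[m0 mN] := m1; have Npos := leq_trans m0 mN.
have M0 : 0 <= M by exact: le_trans (yM (Ordinal Npos)).
rewrite -[leRHS]ger0_norm ?mulr_ge0// -sqrtr_sqr ler_wsqrtr//.
apply: (@le_trans _ _ (\sum_(j < N) M ^+ 2)).
  by apply: ler_sum => j _; rewrite -real_normK ?num_real// lerXn2r ?nnegrE.
rewrite sumr_const card_ord exprMn -[leLHS]mulr_natl; apply: ler_wpM2r; first exact: sqr_ge0.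
by rewrite expr2 ler_peMl// ler1n.
Qed.

Lemma psi0_ge y (d E : R) : 0 < d -> (forall i : 'I_N, (i < m)%N -> d <= y ord0 i) ->
  enorm y <= E -> cpsi * d ^+ m * E `^ (- (gamma + (2 * m)%:R)) <= psi0 m gamma y.
Proof.
move=> d0 yd yE; have /andP[m0 mN] := m1; have Npos := leq_trans m0 mN.
have e0 : 0 < enorm y.
  apply: lt_le_trans (norm_le_enorm y); apply: lt_le_trans (coord_le_norm y (Ordinal Npos)).
  by rewrite normr_gt0 gt_eqF// (lt_le_trans d0)// yd.
rewrite /psi0 -/cpsi -opprD; apply: ler_pM; rewrite ?powR_ge0//.
- by rewrite mulr_ge0 ?exprn_ge0 ?(ltW cpsi0) ?(ltW d0).
- rewrite ler_pM2l// (_ : d ^+ m = \prod_(i < N | (i < m)%N) d).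
    by apply: ler_prod => i im; rewrite (ltW d0) yd.
  by rewrite -(big_ord_widen N (fun=> d) mN) prodr_const card_ord.
- have p0 : 0 < gamma + (2 * m)%:R by rewrite ltr_wpDr.
  rewrite !powRN lef_pV2 ?posrE ?powR_gt0// ?(lt_le_trans e0 yE)//.
  apply: ge0_ler_powR; rewrite ?nnegrE ?(ltW p0) ?(ltW e0)//.
  by rewrite (le_trans (ltW e0) yE).
Qed.

(** On this region the first m coordinates are at least d l and |y| is at most a multiple of l, so
    c0 psi0 is at least k l^m l^(-gamma-2m) = k l^(-gamma-m). Since 2/alpha > gamma + m,
    (mu/l)^(2/alpha) decays faster; k depends on d, L and M but not on x. *)
Lemma initial_ge (M d L mu : R) : 0 <= M -> 0 < d -> 0 < L -> 0 < mu ->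
  \forall l \near +oo, forall x, `|x| <= M ->
    {ae leb, forall y : 'rV[R]_N, (forall i : 'I_N, (i < m)%N -> d * l < y ord0 i) ->
      (forall j, `|(l *: x) ord0 j - y ord0 j| <= L * l) -> (mu / l) `^ (2 / alpha) <= v0 y}.
Proof.
move=> M0 d0 L0 mu0; have /andP[m0 mN] := m1; have Npos := leq_trans m0 mN.
pose B := N%:R * (M + L); pose p := gamma + (2 * m)%:R.
have B0 : 0 < B by rewrite mulr_gt0 ?ltr0n// ltr_wpDl.
pose k := c0 * (cpsi * d ^+ m * B `^ (- p)).
have k0 : 0 < k by rewrite !mulr_gt0 ?exprn_gt0 ?powR_gt0.
have q0 : 0 < 2 / alpha - (gamma + m%:R).
  have gm : 0 < gamma + m%:R by rewrite ltr_wpDr.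
  by rewrite subr_gt0 ltr_pdivlMr// mulrC -ltr_pdivlMr.
near=> l => x xM.
have l0 : 0 < l by near: l; exact: nbhs_pinfty_gt.
have lR : R0 / d <= l by near: l; apply: nbhs_pinfty_ge; rewrite num_real.
have lA : mu `^ (2 / alpha) / k <= l `^ (2 / alpha - (gamma + m%:R)).
  by near: l; exact: powR_pinfty.
apply: filterS v0_ge => y hy yd xy.
have dl0 : 0 < d * l by rewrite mulr_gt0.
have Oy : Omega m y by move=> i im; exact: lt_trans (yd i im).
(* As m >= 1, the first coordinate of y exceeds d l >= R0. *)
have yR : R0 <= enorm y.
  apply: le_trans (norm_le_enorm y); apply: le_trans (coord_le_norm y (Ordinal Npos)).
  apply: (le_trans _ (ler_norm _)); apply: (le_trans _ (ltW (yd (Ordinal Npos) m0))).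
  by rewrite mulrC -ler_pdivrMr.
have yB : enorm y <= l * B.
  rewrite /B mulrCA; apply: enorm_le => j.
  have := xy j; have := le_trans (coord_le_norm x j) xM; rewrite mxE => h1 h2.
  have h3 : `|l * x ord0 j| <= l * M by rewrite normrM (gtr0_norm l0) ler_pM2l.
  have := ler_normB (l * x ord0 j) (l * x ord0 j - y ord0 j).
  by rewrite subKr mulrDr; lra.
apply: le_trans (hy Oy yR).
have := psi0_ge dl0 (fun i im => ltW (yd i im)) yB.
rewrite -/p -(ler_pM2l c00); apply: le_trans.
have -> : c0 * (cpsi * (d * l) ^+ m * (l * B) `^ (- p)) = k * l `^ (- (gamma + m%:R)).
  rewrite /k exprMn powRM ?ltW// -[l ^+ m]powR_mulrn ?ltW//.
  have -> : l `^ (- (gamma + m%:R)) = l `^ m%:R * l `^ (- p).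
    rewrite -powRD; last by rewrite (gt_eqF l0) implybT.
    by congr (_ `^ _); rewrite /p natrM; ring.
  by ring.
have -> : (mu / l) `^ (2 / alpha) = mu `^ (2 / alpha) * l `^ (- (2 / alpha)).
  by rewrite powRM ?invr_ge0 ?(ltW mu0) ?(ltW l0)// -(powR_inv1 (ltW l0)) -powRrM mulN1r.
have -> : l `^ (- (gamma + m%:R)) = l `^ (2 / alpha - (gamma + m%:R)) * l `^ (- (2 / alpha)).
  rewrite -powRD; last by rewrite (gt_eqF l0) implybT.
  by congr (_ `^ _); ring.
rewrite mulrA; apply: ler_wpM2r; first exact: powR_ge0.
by rewrite [leRHS]mulrC -ler_pdivrMr.
Unshelve. all: by end_near. Qed.

Lemma antisym_normr (f : 'rV[R]_N -> R) x : antisymmetric_fun m f ->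
  `|f x| = `|f (\row_j (if (j < m)%N then `|x ord0 j| else x ord0 j))|.
Proof.
(* The negative coordinates are reflected one at a time, each reflection changing only the sign of
   f. *)
move=> af; pose h k : 'rV[R]_N :=
  \row_j (if (j < m)%N && (j < k)%N then `|x ord0 j| else x ord0 j).
suff key k : (k <= N)%N -> `|f (h k)| = `|f x|.
  rewrite -(key N (leqnn N)); congr (`|f _|); apply/rowP => j.
  by rewrite !mxE ltn_ord andbT.
elim: k => [_|k IH kN].
  by congr (`|f _|); apply/rowP => j; rewrite mxE andbF.
rewrite -(IH (ltnW kN)); pose i := Ordinal kN.
have hE (j : 'I_N) : j != i -> (j < k.+1)%N = (j < k)%N.
  by move=> ji; rewrite ltnS leq_eqVlt; case: eqP => // jk; case/eqP: ji; exact: val_inj.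
have [im|im] := boolP (k < m)%N; last first.
  congr (`|f _|); apply/rowP => j; rewrite !mxE.
  by have [->|ji] := eqVneq j i; [rewrite /= (negPf im)|rewrite hE].
have [xi|xi] := leP 0 (x ord0 i).
  congr (`|f _|); apply/rowP => j; rewrite !mxE.
  have [->|ji] := eqVneq j i; last by rewrite hE.
  by rewrite /= im ltnSn ltnn ger0_norm.
rewrite -[RHS]normrN -(af i _ im); congr (`|f _|); apply/rowP => j; rewrite !mxE.
have [->|ji] := eqVneq j i; last by rewrite hE.
by rewrite /= im ltnSn ltnn ltr0_norm.
Qed.

Lemma rescaled_cvg_sector (M e : R) : 0 <= M -> 0 < e ->
  \forall l \near +oo, forall x, sector m x -> `|x| <= M ->
    `|V 1 x - l `^ (2 / alpha) * v (l ^+ 2) (l *: x)| < e.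
Proof.
move=> M0 e0; have /andP[m0 mN] := m1; have Npos := leq_trans m0 mN.
have e20 : 0 < e / 2 by rewrite divr_gt0.
pose K : set (R * 'rV[R]_N) := [set 1] `*` [set x | `|x| <= M].
have cK : compact K by apply: compact_setX; [exact: compact_set1|exact: compact_rV_ball].
have K0 : K `<=` [set p | 0 < p.1] by move=> p [/= -> _].
have nearmu : \forall mu \near +oo, 0 < mu /\
    forall p, K p -> `|V p.1 p.2 - dilation alpha mu w p.1 p.2| < e / 2.
  near=> mu; split; first by near: mu; exact: nbhs_pinfty_gt.
  by near: mu; exact: (dilation_limit_near hV cK K0 e20).
have [mu [mu0 hmu]] := filter_ex nearmu.
pose Q := mu `^ (2 / alpha); have Q0 : 0 < Q by exact: powR_gt0.
have N0 : 0 < N%:R :> R by rewrite ltr0n.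
(* Since mu, hence Q, is already fixed, the error Q N (2 eta) of the lower bound can be made e/4; d
   and L below each contribute one eta. *)
pose eta := e / (8 * Q * N%:R).
have eta0 : 0 < eta by rewrite divr_gt0// !mulr_gt0.
have etaE : Q * (N%:R * eta) = e / 8 by rewrite /eta; field; rewrite !gt_eqF.
have s2p : 0 < Num.sqrt (2 * pi) :> R by rewrite sqrtr_gt0 mulr_gt0// pi_gt0.
pose d := eta * Num.sqrt (2 * pi); have d0 : 0 < d by rewrite mulr_gt0.
have [s s0 hs] := tail_small (@ltr01 R) eta0.
(* [tail t r] depends only on r^2/t, so [tail 1 L] equals [tail s 1], which is small for small s. *)
pose L := (Num.sqrt s)^-1; have L0 : 0 < L by rewrite invr_gt0 sqrtr_gt0.
have tL : tail 1 L <= eta.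
  apply: le_trans (hs s _); last by rewrite s0 lexx.
  rewrite /tail /L exprVn sqr_sqrtr ?(ltW s0)// expr1n mulr1.
  by rewrite ler_wpM2l ?sqrtr_ge0// ler_expR lerN2 div1r invfM mulrC.
near=> l => x sx xM.
have l0 : 0 < l by near: l; exact: nbhs_pinfty_gt.
have hdata : {ae leb, forall y : 'rV[R]_N, (forall i : 'I_N, (i < m)%N -> d * l < y ord0 i) ->
      (forall j, `|(l *: x) ord0 j - y ord0 j| <= L * l) -> (mu / l) `^ (2 / alpha) <= v0 y}.
  by move: x xM sx; near: l; apply: filterS (initial_ge M0 d0 L0 mu0) => l h x xM _; exact: h.
have l20 : 0 < l ^+ 2 by rewrite exprn_gt0.
have Ll : 0 < l `^ (2 / alpha) by exact: powR_gt0.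
have slx : sector m (l *: x) by move=> i im; rewrite mxE mulr_ge0 ?(ltW l0)// sx.
have up : l `^ (2 / alpha) * v (l ^+ 2) (l *: x) <= V 1 x.
  have := flow_le_limit alpha0 hw hV (regular_flow hv) l20 slx.
  by rewrite (limit_scaling hV x l0 ltr01) mulr1 ler_pM2l.
have ml0 : 0 < mu / l by rewrite divr_gt0.
have low := flow_lower_bound m1 gamma0 gammaN hv0 hv alpha0 v0_ge0 hw ml0 l20
  (ltW (mulr_gt0 d0 l0)) (ltW (mulr_gt0 L0 l0)) slx hdata.
(* Dilating by mu/l and then by l is dilating by mu. The prefactor becomes Q, and the strip d l and
   radius L l at time l^2 become d and L at time 1, so no term of the error depends on l. *)
have {}low : dilation alpha mu w 1 x - l `^ (2 / alpha) * v (l ^+ 2) (l *: x) <=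
    Q * (N%:R * (2 * eta)).
  have QE : l `^ (2 / alpha) * (mu / l) `^ (2 / alpha) = Q.
    by rewrite -powRM ?divr_ge0 ?(ltW l0) ?(ltW mu0)// mulrCA divff ?gt_eqF// mulr1.
  have dE : l `^ (2 / alpha) * dilation alpha (mu / l) w (l ^+ 2) (l *: x) =
      dilation alpha mu w 1 x.
    rewrite -[l ^+ 2]mulr1 (@dilation_comp _ _ _ w (mu / l) l)// divfK ?gt_eqF//.
  move: low; rewrite -(ler_pM2l Ll) mulrBr dE [leRHS]mulrA QE => low.
  apply: le_trans low _; rewrite ler_pM2l// ler_pM2l//.
  have -> : d * l / Num.sqrt (2 * pi * l ^+ 2) = eta.
    rewrite sqrtrM ?mulr_ge0 ?pi_ge0// sqrtr_sqr gtr0_norm// /d.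
    by field; rewrite !gt_eqF.
  have -> : tail (l ^+ 2) (L * l) = tail 1 L.
    by rewrite /tail; congr (_ * expR (- _)); field; rewrite gt_eqF.
  lra.
have := hmu (1, x) (conj erefl xM); rewrite /= !ltr_norml => /andP[h1 h2].
have hE : Q * (N%:R * (2 * eta)) = e / 4.
  have -> : Q * (N%:R * (2 * eta)) = 2 * (Q * (N%:R * eta)) by ring.
  by rewrite etaE; field.
by rewrite hE in low; apply/andP; split; lra.
Unshelve. all: by end_near. Qed.

Lemma rescaled_cvg (M e : R) : 0 <= M -> 0 < e ->
  \forall l \near +oo, forall x, `|x| <= M ->
    `|V 1 x - l `^ (2 / alpha) * v (l ^+ 2) (l *: x)| < e.
Proof.
move=> M0 e0; near=> l => x xM.
have l0 : 0 < l by near: l; exact: nbhs_pinfty_gt.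
have key z : sector m z -> `|z| <= M ->
    `|V 1 z - l `^ (2 / alpha) * v (l ^+ 2) (l *: z)| < e.
  by move: z; near: l; exact: rescaled_cvg_sector.
pose F x := V 1 x - l `^ (2 / alpha) * v (l ^+ 2) (l *: x).
have aF : antisymmetric_fun m F.
  have [vt _ _ _] := hv; have [_ av _] := vt (l ^+ 2) (exprn_gt0 2 l0).
  apply: antisymB; first exact: (limit_antisym alpha0 hw hV).
  move=> i y im; rewrite -mulrN -(av i)//; congr (_ * v _ _).
  by apply/rowP => j; rewrite !mxE; case: eqP => // _; rewrite mulrN.
rewrite -/(F x) (antisym_normr x aF).
set z := \row_j _.
have : sector m z by move=> i im; rewrite mxE im.
have : `|z| <= M.
  apply/norm_rV_le => // j; rewrite mxE; have := le_trans (coord_le_norm x j) xM.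
  by case: ifP => // _; rewrite normr_id.
by move=> zM sz; exact: key.
Unshelve. all: by end_near. Qed.

End convergence.

Theorem theorem1p19 (R : realType) (N m : nat) (gamma alpha C : R)
    (v0 : 'rV[R]_N -> R) (v w V : R -> 'rV[R]_N -> R) (R0 c0 : R) :
  (1 <= N)%N -> (1 <= m <= N)%N ->
  0 < gamma < N%:R -> 0 < alpha -> alpha < 2 / (gamma + m%:R) ->
  antisym_Xspace m gamma v0 ->
  {ae lebesgue_rV N, forall x, Omega m x -> 0 <= v0 x} ->
  is_flow m gamma alpha C v0 v ->
  0 < R0 -> 0 < c0 ->
  {ae lebesgue_rV N, forall x,
    Omega m x -> R0 <= enorm x -> c0 * psi0 m gamma x <= v0 x} ->
  is_bounded_solution alpha (antisym_ext m (cst 1)) w ->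
  dilation_limit alpha w V ->
  let g := V 1 in
  [/\ Cbu_fun g, antisymmetric_fun m g,
      (forall t x, 0 < t ->
         V t x = t `^ (- alpha^-1) * g ((Num.sqrt t)^-1 *: x)) &
      forall K : set 'rV[R]_N, compact K ->
        {uniform K, (fun (t : R) x => t `^ alpha^-1 * v t (Num.sqrt t *: x))
           @ +oo --> g}].
Proof.
move=> _ m1 /andP[gamma0 gammaN] alpha0 alpha1 hv0 v0_ge0 hv R00 c00 v0_ge hw hV g.
split.
- exact: (limit_Cbu alpha0 hw hV).
- exact: (limit_antisym alpha0 hw hV).
- by move=> t x t0; exact: (limit_selfsimilar alpha0 hV x t0).
move=> K cK; apply/(uniform_cvgP (@proper_pinfty_nbhs R) K) => e e0.
have [M [_ HM]] := compact_bounded cK.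
have M1 : 0 <= `|M| + 1 by rewrite addr_ge0.
have [A [_ hA]] := rescaled_cvg m1 gamma0 gammaN alpha0 alpha1 hv0 v0_ge0 hv c00 v0_ge
  hw hV M1 e0.
near=> t => x Kx.
have t0 : 0 < t by near: t; exact: nbhs_pinfty_gt.
have tA : A < Num.sqrt t.
  have h : (`|A| + 1) ^+ 2 <= t.
    by near: t; apply: nbhs_pinfty_ge; rewrite num_real.
  apply: (@lt_le_trans _ _ (`|A| + 1)).
    by apply: le_lt_trans (ler_norm A) _; rewrite ltrDl.
  by rewrite -[leLHS]ger0_norm ?addr_ge0// -sqrtr_sqr ler_wsqrtr.
have xM : `|x| <= `|M| + 1.
  apply: HM Kx; apply: le_lt_trans (ler_norm M) _; by rewrite ltrDl.
have := hA _ tA x xM; rewrite sqr_sqrtr ?(ltW t0)//.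
rewrite (_ : Num.sqrt t `^ (2 / alpha) = t `^ alpha^-1)//.
by rewrite -powR12_sqrt ?(ltW t0)// -powRrM; congr (_ `^ _); field; rewrite gt_eqF.
Unshelve. all: by end_near. Qed.
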